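(* Let $(Q,L,D)$ be a nonholonomic system with a $G$-symmetry satisfying the dimension assumption $T_qQ=D_q+V_q$ for all $q\in Q$. Let $W$ be a $G$-invariant vertical complement of the constraints $D$ satisfying the vertical symmetry condition, and suppose that $\langle \mathcal{J},\mathcal{K}_{\mathcal W}\rangle(X_{\mathrm{nh}},\eta_{\mathcal M})=0$ for all $\eta\in\mathfrak g$. Then there are $k:=\operatorname{rank} S$ linearly independent horizontal gauge momenta of the form $$f_\eta=\langle \mathcal{J}^{\mathrm{nh}},P_{\mathfrak g_S}(\eta)\rangle,\qquad \eta\in\mathfrak g.$$
   Context: All manifolds, distributions and maps are smooth; distributions are regular (constant rank); group actions are free and proper. Nonholonomic system. $(Q,L,D)$ consists of a manifold $Q$, a Lagrangian $L:TQ\to\mathbb R$ of mechanical type ($L=$ kinetic energy of a Riemannian metric $\kappa$ minus a potential on $Q$) and a (non-integrable) distribution $D\subset TQ$. Let $\kappa^\flat:TQ\to T^*Q$, $\kappa^\flat(X)(Y)=\kappa(X,Y)$. The constraint submanifold is the vector subbundle $\mathcal M=\kappa^\flat(D)\subset T^*Q$, with inclusion $\iota:\mathcal M\to T^*Q$ and projection $\tau_{\mathcal M}:\mathcal M\to Q$. $\mathcal H:T^*Q\to\mathbb R$ is the Hamiltonian associated to $L$, $\mathcal H_{\mathcal M}=\iota^*\mathcal H$. $\Theta_Q$ is the canonical 1-form on $T^*Q$, $\Omega_Q=-d\Theta_Q$, $\Theta_{\mathcal M}=\iota^*\Theta_Q$, $\Omega_{\mathcal M}=\iota^*\Omega_Q$.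 Set $\mathcal C_m=\{v\in T_m\mathcal M: T\tau_{\mathcal M}(v)\in D_{\tau_{\mathcal M}(m)}\}$. The restriction $\Omega_{\mathcal M}|_{\mathcal C}$ is nondegenerate, and the nonholonomic dynamics is the unique section $X_{\mathrm{nh}}$ of $\mathcal C$ with $\mathbf i_{X_{\mathrm{nh}}}\Omega_{\mathcal M}|_{\mathcal C}=d\mathcal H_{\mathcal M}|_{\mathcal C}$. A function $f\in C^\infty(\mathcal M)$ is a first integral if $X_{\mathrm{nh}}(f)=0$. Symmetry. A Lie group $G$ (Lie algebra $\mathfrak g$) acting on $Q$ is a symmetry if the tangent lifted action preserves $L$ and $D$; then the cotangent lifted action restricts to $\mathcal M$. $V\subset TQ$ and $\mathcal V\subset T\mathcal M$ are the distributions tangent to the $G$-orbits; $\eta_Q,\eta_{\mathcal M}$ are infinitesimal generators of $\eta\in\mathfrak g$ on $Q$ and $\mathcal M$. A section $\xi$ of the trivial bundle $\mathfrak g\times Q\to Q$ has generators $\xi_Q(q)=(\xi_q)_Q(q)$ and $\xi_{\mathcal M}(m)=(\xi_{\tau_{\mathcal M}(m)})_{\mathcal M}(m)$. Let $S=D\cap V$ and let $\mathfrak g_S\to Q$ be the subbundle of $\mathfrak g\times Q$ with fibers $\{\xi_q\in\mathfrak g:\ (\xi_q)_Q(q)\in S_q\}$. The nonholonomic momentum map $\mathcal J^{\mathrm{nh}}:\mathcal M\to\mathfrak g_S^*$ is given by $\langle\mathcal J^{\mathrm{nh}},\xi\rangle=\mathbf i_{\xi_{\mathcal M}}\Theta_{\mathcal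 M}$ for $\xi\in\Gamma(\mathfrak g_S)$, and $\mathcal J:\mathcal M\to\mathfrak g^*$ is the restriction to $\mathcal M$ of the canonical momentum map, $\langle\mathcal J,\eta\rangle=\mathbf i_{\eta_{\mathcal M}}\Theta_{\mathcal M}$. Horizontal gauge momenta. For $X\in\mathfrak X(Q)$ let $X^{T^*Q}$ be its cotangent lift, i.e. the vector field on $T^*Q$ with $\mathbf i_{X^{T^*Q}}\Omega_Q=d\tilde X$, $\tilde X(\alpha)=\alpha(X)$. A horizontal gauge symmetry is a section $\xi\in\Gamma(\mathfrak g_S)$ such that $\xi_Q^{T^*Q}(\mathcal H)(m)=0$ for all $m\in\mathcal M$; its horizontal gauge momentum is the function $\mathcal J_\xi=\langle\mathcal J^{\mathrm{nh}},\xi\rangle$ on $\mathcal M$ (it is a first integral of $X_{\mathrm{nh}}$). Vertical complement. A $G$-invariant vertical complement of the constraints is a $G$-invariant distribution $W$ on $Q$ with $TQ=D\oplus W$ and $W\subset V$. It induces $\mathcal W_m=(T\tau_{\mathcal M}|_{\mathcal V_m})^{-1}(W_{\tau_{\mathcal M}(m)})$, with $T\mathcal M=\mathcal C\oplus\mathcal W$, and associated projections $P_{\mathcal C}:T\mathcal M\to\mathcal C$, $P_{\mathcal W}:T\mathcal M\to\mathcal W$. Let $\mathfrak g_W\to Q$ be the subbundle of $\mathfrak g\times Q$ with fibers $\{\xi_q\in\mathfrak g:(\xi_q)_Q(q)\in W_q\}$; then $\mathfrak g\times Q=\mathfrak g_S\oplus\mathfrak g_W$, and $P_{\mathfrak g_S}$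 is the projection onto $\mathfrak g_S$ along $\mathfrak g_W$; for $\eta\in\mathfrak g$ (viewed as a constant section), $P_{\mathfrak g_S}(\eta)\in\Gamma(\mathfrak g_S)$. $W$ satisfies the vertical symmetry condition if $\mathfrak g_W$ is a trivial bundle given by a Lie subalgebra of $\mathfrak g$, i.e. there is a fixed Lie subalgebra of $\mathfrak g$ equal to every fiber of $\mathfrak g_W$. The 2-form $\langle\mathcal J,\mathcal K_{\mathcal W}\rangle$. Define the $\mathfrak g$-valued 1-form $\mathcal A_{\mathcal W}$ on $\mathcal M$ by $\mathcal A_{\mathcal W}(v_m)=\xi$ iff $P_{\mathcal W}(v_m)=\xi_{\mathcal M}(m)$, and the $\mathfrak g$-valued 2-form $\mathcal K_{\mathcal W}(X,Y)=d\mathcal A_{\mathcal W}(P_{\mathcal C}X,P_{\mathcal C}Y)$. Then $\langle\mathcal J,\mathcal K_{\mathcal W}\rangle$ is the 2-form on $\mathcal M$ obtained by pairing $\mathcal J$ with $\mathcal K_{\mathcal W}$. *)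

(* Defs.v *)
From HB Require Import structures.
From mathcomp Require Import all_boot all_order all_algebra.
From mathcomp Require Import all_classical all_reals all_analysis.

Set Implicit Arguments.
Unset Strict Implicit.
Unset Printing Implicit Defensive.

Import Order.TTheory GRing.Theory Num.Theory.
Import numFieldNormedType.Exports.

Local Open Scope classical_set_scope.
Local Open Scope ring_scope.

(* Smooth manifolds are presented by their algebras of globally defined smooth
   functions (differential spaces in the sense of Sikorski): a space carries a
   set [sm] of real functions, and a manifold of dimension [n] is such a space
   which is locally isomorphic to an open subset of R^n, Hausdorff and second
   countable.  Tangent vectors are derivations of this algebra at a point. *)

Section euclidean.
Context {R : realType}.

Fixpoint cont_diff n (k : nat) (U : set 'rV[R]_n) (F : 'rV[R]_n -> R) : Prop :=
  if k is k'.+1 then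
    (forall x v, U x -> derivable F x v) /\
    (forall v, cont_diff k' U (fun x => 'D_v F x))
  else forall x, U x -> {for x, continuous F}.

Definition smooth_on n (U : set 'rV[R]_n) (F : 'rV[R]_n -> R) : Prop :=
  forall k, cont_diff k U F.

End euclidean.

Section linear_algebra.
Context {R : realType} {V : lmodType R}.

Definition lin_indep r (b : 'I_r -> V) : Prop :=
  forall c : 'I_r -> R, \sum_i c i *: b i = 0 -> forall i, c i = 0.

Definition lin_span r (b : 'I_r -> V) : set V :=
  [set v | exists c : 'I_r -> R, v = \sum_i c i *: b i].

Definition has_dim (A : set V) (r : nat) : Prop :=
  exists2 b : 'I_r -> V, lin_indep b & A = lin_span b.

Definition lin_subspace (A : set V) : Prop :=
  A 0 /\ forall (a : R) v w, A v -> A w -> A (a *: v + w).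

Definition direct_sum (A B E : set V) : Prop :=
  E = [set a + b | a in A & b in B] /\ A `&` B = [set 0].

(* Projection onto [A] along [B]; junk value 0 outside the sum [A + B]. *)
Definition proj (A B : set V) (v : V) : V := xget 0 [set a | A a /\ B (v - a)].

End linear_algebra.

Record fspace (R : realType) := FSpace {
  pt :> Type;
  sm : set (pt -> R)
}.
Arguments FSpace {R} pt sm.

HB.instance Definition _ (R : realType) (X : fspace R) := gen_eqMixin (pt X).
HB.instance Definition _ (R : realType) (X : fspace R) := gen_choiceMixin (pt X).
(* the initial topology of the functions in [sm X] *)
HB.instance Definition _ (R : realType) (X : fspace R) :=
  isSubBaseTopological.Build (pt X)
    [set fU : (pt X -> R) * set R | sm fU.1 /\ open fU.2]
    (fun fU => fU.1 @^-1` fU.2).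

Section spaces.
Context {R : realType}.
Implicit Types X Y : fspace R.

Definition smooth_closure X : set (X -> R) :=
  [set f | forall x : X,
    exists n (g : 'I_n -> X -> R) (F : 'rV[R]_n -> R),
      [/\ forall i, sm (g i), smooth_on setT F &
          \forall y \near x, f y = F (\row_i g i y)]].

Record manifold (n : nat) X : Prop := {
  manifold_closed : @smooth_closure X `<=` @sm R X;
  manifold_chart : forall p : X,
    exists (U : set X) (phi : X -> 'rV[R]_n),
      [/\ open U, U p, forall i, sm (fun x => phi x ord0 i),
          {in U &, injective phi} & open (phi @` U)] /\
      forall f : X -> R, sm f ->
        exists2 F, smooth_on (phi @` U) F & {in U, f =1 F \o phi};
  manifold_hausdorff : hausdorff_space X;
  manifold_countable : @second_countable X
}.

Definition smooth_map X Y (phi : X -> Y) : Prop :=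
  forall f : Y -> R, sm f -> sm (f \o phi).

Definition gen_space (T : Type) (A : set (T -> R)) : fspace R :=
  FSpace T (smooth_closure (X := FSpace T A)).

Definition prod_space X Y : fspace R :=
  gen_space ([set (f \o fst : X * Y -> R) | f in @sm R X] `|`
             [set (g \o snd : X * Y -> R) | g in @sm R Y]).

Definition sub_space X (P : set X) : fspace R :=
  gen_space [set (f \o sval : {x : X | P x} -> R) | f in @sm R X].

End spaces.

Section calculus.
Context {R : realType}.
Implicit Types X Y : fspace R.

Local Notation tv X := ((pt X -> R) -> R^o).
Local Notation field X := (pt X -> tv X).
Local Notation dist X := (pt X -> set (tv X)).
Local Notation form1 X := (pt X -> tv X -> R).

(* A derivation is extended by 0 to the functions which are not smooth, so that
   equality of tangent vectors is equality of functions. *)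
Definition tangent X (x : X) : set (tv X) :=
  [set v : tv X |
    [/\ forall f, ~ sm f -> v f = 0,
        forall (a : R) (f g : X -> R), sm f -> sm g ->
          v (fun y => a * f y + g y) = a * v f + v g &
        forall f g : X -> R, sm f -> sm g ->
          v (fun y => f y * g y) = v f * g x + f x * v g]].

Definition push X Y (phi : X -> Y) (v : tv X) : tv Y :=
  fun f => if `[< sm f >] then v (f \o phi) else 0.

Definition vfield X (V : field X) : Prop :=
  (forall x, tangent x (V x)) /\
  (forall f : X -> R, sm f -> sm (fun x => V x f : R)).

Definition bracket X (V W : field X) : field X :=
  fun x f => V x (fun y => W y f) - W x (fun y => V y f).

Definition distribution X (r : nat) (D : dist X) : Prop :=
  forall x : X, exists V : 'I_r -> field X,
    (forall i, vfield (V i)) /\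
    \forall y \near x,
      lin_indep (fun i => V i y) /\ D y = lin_span (fun i => V i y).

Definition dsection X (D : dist X) (V : field X) : Prop :=
  vfield V /\ forall x, D x (V x).

Definition integrable_dist X (D : dist X) : Prop :=
  forall V W, dsection D V -> dsection D W -> dsection D (bracket V W).

Definition pullback X Y (phi : X -> Y) (theta : form1 Y) : form1 X :=
  fun x v => theta (phi x) (push phi v).

(* 2-forms are evaluated on vector fields, and d is given by Cartan's formula. *)
Definition extd X (theta : form1 X) (V W : field X) : X -> R :=
  fun x => V x (fun y => theta y (W y)) - W x (fun y => theta y (V y))
           - theta x (bracket V W x).

Record riemannian X (kappa : X -> tv X -> tv X -> R) : Prop := {
  riem_linear : forall (q : X) (a : R) u v w,
    tangent q u -> tangent q v -> tangent q w ->
    kappa q (a *: u + v) w = a * kappa q u w + kappa q v w;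
  riem_sym : forall (q : X) v w,
    tangent q v -> tangent q w -> kappa q v w = kappa q w v;
  riem_pos : forall (q : X) v, tangent q v -> v <> 0 -> 0 < kappa q v v;
  riem_smooth : forall V W : field X, vfield V -> vfield W ->
    sm (fun q => kappa q (V q) (W q))
}.

(* As for tangent vectors, covectors vanish outside the tangent space. *)
Definition covector X (q : X) (alpha : tv X -> R) : Prop :=
  (forall v, ~ tangent q v -> alpha v = 0) /\
  (forall (a : R) v w, tangent q v -> tangent q w ->
    alpha (a *: v + w) = a * alpha v + alpha w).

Record covec X := Covec {
  base : X;
  cov : tv X -> R;
  covP : covector base cov
}.

Definition fiberwise X (V : field X) (alpha : covec X) : R :=
  cov alpha (V (base alpha)).

(* The smooth structure of T*Q is generated by the functions lifted from Q and
   by the fibrewise linear functions defined by the vector fields, hence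
   locally by the coordinates (q_i, p_i). *)
Definition cotangent X : fspace R :=
  gen_space ([set (f \o @base X : covec X -> R) | f in @sm R X] `|`
             [set fiberwise V | V in @vfield X]).

Definition thetaQ X : form1 (cotangent X) :=
  fun alpha v => cov (alpha : covec X) (push (X := cotangent X) (@base X) v).

Definition omegaQ X (V W : field (cotangent X)) : cotangent X -> R :=
  fun alpha => - extd (@thetaQ X) V W alpha.

Definition cotangent_lift X (V : field X) (Y : field (cotangent X)) : Prop :=
  vfield Y /\
  forall Z, vfield Z -> forall alpha : cotangent X,
    omegaQ Y Z alpha = Z alpha (fiberwise V).

End calculus.

Section lie_groups.
Context {R : realType}.

Record lie_group := LieGroup {
  lgroup :> groupType;
  lsmooth : set (lgroup -> R);
  lspace := FSpace lgroup lsmooth;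
  ldim : nat;
  lmanifold : manifold ldim lspace;
  lmul_smooth : smooth_map (X := prod_space lspace lspace) (Y := lspace)
                  (fun gh => (gh.1 * gh.2)%g);
  linv_smooth : smooth_map (X := lspace) (Y := lspace) (fun g => g^-1%g)
}.

Variable G : lie_group.
Local Notation tvG := ((pt (lspace G) -> R) -> R^o).

Definition lie_algebra : set tvG := tangent (1%g : lspace G).

Definition left_invariant (eta : tvG) : lspace G -> tvG :=
  fun g => push (X := lspace G) (Y := lspace G) (fun h => (g * h)%g) eta.

Definition lie_bracket (eta zeta : tvG) : tvG :=
  bracket (left_invariant eta) (left_invariant zeta) 1%g.

Definition lie_subalgebra (h : set tvG) : Prop :=
  [/\ h `<=` lie_algebra, lin_subspace h &
      forall eta zeta, h eta -> h zeta -> h (lie_bracket eta zeta)].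

End lie_groups.

Arguments lie_group R : clear implicits.

(* The Lagrangian is  kappa(v, v) / 2 - potential. *)
Record nonholonomic_system (R : realType) := NonholonomicSystem {
  Q : fspace R;
  metric : Q -> ((Q -> R) -> R^o) -> ((Q -> R) -> R^o) -> R;
  potential : Q -> R;
  D : Q -> set ((Q -> R) -> R^o);
  dimQ : nat;
  rankD : nat;
  Q_manifold : manifold dimQ Q;
  metric_riemannian : riemannian metric;
  potential_smooth : sm potential;
  D_distribution : distribution rankD D;
  D_nonintegrable : ~ integrable_dist D
}.

Section nonholonomic.
Context {R : realType} (N : nonholonomic_system R).
Local Notation Q := (Q N).
Local Notation D := (@D _ N).
Local Notation tvQ := ((pt Q -> R) -> R^o).

Definition lagrangian (q : Q) (v : tvQ) : R :=
  metric q v v / 2 - potential q.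

Definition is_flat (alpha : covec Q) (v : tvQ) : Prop :=
  tangent (base alpha) v /\
  forall w, tangent (base alpha) w -> cov alpha w = metric (base alpha) v w.

(* The Legendre transformation of the Lagrangian is v |-> flat v. *)
Definition hamiltonian (alpha : cotangent Q) : R :=
  let v := xget 0 [set v | is_flat alpha v] in
  cov alpha v - lagrangian (base alpha) v.

Definition M : fspace R :=
  sub_space (X := cotangent Q)
    [set alpha | exists2 v, D (base alpha) v & is_flat alpha v].
Local Notation tvM := ((pt M -> R) -> R^o).
Local Notation fieldM := (pt M -> tvM).

Definition incl : M -> cotangent Q := sval.
Definition tauM (m : M) : Q := base (incl m).

Definition hamiltonianM : M -> R := hamiltonian \o incl.

Definition thetaM : M -> tvM -> R := pullback incl (@thetaQ R Q).

(* the pull-back of [omegaQ], as d commutes with pull-backs *)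
Definition omegaM (V W : fieldM) : M -> R := fun m => - extd thetaM V W m.

Definition C (m : M) : set tvM :=
  [set v | tangent m v /\ D (tauM m) (push tauM v)].

Definition nonholonomic_field (X : fieldM) : Prop :=
  dsection C X /\
  forall Y, dsection C Y -> forall m, omegaM X Y m = Y m hamiltonianM.

End nonholonomic.

(* [act_lagrangian] and [act_D] are the invariance of L and D under the tangent
   lift of the action. *)
Record symmetry (R : realType) (N : nonholonomic_system R) := Symmetry {
  G : lie_group R;
  act : G -> Q N -> Q N;
  act1 : forall q, act 1%g q = q;
  actM : forall g h q, act (g * h)%g q = act g (act h q);
  act_smooth : smooth_map (X := prod_space (lspace G) (Q N)) (Y := Q N)
                 (fun gq => act gq.1 gq.2);
  act_free : forall g q, act g q = q -> g = 1%g;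
  act_proper : forall K : set (Q N * Q N), compact K ->
    compact ((fun gq : lspace G * Q N => (act gq.1 gq.2, gq.2)) @^-1` K);
  act_lagrangian : forall g (q : Q N) v, tangent q v ->
    lagrangian (act g q) (push (act g) v) = lagrangian q v;
  act_D : forall g (q : Q N) v, D q v -> D (act g q) (push (act g) v)
}.

Section reduction.
Context {R : realType} {N : nonholonomic_system R} (S : symmetry N).
Local Notation Q := (Q N).
Local Notation D := (@D _ N).
Local Notation G := (G S).
Local Notation M := (M N).
Local Notation tvQ := ((pt Q -> R) -> R^o).
Local Notation tvM := ((pt M -> R) -> R^o).
Local Notation tvG := ((pt (lspace G) -> R) -> R^o).

(* The lift of the action to T*Q, restricted to M: <g.m, Tg(v)> = <m, v>. *)
Definition cotangent_act (g : G) (m : M) : M :=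
  xget m [set m' : M | tauM m' = act g (tauM m) /\
    forall v, tangent (tauM m) v ->
      cov (incl m') (push (act g) v) = cov (incl m) v].

Definition genQ (eta : tvG) (q : Q) : tvQ :=
  push (X := lspace G) (fun g => act g q) eta.
Definition genM (eta : tvG) (m : M) : tvM :=
  push (X := lspace G) (fun g => cotangent_act g m) eta.

Definition gen_secQ (xi : Q -> tvG) (q : Q) : tvQ := genQ (xi q) q.
Definition gen_secM (xi : Q -> tvG) (m : M) : tvM := genM (xi (tauM m)) m.

Definition smooth_section (xi : Q -> tvG) : Prop :=
  (forall q, lie_algebra (xi q)) /\
  (forall f : lspace G -> R, sm f -> sm (fun q => xi q f : R)).

Definition vertQ (q : Q) : set tvQ :=
  [set genQ eta q | eta in @lie_algebra R G].
Definition vertM (m : M) : set tvM :=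
  [set genM eta m | eta in @lie_algebra R G].

Definition distS (q : Q) : set tvQ := D q `&` vertQ q.

Definition gS (q : Q) : set tvG :=
  [set xi | lie_algebra xi /\ distS q (genQ xi q)].

Definition dimension_assumption : Prop :=
  forall q : Q, tangent q = [set v + w | v in D q & w in vertQ q].

Definition Jnh (xi : Q -> tvG) (m : M) : R := thetaM m (gen_secM xi m).

Definition J (m : M) (eta : tvG) : R := thetaM m (genM eta m).

Definition horizontal_gauge_symmetry (xi : Q -> tvG) : Prop :=
  [/\ smooth_section xi, forall q, gS q (xi q) &
      exists2 Y, cotangent_lift (gen_secQ xi) Y &
        forall m : M, Y (incl m) (@hamiltonian R N) = 0].

Variable W : Q -> set tvQ.

Record vertical_complement : Prop := {
  W_distribution : exists r, distribution r W;
  W_invariant : forall (g : G) (q : Q) v, W q v -> W (act g q) (push (act g) v);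
  W_complement : forall q : Q, direct_sum (D q) (W q) (tangent q);
  W_vertical : forall q, W q `<=` vertQ q
}.

Definition calW (m : M) : set tvM :=
  [set v | vertM m v /\ W (tauM m) (push (@tauM R N) v)].

Definition projC (m : M) : tvM -> tvM := proj (@C R N m) (calW m).
Definition projW (m : M) : tvM -> tvM := proj (calW m) (@C R N m).

Definition gW (q : Q) : set tvG :=
  [set xi | lie_algebra xi /\ W q (genQ xi q)].

Definition vertical_symmetry_condition : Prop :=
  exists2 h, lie_subalgebra h & forall q, gW q = h.

Definition PgS (eta : tvG) (q : Q) : tvG := proj (gS q) (gW q) eta.

Definition calA (m : M) (v : tvM) : tvG :=
  xget 0 [set xi | lie_algebra xi /\ genM xi m = projW m v].

(* [lie_algebra] consists of real functions on [lspace G -> R], and the Lie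
   algebra valued form [calA] is differentiated pointwise in this argument. *)
Definition calK (V Z : M -> tvM) (m : M) : tvG :=
  fun f => extd (fun m' v => calA m' v f)
             (fun m' => projC m' (V m')) (fun m' => projC m' (Z m')) m.

Definition JK (V Z : M -> tvM) (m : M) : R := J m (calK V Z m).

End reduction.

Arguments genM {R N} S eta m.
Arguments Jnh {R N} S xi m.
Arguments horizontal_gauge_symmetry {R N} S xi.
Arguments PgS {R N} S W eta q.

(* Main.v *)
(* By the vertical symmetry condition [g_W] is a fixed subalgebra [h], so
   [xi = P_gS eta] differs from the constant [eta] by a section with values in [h],
   and every derivative of [xi] takes its values in [h].  The cotangent lift of
   [xi_Q] is the sum of the generator of the lifted action and of the vertical
   vector attached to the one-form [w |-> - alpha ((D_w xi)_Q)].  The generator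
   annihilates the Hamiltonian, and at a point [m] of [M] the vertical part gives
   [- m ((D_u xi)_Q)] with [u] the vector dual to [m].  As [X_nh] projects to [u],
   this is up to sign [<J, K_W> (X_nh, eta_M)], which vanishes.

   For independence one chooses [eta_i] whose generators form a basis of [S] at
   one point.  A linear relation between the momenta at any other point [q] says
   that [D_q] contains and [D_q] is orthogonal to [(sum_i c_i xi_i)_Q], so by
   freeness [sum_i c_i eta_i] lies in [h]; as [h] is the fibre of [g_W] at the first
   point as well, the relation holds there too.  Freeness is needed infinitesimally,
   and is obtained from injectivity of the orbit maps without integral curves.

   Vector fields being derivations of the algebra of smooth functions, vectors of
   the cotangent bundle are constructed by their values on generating functions,
   and locality and the chain rule rest on Hadamard's lemma. *)
Require Import Defs.
From HB Require Import structures.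
From mathcomp Require Import finmap.
From mathcomp Require Import all_boot all_order all_algebra.
From mathcomp Require Import all_classical all_reals all_analysis.
From mathcomp Require Import ring lra.
Set Implicit Arguments.
Unset Strict Implicit.
Unset Printing Implicit Defensive.
Import Order.TTheory GRing.Theory Num.Theory.
Import numFieldNormedType.Exports.
Local Open Scope classical_set_scope.
Local Open Scope ring_scope.

(** * Functions of class C^k *)

(** Write [xi = P_gS eta] and [u] for the vector dual to [m]. Since [P_C eta_M = xi_M] and [A_W]
    vanishes on [C], Cartan's formula leaves [K_W (X_nh, eta_M) = - A_W [X_nh, xi_M]]. The bracket
    projects to [(D_u xi)_Q], a vector of [W] because [D_u xi] is in [h]; so [A_W] reads off
    [D_u xi] itself, and [<J, K_W>] becomes [- m ((D_u xi)_Q)]. That [X_nh] projects to [u] follows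
    by testing the equation of motion against the vertical vectors of [M], which all lie in [C]. The
    obstacle is that [T*Q] and [M] come without charts, being known only by generating functions.
    Forms and brackets on them are computed by writing each vector of [Q] locally as
    [\sum_j v (f j) *: Z j] with finitely many smooth [f j]; the frame behind this is made of frames
    of [D] and of [W]. Derivability is directional throughout, so that even additivity of the
    derivative in its direction and the chain rule require an argument. *)

Section ck.
Context {R : realType} {V : normedModType R}.
Implicit Types (U : set V) (F G : V -> R).

(** Unlike in [cont_diff], every level records continuity of the function itself: directional
    derivability does not imply it, and the inductions for products and inverses need order [k.+1]
    to contain order [k]. *)
Fixpoint ck (k : nat) U F : Prop :=
  (forall x, U x -> {for x, continuous F}) /\
  if k is k'.+1 then
    (forall x v, U x -> derivable F x v) /\ forall v, ck k' U (fun x => 'D_v F x)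
  else True.

Lemma ck_cont k U F x : ck k U F -> U x -> {for x, continuous F}.
Proof. by case: k => [|k] /= [+ _]; apply. Qed.

Lemma ckS k U F : ck k.+1 U F -> ck k U F.
Proof.
elim: k F => [|k IH] F [cF [dF DF]]; first by split.
by split=> //; split=> // v; apply: IH.
Qed.

Lemma ck_eq k U F G : open U -> {in U, F =1 G} -> ck k U F -> ck k U G.
Proof.
move=> oU; elim: k F G => [|k IH] F G FG.
  move=> [cF _]; split=> // x Ux.
  have FGx : \forall y \near x, F y = G y.
    by apply: filterS (open_nbhs_nbhs (conj oU Ux)) => y Uy; apply: FG; rewrite inE.
  rewrite /prop_for /continuous_at -(nbhs_singleton FGx).
  by apply: cvg_trans (cF x Ux); exact: near_eq_cvg.
have FGx x : U x -> \forall y \near x, F y = G y.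
  by move=> Ux; apply: filterS (open_nbhs_nbhs (conj oU Ux)) => y Uy; apply: FG; rewrite inE.
move=> [cF [dF DF]]; split.
  move=> x Ux; rewrite /prop_for /continuous_at -(nbhs_singleton (FGx x Ux)).
  apply: cvg_trans (cF x Ux); exact: near_eq_cvg (FGx x Ux).
split=> [x v Ux|v]; first exact: near_eq_derivable (FGx x Ux) (dF x v Ux).
apply: IH (DF v) => x; rewrite inE => Ux; exact: near_eq_derive (FGx x Ux).
Qed.

Lemma ck_local k U F :
  (forall x, U x -> exists2 W, open W /\ W x & ck k W F) -> ck k U F.
Proof.
elim: k F => [|k IH] F FU.
  by split=> // x /FU[W [_ Wx] [cF _]]; apply: cF.
split; first by move=> x /FU[W [_ Wx] [cF _]]; apply: cF.
split=> [x v /FU[W [_ Wx] [_ [dF _]]]|v]; first exact: dF.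
by apply: IH => x /FU[W WO [_ [_ DF]]]; exists W => //; exact: DF.
Qed.

Lemma ck_subset k U U' F : U' `<=` U -> ck k U F -> ck k U' F.
Proof.
move=> U'U; elim: k F => [|k IH] F.
  by move=> [cF _]; split=> // x /U'U; apply: cF.
move=> [cF [dF DF]]; split; first by move=> x /U'U; apply: cF.
by split=> [x v /U'U /dF|v]; [apply|exact/IH/DF].
Qed.

Lemma ck_cst k U (c : R) : ck k U (fun=> c).
Proof.
elim: k c => [|k IH] c; first by split=> // x _; exact: cvg_cst.
split; first by move=> x _; exact: cvg_cst.
split=> [x v _|v]; first exact: derivable_cst.
have -> : (fun x => 'D_v (fun=> c) x) = fun=> 0 :> R.
  by apply/funext => x; exact: derive_cst.
exact: IH.
Qed.

Lemma ckD k U F G : open U -> ck k U F -> ck k U G ->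
  ck k U (fun x => F x + G x).
Proof.
move=> oU; elim: k F G => [|k IH] F G.
  by move=> [cF _] [cG _]; split=> // x Ux; apply: cvgD; [exact: cF|exact: cG].
move=> [cF [dF DF]] [cG [dG DG]]; split.
  by move=> x Ux; apply: cvgD; [exact: cF|exact: cG].
split=> [x v Ux|v]; first by apply: derivableD; [exact: dF|exact: dG].
apply: ck_eq (IH _ _ (DF v) (DG v)) => // x; rewrite inE => Ux.
by rewrite -deriveD; [|exact: dF|exact: dG].
Qed.

Lemma ckM k U F G : open U -> ck k U F -> ck k U G ->
  ck k U (fun x => F x * G x).
Proof.
move=> oU; elim: k F G => [|k IH] F G.
  by move=> [cF _] [cG _]; split=> // x Ux; apply: cvgM; [exact: cF|exact: cG].
move=> cF' cG'; have [cF [dF DF]] := cF'; have [cG [dG DG]] := cG'; split.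
  by move=> x Ux; apply: cvgM; [exact: cF|exact: cG].
split=> [x v Ux|v]; first by apply: derivableM; [exact: dF|exact: dG].
apply: ck_eq (ckD oU (IH _ _ (ckS cF') (DG v)) (IH _ _ (ckS cG') (DF v))) => // x.
by rewrite inE => Ux; rewrite [RHS]deriveM; [|exact: dF|exact: dG].
Qed.

Lemma ckV k U F : open U -> (forall x, U x -> F x != 0) -> ck k U F ->
  ck k U (fun x => (F x)^-1).
Proof.
move=> oU F0; elim: k F F0 => [|k IH] F F0.
  by move=> [cF _]; split=> // x Ux; apply: cvgV; [exact: F0|exact: cF].
move=> cF'; have [cF [dF DF]] := cF'; split.
  by move=> x Ux; apply: cvgV; [exact: F0|exact: cF].
split=> [x v Ux|v]; first by apply: derivableV; [exact: F0|exact: dF].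
have cV := IH _ F0 (ckS cF').
apply: ck_eq (ckM oU (ck_cst k U (-1)) (ckM oU (ckM oU cV cV) (DF v))) => // x.
rewrite inE => Ux; rewrite [RHS]deriveV; [|exact: F0|exact: dF].
by rewrite /GRing.scale /= mulN1r mulNr -exprVn expr2.
Qed.

Lemma ck_sum k U (I : Type) (r : seq I) (F : I -> V -> R) : open U ->
  (forall i, ck k U (F i)) -> ck k U (fun x => \sum_(i <- r) F i x).
Proof.
move=> oU cF; elim: r => [|i r IH].
  apply: ck_eq (ck_cst k U 0) => // x _; by rewrite big_nil.
by apply: ck_eq (ckD oU (cF i) IH) => // x _; rewrite big_cons.
Qed.

Lemma ck_prod k U (I : Type) (r : seq I) (F : I -> V -> R) : open U ->
  (forall i, ck k U (F i)) -> ck k U (fun x => \prod_(i <- r) F i x).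
Proof.
move=> oU cF; elim: r => [|i r IH].
  apply: ck_eq (ck_cst k U 1) => // x _; by rewrite big_nil.
by apply: ck_eq (ckM oU (cF i) IH) => // x _; rewrite big_cons.
Qed.

Lemma is_derive_linear (L : V -> R) x v : linear L -> is_derive x v L (L v).
Proof.
move=> lL.
have cL : (fun h : R => h^-1 *: (L (h *: v + x) - L x)) @ 0^' --> L v.
  apply: cvg_near_cst; near=> h.
  rewrite lL addrK /GRing.scale /= mulrA mulVf ?mul1r//.
  by near: h; exact: nbhs_dnbhs_neq.
by apply: DeriveDef; [apply/cvg_ex; exists (L v)|exact: cvg_lim].
Unshelve. all: by end_near. Qed.

Lemma ck_linear k U (L : V -> R) : linear L -> continuous L -> ck k U L.
Proof.
move=> lL cL; case: k => [|k]; first by split=> // x _; exact: cL.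
split; first by move=> x _; exact: cL.
split=> [x v _|v]; first by have [] := is_derive_linear x v lL.
have -> : (fun x => 'D_v L x) = fun=> L v.
  by apply/funext => x; have [_ ->] := is_derive_linear x v lL.
exact: ck_cst.
Qed.

End ck.

Section smooth.
Context {R : realType} {n : nat}.
Implicit Types (U : set 'rV[R]_n) (F G : 'rV[R]_n -> R).

(** Smoothness asks for all orders, and order 0 for each iterated derivative supplies the continuity
    that [ck] records at every level. *)
Lemma smooth_onP U F : smooth_on U F <-> forall k, ck k U F.
Proof.
split=> [sF k|cF k].
  elim: k F sF => [|k IH] F sF.
    by split=> //; exact: (sF 0).
  split; first exact: (sF 0).
  split; first by have [] := sF 1.
  by move=> v; apply: IH => j; have [_] := sF j.+1; apply.
elim: k F cF => [|k IH] F cF; first by move=> x; exact: ck_cont (cF 0).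
split; first by have [_ []] := cF 1.
by move=> v; apply: IH => j; have [_ [_]] := cF j.+1; apply.
Qed.

Lemma smooth_derive U F v : smooth_on U F -> smooth_on U (fun x => 'D_v F x).
Proof. by move=> sF k; have [_] := sF k.+1; apply. Qed.

Lemma smooth_derivable U F x v : smooth_on U F -> U x -> derivable F x v.
Proof. by move=> sF; have [+ _] := sF 1; apply. Qed.

Lemma smooth_continuous U F x : smooth_on U F -> U x -> {for x, continuous F}.
Proof. by move=> sF; exact: (sF 0). Qed.

Lemma smooth_coord (i : 'I_n) : smooth_on setT (fun x : 'rV[R]_n => x ord0 i).
Proof.
apply/smooth_onP => k; apply: ck_linear; last exact: coord_continuous.
by move=> a x y; rewrite !mxE.
Qed.

End smooth.

(** * Directional derivatives: mean values, linearity, symmetry *)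

Section lines.
Context {R : realType} {V : normedModType R}.
Implicit Types (F : V -> R) (x v w : V).

Lemma is_derive_line F x v t : derivable F (t *: v + x) v ->
  is_derive t (1 : R) (fun s : R => F (s *: v + x)) ('D_v F (t *: v + x)).
Proof.
move=> dF.
have e : (fun h : R => h^-1 *: (F ((h *: 1 + t) *: v + x) - F (t *: v + x)))
       = (fun h : R => h^-1 *: (F (h *: v + (t *: v + x)) - F (t *: v + x))).
  by apply/funext => h; rewrite [h *: 1]mulr1 scalerDl addrA.
by apply: DeriveDef; rewrite /derivable /derive /= e.
Qed.

Lemma mean_value_line F x v (h : R) : (forall y, derivable F y v) ->
  exists2 s, `|s| <= `|h| & F (h *: v + x) - F x = h * 'D_v F (s *: v + x).
Proof.
move=> dF; pose g (s : R) := F (s *: v + x).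
have dg (t : R) : is_derive t (1 : R) g ('D_v F (t *: v + x)) by exact: is_derive_line.
have cg : continuous g.
  move=> t; apply: differentiable_continuous; apply/derivable1_diffP.
  by have [] := dg t.
have g0 : g 0 = F x by rewrite /g scale0r add0r.
have [h0|/ltW h0] := leP 0 h.
  have [c] := MVT_segment h0 (fun t _ => dg t) (continuous_subspaceT cg).
  rewrite in_itv /= g0 => /andP[c0 ch] e; exists c; last by rewrite -[LHS]/(g h - F x) e subr0 mulrC.
  by rewrite !ger0_norm.
have [c] := MVT_segment h0 (fun t _ => dg t) (continuous_subspaceT cg).
rewrite in_itv /= g0 => /andP[c0 ch] e; exists c.
  by rewrite !ler0_norm ?lerN2.
by apply: oppr_inj; rewrite opprB e sub0r mulrC mulNr.
Qed.

(** The increment along [v + w] passes through [h *: v + x]; the mean value theorem turns its second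
    leg into a value of ['D_w F] at a point tending to [x]. Continuity is used for ['D_w F] only,
    and only at [x]. *)
Lemma derive_dirD F x v w : (forall y u, derivable F y u) ->
  {for x, continuous (fun y => 'D_w F y)} ->
  'D_(v + w) F x = 'D_v F x + 'D_w F x.
Proof.
move=> dF cF.
have /choice[s sP] : forall h : R, exists s, `|s| <= `|h| /\
    F (h *: w + (h *: v + x)) - F (h *: v + x) = h * 'D_w F (s *: w + (h *: v + x)).
  by move=> h; have [s s1 s2] := mean_value_line (h *: v + x) h (fun y => dF y w); exists s.
have sP1 h : `|s h| <= `|h| by have [] := sP h.
have s0 : s h @[h --> 0^'] --> 0.
  apply: cvg_trans (_ : s h @[h --> (0:R)] --> 0); first exact: cvg_within_filter.
  apply/cvgr0Pnorm_lt => e e0; near=> h.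
  apply: le_lt_trans (sP1 h) _; near: h.
  apply: (@cvgr0_norm_lt _ _ _ _ _ id) => //; exact: cvg_id.
have cv : h^-1 *: (F (h *: v + x) - F x) @[h --> 0^'] --> 'D_v F x.
  by have := dF x v => /cvg_ex[l lP]; rewrite /derive /= (cvg_lim _ lP).
have h0 : h @[h --> (0:R)^'] --> (0:R) by exact: cvg_within_filter.
have cw : 'D_w F (s h *: w + (h *: v + x)) @[h --> 0^'] --> 'D_w F x.
  have c : (s h *: w + (h *: v + x)) @[h --> 0^'] --> (0:R) *: w + ((0:R) *: v + x).
    by apply: cvgD; [exact: cvgZr_tmp|apply: cvgD; [exact: cvgZr_tmp|exact: cvg_cst]].
  by move: c; rewrite !scale0r !add0r => c; exact: cvg_comp c cF.
have cwv := cvgD cw cv.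
rewrite [RHS]addrC; apply: cvg_lim => //.
apply: (cvg_trans _ (cwv _)); apply: near_eq_cvg; near=> h.
have hn0 : h != 0 by near: h; exact: nbhs_dnbhs_neq.
have [_ e] := sP h.
rewrite /= fctE -['D_w F _](mulKf hn0) -e -[_^-1 * _]/(_^-1 *: (_ : R)) -scalerDr addrA subrK.
by congr (_ *: (F _ - _)); rewrite scalerDr addrCA addrA.
Unshelve. all: by end_near. Qed.

Lemma derive_dirZ F x v (a : R) : derivable F x v -> 'D_(a *: v) F x = a * 'D_v F x.
Proof.
move=> dF; pose g (s : R) := F (s *: v + x).
have dg : is_derive (0:R) (1:R) g ('D_v F x).
  have := @is_derive_line F x v 0; rewrite scale0r add0r; exact.
have e : (fun h : R => F (h *: (a *: v) + x)) = g \o (fun h => h * a).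
  by apply/funext => h; rewrite /g /= scalerA.
have -> : 'D_(a *: v) F x = (fun h : R => F (h *: (a *: v) + x))^`()%classic 0.
  by rewrite /derive1 /derive /=; under [in RHS]eq_fun do rewrite addr0 scale0r add0r.
rewrite e derive1_comp; last by rewrite mul0r; have [] := dg.
  rewrite mul0r derive1E; have [_ ->] := dg.
  by rewrite derive1Mr; [rewrite derive1_id mul1r mulrC|exact: derivable_id].
by apply: derivableM; [exact: derivable_id|exact: derivable_cst].
Qed.

End lines.

Section clairaut.
Context {R : realType} {n : nat}.
Implicit Types (F : 'rV[R]_n -> R) (x v w : 'rV[R]_n).

Lemma smooth_dirD F x v w : smooth_on setT F ->
  'D_(v + w) F x = 'D_v F x + 'D_w F x.
Proof.
move=> sF; apply: derive_dirD => [y u|]; first exact: smooth_derivable sF _.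
exact: smooth_continuous (smooth_derive w sF) _.
Qed.

Lemma smooth_dirZ F x v (a : R) : smooth_on setT F ->
  'D_(a *: v) F x = a * 'D_v F x.
Proof. by move=> sF; apply: derive_dirZ; exact: smooth_derivable sF _. Qed.

Lemma smooth_dir F x v : smooth_on setT F ->
  'D_v F x = \sum_i v ord0 i * 'D_('e_i) F x.
Proof.
move=> sF; rewrite [v in LHS]row_sum_delta.
elim/big_rec2: _ => [|i a b _ <-]; first by rewrite derive0.
by rewrite smooth_dirD // smooth_dirZ.
Qed.

(** Two applications of the mean value theorem, along [v] and then along [w]. The quotient is
    symmetric in [v] and [w], which makes the mixed derivatives commute. *)
Lemma second_difference F x v w : smooth_on setT F ->
  (F (h *: v + h *: w + x) - F (h *: v + x) - F (h *: w + x) + F x) / (h * h)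
    @[h --> 0^'] --> 'D_w (fun y => 'D_v F y) x.
Proof.
move=> sF.
have dF y u : derivable F y u by exact: smooth_derivable sF _.
have dFv y u : derivable (fun z => 'D_v F z) y u.
  exact: smooth_derivable (smooth_derive v sF) _.
have /choice[s sP] : forall h : R, exists s : R * R, [/\ `|s.1| <= `|h|, `|s.2| <= `|h| &
    F (h *: v + h *: w + x) - F (h *: v + x) - F (h *: w + x) + F x =
    h * (h * 'D_w (fun y => 'D_v F y) (s.2 *: w + (s.1 *: v + x)))].
  move=> h; pose H y := F (h *: w + y) - F y.
  have dH y : is_derive y v H ('D_v F (h *: w + y) - 'D_v F y).
    have -> : H = (fun y => F (h *: w + y)) - F by apply/funext.
    apply: is_deriveB; last exact: derivableP.
    have e : (fun k : R => k^-1 *: (F (h *: w + (k *: v + y)) - F (h *: w + y)))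
       = (fun k : R => k^-1 *: (F (k *: v + (h *: w + y)) - F (h *: w + y))).
      by apply/funext => k; rewrite addrCA.
    by apply: DeriveDef; rewrite /derivable /derive /= e //; exact: dF.
  have [|s1 s1h e1] := @mean_value_line _ _ H x v h; first by move=> y; have [] := dH y.
  have [|s2 s2h e2] := @mean_value_line _ _ (fun y => 'D_v F y) (s1 *: v + x) w h; first by [].
  exists (s1, s2); split=> //=; rewrite -e2.
  have [_ D1] := dH (s1 *: v + x); rewrite -D1 -e1 /H.
  rewrite !addrA [h *: w + h *: v]addrC opprB.
  by rewrite addrA; ring.
have to0 (f : R -> R) : (forall h, `|f h| <= `|h|) -> f h @[h --> 0^'] --> 0.
  move=> fh.
  apply: cvg_trans (_ : f h @[h --> (0:R)] --> 0); first exact: cvg_within_filter.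
  apply/cvgr0Pnorm_lt => e e0; near=> h.
  apply: le_lt_trans (fh h) _; near: h.
  apply: (@cvgr0_norm_lt _ _ _ _ _ id) => //; exact: cvg_id.
have s10 : (s h).1 @[h --> 0^'] --> (0:R) by apply: to0 => h; have [] := sP h.
have s20 : (s h).2 @[h --> 0^'] --> (0:R) by apply: to0 => h; have [] := sP h.
have cw : 'D_w (fun y => 'D_v F y) ((s h).2 *: w + ((s h).1 *: v + x)) @[h --> 0^']
      --> 'D_w (fun y => 'D_v F y) x.
  have c : ((s h).2 *: w + ((s h).1 *: v + x)) @[h --> 0^'] --> (0:R) *: w + ((0:R) *: v + x).
    by apply: cvgD; [exact: cvgZr_tmp|apply: cvgD; [exact: cvgZr_tmp|exact: cvg_cst]].
  move: c; rewrite !scale0r !add0r => c; apply: (cvg_comp _ (fun y => 'D_w (fun z => 'D_v F z) y) c).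
  exact: smooth_continuous (smooth_derive w (smooth_derive v sF)) _.
apply: cvg_trans cw; apply: near_eq_cvg; near=> h.
have hn0 : h != 0 by near: h; exact: nbhs_dnbhs_neq.
by have [_ _ ->] := sP h; rewrite mulrA mulrAC divff ?mul1r// mulf_neq0.
Unshelve. all: by end_near. Qed.

Lemma smooth_derive_comm F x v w : smooth_on setT F ->
  'D_w (fun y => 'D_v F y) x = 'D_v (fun y => 'D_w F y) x.
Proof.
move=> sF; have c1 := @second_difference F x v w sF; have c2 := @second_difference F x w v sF.
apply: (cvg_unique _ c1); first exact: norm_hausdorff.
apply: cvg_trans c2; apply: near_eq_cvg; near=> h.
congr (_ / _); rewrite [h *: w + h *: v]addrC; ring.
Unshelve. all: by end_near. Qed.

End clairaut.

(** * Integrals over the unit interval and along segments *)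

Section int01.
Context {R : realType}.
Local Notation mu := (@lebesgue_measure R).
Implicit Types f g : R -> R.

Definition int01 f : R := \int[mu]_(t in `[0%R, 1%R]) f t.

Lemma integrable01 f : continuous f -> mu.-integrable `[0%R, 1%R] (EFin \o f).
Proof.
move=> cf; apply: continuous_compact_integrable; first exact: segment_compact.
exact: continuous_subspaceT.
Qed.

Lemma int01_cst (c : R) : int01 (fun=> c) = c.
Proof.
rewrite /int01 Rintegral_cst //= lebesgue_measure_itv /= lte_fin ltr01 /=.
by rewrite oppr0 addr0 mulr1.
Qed.

Lemma int01D f g : continuous f -> continuous g ->
  int01 (fun t => f t + g t) = int01 f + int01 g.
Proof. by move=> cf cg; apply: RintegralD => //; exact: integrable01. Qed.

Lemma int01B f g : continuous f -> continuous g ->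
  int01 (fun t => f t - g t) = int01 f - int01 g.
Proof. by move=> cf cg; apply: RintegralB => //; exact: integrable01. Qed.

Lemma int01Z (c : R) f : continuous f -> int01 (fun t => c * f t) = c * int01 f.
Proof. by move=> cf; apply: RintegralZl => //; exact: integrable01. Qed.

Lemma int01_sum (I : Type) (r : seq I) (f : I -> R -> R) :
  (forall i, continuous (f i)) ->
  int01 (fun t => \sum_(i <- r) f i t) = \sum_(i <- r) int01 (f i).
Proof.
move=> cf; elim: r => [|i r IH].
  rewrite big_nil -[RHS](int01_cst 0); congr int01.
  by apply/funext => t; rewrite big_nil.
rewrite big_cons -IH -int01D //; last first.
  elim: r {IH} => [|j r IH] t.
    by under eq_fun do rewrite big_nil; exact: cvg_cst.
  under eq_fun do rewrite big_cons; apply: cvgD; [exact: cf|exact: IH].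
by congr int01; apply/funext => t; rewrite big_cons.
Qed.

Lemma int01_norm_le f (c : R) : continuous f ->
  (forall t, 0 <= t <= 1 -> `|f t| <= c) -> `|int01 f| <= c.
Proof.
move=> cf fc; apply: le_trans (le_normr_Rintegral _ (integrable01 cf)) _ => //.
rewrite -[leRHS]int01_cst; apply: le_Rintegral => //.
  by apply: (@integrable01 (fun t => `|f t|)) => t; apply: cvg_norm; exact: cf.
  by apply: integrable01 => t; exact: cvg_cst.
Qed.

Lemma int01_derive f df : (forall t : R, is_derive t (1 : R) f (df t)) ->
  continuous df -> int01 df = f 1 - f 0.
Proof.
move=> dfP cdf; have cf : continuous f.
  move=> t; apply: differentiable_continuous; apply/derivable1_diffP.
  by have [] := dfP t.
rewrite /int01 /Rintegral (@continuous_FTC2 _ _ f) //=.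
- exact: continuous_subspaceT.
- split; [by move=> t _; have [] := dfP t|exact: cvg_at_right_filter (cf _)
    |exact: cvg_at_left_filter (cf _)].
- by move=> t _; rewrite derive1E; have [_ ->] := dfP t.
Qed.

(** Joint continuity at the points [(z, t)], with [t] in the compact unit interval, makes [f y]
    uniformly close to [f z] there for [y] near [z]. *)
Lemma int01_continuous (T : topologicalType) (f : T -> R -> R) (z : T) :
  (forall t, {for (z, t), continuous (fun p => f p.1 p.2)}) ->
  (forall y, continuous (f y)) ->
  {for z, continuous (fun y => int01 (f y))}.
Proof.
move=> cf cfy; apply/cvgrPdist_le => e e0.
have /compact_near_coveringP cov := @segment_compact R 0 1.
have cov1 := cov T (nbhs z) (fun y t => `|f z t - f y t| <= e) _.
have {cov1} : \forall y \near z, `[0%R, 1%R]%classic `<=` (fun t => `|f z t - f y t| <= e).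
  apply: cov1 => t _.
  have e2 : 0 < e / 2 by rewrite divr_gt0.
  have /cvgrPdist_le/(_ _ e2)[[A B] /= [nA nB] AB] := cf t.
  exists (B, A) => //= -[s y] /= [Bs Ay].
  have := AB (y, s) (conj Ay Bs) => /= H1.
  have := AB (z, s) (conj (nbhs_singleton nA) Bs) => /= H2.
  rewrite -(subrKA (f z t)) (splitr e); apply: le_trans (ler_normD _ _) _.
  by apply: lerD => //; rewrite distrC.
apply: filterS => y fy; rewrite -int01B //; apply: int01_norm_le.
  by move=> t; apply: cvgB; exact: cfy.
by move=> t t01; apply: fy => /=; rewrite in_itv.
Qed.

End int01.

Section segments.
Context {R : realType} {V : normedModType R}.
Implicit Types (F : V -> R) (a x v w z : V).

Lemma continuous_normB a : continuous (fun p : V => `|p - a|).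
Proof.
by move=> p; apply: cvg_norm; apply: cvgB; [exact: cvg_id|exact: cvg_cst].
Qed.

Lemma continuous_normr F : continuous F -> continuous (fun p => `|F p|).
Proof. by move=> cF p; apply: cvg_norm; exact: cF. Qed.

Lemma closed_nball a (M : R) : closed [set p : V | `|p - a| <= M].
Proof.
rewrite -[X in closed X]/((fun p => `|p - a|) @^-1` [set x : R | x <= M]).
by apply: preimage_closed; [move=> p _; exact: continuous_normB|exact: closed_le].
Qed.

(** A weighted integral of [F] over the segment from [a] to [z]. Each derivative in [z] brings out a
    factor [t], so the powers of [t] make the family closed under derivation. *)
Definition segment_moment m F a z : R :=
  int01 (fun t => t ^+ m * F (a + t *: (z - a))).

Lemma cvg_segment F a (z : V) (t : R) : continuous F ->
  {for (z, t), continuous (fun p : V * R => F (a + p.2 *: (p.1 - a)))}.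
Proof.
move=> cF; apply: (@cvg_comp _ _ _ (fun p : V * R => a + p.2 *: (p.1 - a))
  F _ (nbhs (a + t *: (z - a)))); last exact: cF.
apply: cvgD; first exact: cvg_cst.
apply: cvgZ; first exact: cvg_snd.
by apply: cvgB; [exact: cvg_fst|exact: cvg_cst].
Qed.

Lemma continuous_segment F a z : continuous F ->
  continuous (fun t : R => F (a + t *: (z - a))).
Proof.
move=> cF t; apply: (@cvg_comp _ _ _ (fun t => a + t *: (z - a)) F _ 
  (nbhs (a + t *: (z - a)))); last exact: cF.
by apply: cvgD; [exact: cvg_cst|apply: cvgZr_tmp; exact: cvg_id].
Qed.

Lemma continuous_moment m F a z : continuous F ->
  continuous (fun t : R => t ^+ m * F (a + t *: (z - a))).
Proof.
move=> cF t; apply: cvgM; first exact: exprn_continuous.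
exact: continuous_segment.
Qed.

Lemma segment_moment_continuous m F a : continuous F ->
  continuous (segment_moment m F a).
Proof.
move=> cF z; apply: int01_continuous => [t|y]; last exact: continuous_moment.
apply: cvgM; last exact: cvg_segment.
by apply: (@cvg_comp _ _ _ snd (fun t : R => t ^+ m)); [exact: cvg_snd|exact: exprn_continuous].
Qed.

(** Boundedness on balls supplies the dominating constant for differentiation under the integral; it
    is proved below in ['rV[R]_n], where balls are compact. *)
Hypothesis continuous_bounded : forall F a (M : R), continuous F ->
  exists2 C, 0 <= C & forall p, `|p - a| <= M -> `|F p| <= C.

Lemma segment_moment_is_derive m F a z v : (forall k, ck k setT F) ->
  is_derive z v (segment_moment m F a) (segment_moment m.+1 (fun y => 'D_v F y) a z).
Proof.
move=> sF.
have cF : continuous F by move=> y; exact: ck_cont (sF 0) I.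
have sDF k : ck k setT ('D_v F) by have [_ [_]] := sF k.+1; apply.
have dF y w : derivable F y w by have [_ [+ _]] := sF 1; apply.
have cDF : continuous ('D_v F).
  by move=> y; exact: ck_cont (sDF 0) I.
pose f (h t : R) := t ^+ m * F (a + t *: (h *: v + z - a)).
have df h t : is_derive h (1 : R) (f ^~ t)
    (t ^+ m.+1 * 'D_v F (a + t *: (h *: v + z - a))).
  have e : f ^~ t = (t ^+ m) *: (fun h => F (h *: (t *: v) + (a + t *: (z - a)))) :> (R -> R).
    apply/funext => k; rewrite /f -[RHS]/(t ^+ m * _); congr (_ * F _).
    by rewrite -addrA scalerDr addrCA !scalerA mulrC.
  have := @is_derive_line R _ F (a + t *: (z - a)) (t *: v) h (dF _ _).
  rewrite derive_dirZ // => D; rewrite e.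
  have := is_deriveZ (t ^+ m) D.
  rewrite -[_ *: (_ * _)]/(t ^+ m * (t * _)) mulrA -exprSr.
  congr (is_derive _ _ _ (_ * 'D_v F _)).
  by rewrite -[h *: v + z - a]addrA [in RHS]scalerDr addrCA !scalerA mulrC.
have d1 h t : partial1of2 f h t = t ^+ m.+1 * 'D_v F (a + t *: (h *: v + z - a)).
  by rewrite partial1of2E; have [_ ->] := df h t.
(* For [|h| < 1] and [t] in the unit interval the point [a + t *: (h *: v + z - a)] stays within
   [|v| + |z - a|] of [a]. *)
have [C C0 CP] := continuous_bounded a (`|v| + `|z - a|) cDF.
have m01 : measurable (`[0%R, 1%R]%classic : set (measurableTypeR R)) by [].
have I0 : `]-1, 1[%classic (0 : R) by rewrite /= in_itv /= ltrN10 ltr01.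
have If (h : R) : `]-1, 1[%classic h -> 
  (@lebesgue_measure R).-integrable `[0%R, 1%R] (EFin \o f h).
  by move=> _; apply: integrable01; exact: continuous_moment.
have Id (h t : R) : `]-1, 1[%classic h -> `[0%R, 1%R]%classic t -> derivable (f^~ t) h 1.
  by move=> _ _; have [] := df h t.
have IC : (@lebesgue_measure R).-integrable `[0%R, 1%R] (EFin \o (fun=> C)).
  by apply: integrable01 => t; exact: cvg_cst.
have Ib (h t : R) : `]-1, 1[%classic h -> `[0%R, 1%R]%classic t -> `|partial1of2 f h t| <= C.
  rewrite /= !in_itv /= => /andP[h1 h2] /andP[t0 t1]; rewrite d1 normrM.
  rewrite -[leRHS]mul1r; apply: ler_pM => //.
    by rewrite normrX exprn_ile1 // ger0_norm.
  apply: CP; rewrite addrC addKr normrZ -[leRHS]mul1r; apply: ler_pM => //.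
    by rewrite ger0_norm.
  rewrite -addrA; apply: le_trans (ler_normD _ _) _; rewrite lerD2r normrZ.
  by rewrite ler_piMl // ler_norml ltW // ltW.
have e : (fun h : R => h^-1 *: (segment_moment m F a (h *: v + z) - segment_moment m F a z))
   = (fun h : R => h^-1 *: (int01 (f (h *: 1 + 0)) - int01 (f 0))).
  apply/funext => h; rewrite /segment_moment /f; congr (_ *: (_ - _)).
    by rewrite addr0 [h *: 1]mulr1.
  by rewrite scale0r add0r.
have der := @derivable_under_integral R _ _ (@lebesgue_measure R) f _ m01 0 (-1) 1 I0 If Id (fun=> C) (fun=> C0) IC Ib.
have dif := @differentiation_under_integral R _ _ (@lebesgue_measure R) f _ m01 0 (-1) 1 I0 If Id (fun=> C) (fun=> C0) IC Ib.
apply: DeriveDef; first by rewrite /derivable /= e.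
rewrite /derive /= e -[LHS]/('D_1 (fun h => int01 (f h)) 0) -derive1E [LHS]dif.
rewrite -/(int01 _); congr int01; apply/funext => t.
by rewrite d1 scale0r add0r.
Qed.

Lemma segment_moment_smooth m F a : (forall k, ck k setT F) ->
  forall k, ck k setT (segment_moment m F a).
Proof.
move=> sF k; elim: k m F sF => [|k IH] m F sF.
  split=> // z _; apply: segment_moment_continuous => y.
  exact: ck_cont (sF 0) I.
split; first by move=> z _; apply: segment_moment_continuous => y; exact: ck_cont (sF 0) I.
split=> [z v _|v]; first by have [] := segment_moment_is_derive m a z v sF.
have -> : 'D_v (segment_moment m F a) = segment_moment m.+1 (fun y => 'D_v F y) a.
  by apply/funext => z; have [_ ->] := segment_moment_is_derive m a z v sF.
by apply: IH => j; have [_ [_]] := sF j.+1; apply.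
Qed.

End segments.

(** * Hadamard's lemma and composition *)

Section hadamard.
Context {R : realType} {n : nat}.
Implicit Types (F : 'rV[R]_n -> R) (a x v w z : 'rV[R]_n).

Lemma compact_nball a (M : R) : compact [set p : 'rV[R]_n | `|p - a| <= M].
Proof.
apply: bounded_closed_compact; last exact: closed_nball.
exists (`|a| + M); split; first exact: num_real.
move=> C ltC p /= pM; apply: le_trans (ltW ltC).
by rewrite -[p](subrK a) addrC; apply: le_trans (ler_normD _ _) _; rewrite lerD2l.
Qed.

Lemma continuous_bounded F a (M : R) : continuous F ->
  exists2 C, 0 <= C & forall p, `|p - a| <= M -> `|F p| <= C.
Proof.
move=> cF; have [M0|M0] := ltP M 0.
  by exists 0 => // p pM; have := le_lt_trans (le_trans (normr_ge0 _) pM) M0; rewrite ltxx.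
have cN := continuous_normr cF.
have [||c _ cP] := @EVT_max_rV R n (fun p => `|F p|) _ _ (@compact_nball a M).
- by exists a => /=; rewrite subrr normr0.
- exact: continuous_subspaceT.
by exists `|F c| => // p pM; apply: cP; rewrite inE.
Qed.

(** [F z - F a] is the integral over the segment of the derivative of [F] along [z - a], and this
    direction is expanded in coordinates; [G i] is the moment of order 0 of the [i]-th partial
    derivative. *)
Lemma hadamard F a : smooth_on setT F ->
  exists G : 'I_n -> 'rV[R]_n -> R,
    (forall i, smooth_on setT (G i)) /\ 
    (forall i, G i a = 'D_('e_i) F a) /\
    forall z, F z = F a + \sum_i (z ord0 i - a ord0 i) * G i z.
Proof.
move=> sF; exists (fun i => segment_moment 0 (fun y => 'D_('e_i) F y) a); split.
  by move=> i; apply/smooth_onP/segment_moment_smooth; [exact: continuous_bounded|exact/smooth_onP/smooth_derive].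
split=> [i|z].
  rewrite /segment_moment -[RHS]int01_cst; congr int01; apply/funext => t.
  by rewrite expr0 mul1r subrr scaler0 addr0.
have cD i : continuous ('D_('e_i) F).
  by move=> y; exact: smooth_continuous (smooth_derive _ sF) _.
apply/eqP; rewrite addrC -subr_eq; apply/eqP.
pose f (t : R) := F (t *: (z - a) + a).
have -> : F z - F a = f 1 - f 0 by rewrite /f scale1r subrK scale0r add0r.
have dfP (t : R) : is_derive t (1 : R) f ('D_(z - a) F (t *: (z - a) + a)).
  by apply: is_derive_line; exact: smooth_derivable sF _.
rewrite -(int01_derive dfP); last first.
  have -> : (fun t : R => 'D_(z - a) F (t *: (z - a) + a)) =
      (fun t => 'D_(z - a) F (a + t *: (z - a))).
    by apply/funext => t; rewrite [_ *: _ + _]addrC.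
  have c : continuous ('D_(z - a) F).
    by move=> y; exact: smooth_continuous (smooth_derive _ sF) _.
  exact: (@continuous_segment R _ _ a z c).
have -> : (fun t : R => 'D_(z - a) F (t *: (z - a) + a)) = fun t =>
    \sum_i (z ord0 i - a ord0 i) * (t ^+ 0 * 'D_('e_i) F (a + t *: (z - a))).
  apply/funext => t; rewrite smooth_dir //; apply: eq_bigr => i _.
  by rewrite !mxE expr0 mul1r addrC [t *: _ + a]addrC.
rewrite int01_sum; last first.
  by move=> i t; apply: cvgM; [exact: cvg_cst|exact: (@continuous_moment R _ 0 _ a z (cD i))].
by apply: eq_bigr => i _; rewrite int01Z //; exact: (@continuous_moment R _ 0 _ a z (cD i)).
Qed.

End hadamard.

Section composition.
Context {R : realType} {V : normedModType R}.

Lemma near_row (T : topologicalType) n (phi : 'I_n -> T -> R) (x : T)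
    (A : set 'rV[R]_n) :
  (forall i, {for x, continuous (phi i)}) -> nbhs (\row_i phi i x) A ->
  \forall y \near x, A (\row_i phi i y).
Proof.
move=> cphi [P nP PA].
suff : \forall y \near x, forall i : 'I_n, P ord0 i (phi i y).
  by apply: filterS => y Py; apply: PA => i j; rewrite (ord1 i) mxE.
apply: filter_forall => i; apply: cphi.
by have := nP ord0 i; rewrite mxE.
Qed.

Lemma continuous_row (T : topologicalType) n (phi : 'I_n -> T -> R) (x : T)
    (F : 'rV[R]_n -> R) :
  (forall i, {for x, continuous (phi i)}) -> {for \row_i phi i x, continuous F} ->
  {for x, continuous (fun y => F (\row_i phi i y))}.
Proof.
by move=> cphi cF A nA; apply: (near_row cphi (cF _ nA)).
Qed.

(* [q] is only continuous, so this is not the Leibniz rule. *)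
Lemma is_derive_vanishM (p q : V -> R) x v : derivable p x v -> p x = 0 ->
  {for 0, continuous (fun h : R => q (h *: v + x))} ->
  is_derive x v (fun y => p y * q y) (q x * 'D_v p x).
Proof.
move=> dp p0 cq.
have cvp : (fun h : R => h^-1 *: (p (h *: v + x) - p x)) @ 0^' --> 'D_v p x.
  by have := dp => /cvg_ex[l lP]; rewrite /derive /= (cvg_lim _ lP).
have cvq : (fun h : R => q (h *: v + x)) @ 0^' --> q x.
  have := cq; rewrite /prop_for /continuous_at scale0r add0r => cq'.
  by apply: cvg_trans cq'; exact: cvg_within_filter.
have c : (fun h : R => h^-1 *: (p (h *: v + x) * q (h *: v + x) - p x * q x)) @ 0^'
    --> q x * 'D_v p x.
  have e : (fun h : R => h^-1 *: (p (h *: v + x) * q (h *: v + x) - p x * q x)) =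
      (fun h : R => q (h *: v + x) * (h^-1 *: (p (h *: v + x) - p x))).
    by apply/funext => h; rewrite p0 mul0r !subr0 [RHS]mulrC; exact: mulrA.
  by rewrite e; apply: cvgM.
by apply: DeriveDef; [apply/cvg_ex; exists (q x * 'D_v p x)|exact: cvg_lim].
Qed.

Lemma cvg_lineR (x v : V) : (fun h : R => h *: v + x) @ (0 : R) --> x.
Proof.
have : (fun h : R => h *: v + x) @ (0 : R) --> (0 : R) *: v + x.
  by apply: cvgD; [apply: cvgZr_tmp; exact: cvg_id|exact: cvg_cst].
by rewrite scale0r add0r.
Qed.

(** The [phi i] are derivable along [v] only, so [F] is expanded by [hadamard] at the image of [x]:
    each term is a product whose first factor vanishes at [x] and whose second factor is continuous
    there. *)
Lemma is_derive_comp n (F : 'rV[R]_n -> R) (phi : 'I_n -> V -> R) x v :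
  smooth_on setT F ->
  (forall i, {for x, continuous (phi i)}) -> (forall i, derivable (phi i) x v) ->
  is_derive x v (fun y => F (\row_i phi i y))
    (\sum_i 'D_('e_i) F (\row_i phi i x) * 'D_v (phi i) x).
Proof.
move=> sF cphi dphi.
have [G [sG [Ga FG]]] := hadamard (\row_i phi i x) sF.
have -> : (fun y => F (\row_i phi i y)) = cst (F (\row_i phi i x)) +
    \sum_i (fun y => (phi i y - phi i x) * G i (\row_i phi i y)).
  apply/funext => y; rewrite fctE FG; congr (_ + _).
  rewrite fct_sumE; apply: eq_bigr => i _; by rewrite !mxE.
rewrite -[X in is_derive _ _ _ X]add0r.
apply: is_deriveD; apply: is_derive_sum => i.
have dB : is_derive x v (fun y => phi i y - phi i x) ('D_v (phi i) x).
  rewrite -[X in is_derive _ _ _ X]subr0; apply: is_deriveB; exact: derivableP.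
have [dB1 dB2] := dB.
rewrite -Ga -dB2; apply: is_derive_vanishM => //; first by rewrite subrr.
apply: (@cvg_comp _ _ _ (fun h : R => h *: v + x) (fun y => G i (\row_i phi i y)) _ (nbhs x)).
  exact: cvg_lineR.
rewrite scale0r add0r; apply: continuous_row => //.
exact: smooth_continuous (sG i) _.
Qed.

Lemma ck_comp k n (F : 'rV[R]_n -> R) (phi : 'I_n -> V -> R) (U : set V) : open U ->
  smooth_on setT F -> (forall i j, ck j U (phi i)) ->
  ck k U (fun y => F (\row_i phi i y)).
Proof.
move=> oU + cphi; elim: k F => [|k IH] F sF.
  split=> // x Ux; apply: continuous_row; last exact: smooth_continuous sF _.
  by move=> i; exact: ck_cont (cphi i 0) Ux.
have D x v : U x -> is_derive x v (fun y => F (\row_i phi i y))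
    (\sum_i 'D_('e_i) F (\row_i phi i x) * 'D_v (phi i) x).
  move=> Ux; apply: is_derive_comp => // i; first exact: ck_cont (cphi i 0) Ux.
  by have [_ [+ _]] := cphi i 1; apply.
split.
  move=> x Ux; apply: continuous_row; last exact: smooth_continuous sF _.
  by move=> i; exact: ck_cont (cphi i 0) Ux.
split=> [x v Ux|v]; first by have [] := D x v Ux.
apply: (@ck_eq _ _ _ _ (fun x => \sum_i 'D_('e_i) F (\row_i phi i x) * 'D_v (phi i) x)) => //.
  by move=> x; rewrite inE => Ux; have [_ ->] := D x v Ux.
apply: ck_sum => // i; apply: ckM => //.
  exact: (IH (fun z => 'D_('e_i) F z)) (smooth_derive _ sF).
by have [_ [_]] := cphi i k.+1; apply.
Qed.

End composition.

Lemma smooth_comp (R : realType) m n (F : 'rV[R]_n -> R) (phi : 'I_n -> 'rV[R]_m -> R) U :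
  open U -> smooth_on setT F -> (forall i, smooth_on U (phi i)) ->
  smooth_on U (fun y => F (\row_i phi i y)).
Proof.
move=> oU sF sphi; apply/smooth_onP => k; apply: ck_comp => // i.
exact/smooth_onP.
Qed.

(** * Cut-off functions and extension *)

Section onevar.
Context {R : realType}.
Implicit Types f : R -> R.

Lemma ck_onevar f df : (forall t : R, is_derive t (1 : R) f (df t)) ->
  forall k, ck k setT df -> ck k.+1 setT f.
Proof.
move=> fdf k cf.
have dif t : differentiable f t by apply/derivable1_diffP; have [] := fdf t.
split; first by move=> x _; apply: differentiable_continuous.
split=> [x v _|v]; first exact: diff_derivable.
have -> : 'D_v f = fun t => v * df t.
  apply/funext => t; have [f1 f2] := fdf t.
  by have := @derive_dirZ _ _ f t 1 v f1; rewrite [v *: 1]mulr1 f2.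
by apply: ckM => //; [exact: openT|exact: ck_cst].
Qed.

Lemma smooth_onevar f : (forall k, ck k setT f) ->
  smooth_on setT (fun z : 'rV[R]_1 => f (z ord0 ord0)).
Proof.
move=> cf; apply/smooth_onP => k; elim: k f cf => [|k IH] f cf.
  split=> // z _; apply: (@continuous_comp _ _ _ (fun z : 'rV[R]_1 => z ord0 ord0) f).
    exact: coord_continuous.
  exact: ck_cont (cf 0) I.
have df t v : derivable f t v by have [_ [+ _]] := cf 1; apply.
have D (z v : 'rV[R]_1) : is_derive z v (fun z : 'rV[R]_1 => f (z ord0 ord0))
    (v ord0 ord0 * 'D_1 f (z ord0 ord0)).
  have e : (fun h : R => h^-1 *: (f ((h *: v + z) ord0 ord0) - f (z ord0 ord0)))
     = (fun h : R => h^-1 *: (f (h *: (v ord0 ord0 *: 1) + z ord0 ord0) - f (z ord0 ord0))).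
    by apply/funext => h; rewrite !mxE [_ *: 1]mulr1.
  by apply: DeriveDef; rewrite /derivable /derive /= e; [exact: df|rewrite -derive_dirZ].
split.
  move=> z _; apply: (@continuous_comp _ _ _ (fun z : 'rV[R]_1 => z ord0 ord0) f).
    exact: coord_continuous.
  exact: ck_cont (cf 0) I.
split=> [z v _|v]; first by have [] := D z v.
have -> : 'D_v (fun z : 'rV[R]_1 => f (z ord0 ord0)) =
    fun z => v ord0 ord0 * 'D_1 f (z ord0 ord0).
  by apply/funext => z; have [_ ->] := D z v.
apply: ckM; [exact: openT|exact: ck_cst|apply: (IH ('D_1 f)) => j].
by have [_ [_]] := cf j.+1; apply.
Qed.

Lemma ck_comp1 {V : normedModType R} (U : set V) f (g : V -> R) : open U ->
  (forall k, ck k setT f) -> (forall k, ck k U g) -> forall k, ck k U (fun x => f (g x)).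
Proof.
move=> oU cf cg k.
have := @ck_comp R V k 1 _ (fun=> g) U oU (smooth_onevar cf) (fun=> cg).
by apply: ck_eq => // x _; rewrite mxE.
Qed.

(** The polynomial factor makes the family closed under derivation, so that smoothness is a single
    induction over all [p]. *)
Definition flat (p : {poly R}) (t : R) : R :=
  if 0 < t then p.[t^-1] * expR (- t^-1) else 0.

Lemma poly_expR_bounded (p : {poly R}) :
  exists C, forall s : R, 0 < s -> `|p.[s] * expR (- s)| <= C.
Proof.
elim/poly_ind: p.
  by exists 0 => s _; rewrite horner0 mul0r normr0.
move=> p c _; set q := p * 'X + c%:P.
have mono i : exists C, forall s : R, 0 < s -> `|s ^+ i * expR (- s)| <= C.
  case: i => [|i].
    exists 1 => s s0; rewrite mul1r ger0_norm ?expR_ge0// -expR0 ler_expR; lra.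
  exists (i.+1%:R ^+ i.+1) => s s0.
  have s0' := ltW s0.
  rewrite ger0_norm ?mulr_ge0 ?exprn_ge0 ?expR_ge0 //.
  rewrite expRN ler_pdivrMr ?expR_gt0//.
  (* With [n = i.+1], the bound [s / n <= exp (s / n)] raised to the power [n] gives
     [s ^+ n <= n ^+ n * exp s]. *)
  have -> : expR s = expR (s / i.+1%:R) ^+ i.+1.
    by rewrite -expRM_natl -mulr_natl mulrCA divff ?mulr1// pnatr_eq0.
  rewrite -exprMn lerXn2r ?nnegrE ?mulr_ge0 ?expR_ge0 //.
  rewrite mulrC -ler_pdivrMr ?ltr0n//.
  by apply: le_trans (expR_ge1Dx _); rewrite lerDr.
have /choice[C CP] := mono.
exists (\sum_(i < size q) `|q`_i| * C i) => s s0.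
rewrite horner_coef mulr_suml; apply: le_trans (ler_norm_sum _ _ _) _.
by apply: ler_sum => i _; rewrite -mulrA normrM ler_wpM2l // CP.
Qed.

Lemma is_derive_flat p (t : R) :
  is_derive t (1 : R) (flat p) (flat ('X ^+ 2 * (p - p^`())) t).
Proof.
have [t0|t0|<-] := ltgtP 0 t.
- have near_t : \forall s \near t, p.[s^-1] * expR (- s^-1) = flat p s.
    by apply: filterS (lt_nbhsr t0) => s s0; rewrite /flat s0.
  apply: near_eq_is_derive near_t _.
  have tn0 : t != 0 by rewrite gt_eqF.
  have dV : is_derive t (1 : R) (fun s : R => s^-1) (- t ^- 2).
    have := is_deriveV tn0 (is_derive_id t (1 : R)).
    by rewrite /GRing.scale /= mulr1.
  have dp : is_derive t (1 : R) (fun s : R => p.[s^-1]) (- t ^- 2 * p^`().[t^-1]).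
    have [dV1 dV2] := dV.
    have dh : derivable (horner p) t^-1 1 by exact: derivable_horner.
    have := derive1_comp dV1 dh; rewrite -derivE !derive1E dV2 => e.
    apply: DeriveDef; last by rewrite mulrC -e.
    apply/derivable1_diffP/(@differentiable_comp _ _ _ _ (fun s : R => s^-1) (horner p));
      by apply/derivable1_diffP.
  have de : is_derive t (1 : R) (fun s : R => expR (- s^-1)) (t ^- 2 * expR (- t^-1)).
    have := @is_derive1_comp R expR (fun s => - s^-1) t _ _ (is_derive_expR _) (is_deriveN dV).
    by rewrite opprK mulrC.
  have dM : is_derive t (1 : R) (fun s : R => p.[s^-1] * expR (- s^-1)) _ := is_deriveM dp de.
  rewrite /flat t0; apply: (is_derive_eq dM).
  rewrite /GRing.scale /= !hornerE /= -exprVn; ring.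
- have near_t : \forall s \near t, 0 = flat p s.
    by apply: filterS (lt_nbhsl t0) => s s0; rewrite /flat ltNge (ltW s0).
  apply: near_eq_is_derive near_t _.
  by rewrite /flat ltNge (ltW t0) /=; exact: is_derive_cst.
(* At 0 the difference quotient is [h] times a bounded function: multiplying [p] by ['X ^+ 2] turns
   the factor [h^-1] into [h]. *)
have [C CP] := poly_expR_bounded ('X ^+ 2 * p).
have c : (fun h : R => h^-1 *: (flat p (h *: 1 + 0) - flat p 0)) @ 0^' --> (0 : R).
  apply/cvgr0Pnorm_le => e e0.
  have C1 : 0 < `|C| + 1 by rewrite ltr_wpDl.
  have nh : \forall h \near (0 : R)^', `|h| < e / (`|C| + 1).
    have h0 : (fun h : R => h) @ 0^' --> (0 : R) by exact: cvg_within.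
    by have /cvgr0Pnorm_lt/(_ _ (divr_gt0 e0 C1)) := h0.
  apply: filterS nh => h; rewrite ltr_pdivlMr // => hlt.
  rewrite addr0 [h *: 1]mulr1 {2}/flat ltxx subr0.
  rewrite /flat; case: ifPn => [h0|_]; last by rewrite scaler0 normr0 ltW.
  apply: le_trans (ltW hlt).
  have -> : h^-1 *: (p.[h^-1] * expR (- h^-1)) = h * (('X ^+ 2 * p).[h^-1] * expR (- h^-1)).
    by rewrite -[LHS]/(h^-1 * _) !hornerE /=; field; rewrite gt_eqF.
  rewrite normrM ler_wpM2l //; apply: le_trans (CP _ _) _; first by rewrite invr_gt0.
  by apply: le_trans (ler_norm _) _; rewrite lerDl.
rewrite [X in is_derive _ _ _ X]/flat ltxx.
by apply: DeriveDef; [apply/cvg_ex; exists 0|exact: cvg_lim].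
Qed.

Lemma ck_flat p k : ck k setT (flat p).
Proof.
elim: k p => [|k IH] p.
  split=> // x _; apply: differentiable_continuous; apply/derivable1_diffP.
  by have [] := is_derive_flat p x.
exact: ck_onevar (is_derive_flat p) _ (IH _).
Qed.

Lemma flat1_gt0 t : 0 < t -> 0 < flat 1 t.
Proof. by move=> t0; rewrite /flat t0 hornerC mul1r expR_gt0. Qed.

Lemma flat1_ge0 t : 0 <= flat 1 t.
Proof. by rewrite /flat; case: ifP => // _; rewrite hornerC mul1r expR_ge0. Qed.

Lemma flat_le0 p t : t <= 0 -> flat p t = 0.
Proof. by rewrite /flat ltNge => ->. Qed.

(** Equal to 1 for [|t| <= 1] and to 0 for [2 <= |t|]. The denominator is positive because
    [4 - t * t] and [t * t - 1] have sum 3, so one of them is positive. *)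
Definition plateau (t : R) : R :=
  flat 1 (4 - t * t) / (flat 1 (4 - t * t) + flat 1 (t * t - 1)).

Lemma plateau_den_gt0 t : 0 < flat 1 (4 - t * t) + flat 1 (t * t - 1).
Proof.
have [t1|t1] := ltP 1 (t * t).
  by rewrite ltr_wpDl ?flat1_ge0 // flat1_gt0 // subr_gt0.
by rewrite ltr_pwDl ?flat1_ge0 // flat1_gt0 //; lra.
Qed.

Lemma plateau_ge0 t : 0 <= plateau t.
Proof. by rewrite divr_ge0 ?flat1_ge0 // ltW // plateau_den_gt0. Qed.

Lemma plateau1 t : `|t| <= 1 -> plateau t = 1.
Proof.
move=> t1; have tt : t * t <= 1.
  have -> : t * t = `|t| * `|t| by rewrite -normrM ger0_norm // -expr2 sqr_ge0.
  by rewrite mulr_ile1.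
rewrite /plateau (@flat_le0 _ (t * t - 1)) ?addr0 ?divff ?gt_eqF //.
  by rewrite flat1_gt0 // subr_gt0; lra.
by rewrite subr_le0.
Qed.

Lemma plateau0 t : 2 <= `|t| -> plateau t = 0.
Proof.
move=> t2; rewrite /plateau flat_le0 ?mul0r // subr_le0.
have -> : t * t = `|t| * `|t| by rewrite -normrM ger0_norm // -expr2 sqr_ge0.
by nra.
Qed.

Lemma ck_plateau k : ck k setT plateau.
Proof.
have o := @openT R.
have ct j : ck j setT (fun t : R => t).
  apply: ck_linear => [a x y|x] //; exact: cvg_id.
have ctt j : ck j setT (fun t : R => t * t) by exact: ckM.
have c4 j : ck j setT (fun t : R => 4 - t * t).
  have := ckD o (ck_cst j setT 4) (ckM o (ck_cst j setT (-1)) (ctt j)).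
  by apply: ck_eq => // t _; rewrite mulN1r.
have c1 j : ck j setT (fun t : R => t * t - 1).
  exact: ckD o (ctt j) (ck_cst j setT (-1)).
have f4 := ck_comp1 o (ck_flat 1) c4; have f1 := ck_comp1 o (ck_flat 1) c1.
apply: ckM => //; apply: ckV => //; last exact: ckD.
by move=> t _; rewrite gt_eqF // plateau_den_gt0.
Qed.

(** The inverse function, changed near 0 so as to be smooth on the whole line, because
    [smooth_closure] composes with functions smooth everywhere; the summand [plateau] keeps the
    denominator positive at 0. *)
Definition smooth_inv (c t : R) : R := t / (t * t + plateau (t / c)).

Lemma smooth_invE c t : 0 < c -> 2 * c <= `|t| -> smooth_inv c t = t^-1.
Proof.
move=> c0 ct; rewrite /smooth_inv plateau0 ?addr0.
  have [->|t0] := eqVneq t 0; first by rewrite mul0r invr0.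
  by rewrite invfM mulrA divff ?mul1r.
by rewrite normrM normfV (gtr0_norm c0) ler_pdivlMr.
Qed.

Lemma ck_smooth_inv c k : 0 < c -> ck k setT (smooth_inv c).
Proof.
move=> c0; have o := @openT R.
have ct j : ck j setT (fun t : R => t).
  apply: ck_linear => [a x y|x] //; exact: cvg_id.
apply: ckM => //; apply: ckV => //.
  move=> t _; rewrite gt_eqF //; have [->|t0] := eqVneq t 0.
    by rewrite mulr0 mul0r add0r plateau1 // normr0.
  by rewrite ltr_pwDl ?plateau_ge0 // -expr2 exprn_even_gt0.
apply: ckD => //; first exact: ckM.
have ctc j : ck j setT (fun t : R => t / c) by apply: ckM => //; exact: ck_cst.
exact: (ck_comp1 o ck_plateau ctc k).
Qed.

End onevar.

Section extension.
Context {R : realType} {n : nat}.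

Lemma rV_norm_le (z : 'rV[R]_n) c : 0 <= c ->
  (`|z| <= c) = [forall i, `|z ord0 i| <= c].
Proof.
move=> c0; rewrite /Num.norm /= mx_normrE.
apply/idP/forallP => [zc i|zc].
  by apply: le_trans zc; exact: (le_bigmax _ (fun ij => `|z ij.1 ij.2|) (ord0, i)).
by apply/bigmax_leP; split=> // -[i j] _; rewrite (ord1 i); exact: zc.
Qed.

Definition cube_bump (a : 'rV[R]_n) (e : R) (z : 'rV[R]_n) : R :=
  \prod_i plateau ((z ord0 i - a ord0 i) / e).

Lemma cube_bump1 a e z : 0 < e -> `|z - a| <= e -> cube_bump a e z = 1.
Proof.
move=> e0; rewrite rV_norm_le ?ltW // => /forallP ze.
apply: big1 => i _; apply: plateau1; rewrite normrM normfV (gtr0_norm e0).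
by rewrite ler_pdivrMr // mul1r; have := ze i; rewrite !mxE.
Qed.

Lemma cube_bump0 a e z : 0 < e -> 2 * e < `|z - a| -> cube_bump a e z = 0.
Proof.
move=> e0; rewrite ltNge rV_norm_le; last by rewrite mulr_ge0 ?ltW.
rewrite negb_forall => /existsP[i]; rewrite -ltNge !mxE => zi.
rewrite /cube_bump (bigD1 i) //= plateau0 ?mul0r //.
by rewrite normrM normfV (gtr0_norm e0) ler_pdivlMr // ltW.
Qed.

Lemma smooth_cube_bump a e : smooth_on setT (cube_bump a e).
Proof.
apply/smooth_onP => k; apply: ck_prod => [|i]; first exact: openT.
apply: (@ck_comp1 _ _ setT plateau (fun z : 'rV[R]_n => (z ord0 i - a ord0 i) / e));
  [exact: openT|exact: ck_plateau|move=> j].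
apply: ckM; [exact: openT| |exact: ck_cst].
apply: ckD; [exact: openT| |exact: ck_cst].
by have /smooth_onP := @smooth_coord R n i; apply.
Qed.

Lemma smooth_extension (U : set 'rV[R]_n) F a : open U -> U a -> smooth_on U F ->
  exists2 G, smooth_on setT G & \forall z \near a, G z = F z.
Proof.
move=> oU Ua sF.
have /nbhs_ballP[d /= d0 dU] : nbhs a U by apply: open_nbhs_nbhs.
(* The bump vanishes beyond distance [2 * e] of [a] while [U] contains the ball of radius [3 * e],
   so a point outside [U] has a neighbourhood on which the bump is 0. *)
pose e := d / 3; have e0 : 0 < e by rewrite divr_gt0.
exists (fun z => if `[< U z >] then cube_bump a e z * F z else 0).
  apply/smooth_onP => k; apply: ck_local => z _.
  have [Uz|nUz] := pselect (U z).
    exists U => //.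
    have B : ck k U (cube_bump a e).
      by apply: (@ck_subset _ _ _ setT) => //; have /smooth_onP := smooth_cube_bump a e; apply.
    have := ckM oU B ((smooth_onP _ _).1 sF k).
    by apply: ck_eq => // y; rewrite inE => Uy; rewrite asboolT.
  exists [set y | 2 * e < `|y - a|]; first split.
  - rewrite -[X in open X]/((fun p => `|p - a|) @^-1` [set x : R | 2 * e < x]).
    by apply: open_comp; [move=> p _; exact: continuous_normB|exact: open_gt].
  - rewrite /= ltNge; apply/negP => za; apply: nUz; apply: dU.
    rewrite -ball_normE /= distrC; apply: le_lt_trans za _.
    by rewrite /e; lra.
  have W : open [set y : 'rV[R]_n | 2 * e < `|y - a|].
    rewrite -[X in open X]/((fun p => `|p - a|) @^-1` [set x : R | 2 * e < x]).
    by apply: open_comp; [move=> p _; exact: continuous_normB|exact: open_gt].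
  apply: ck_eq (ck_cst k _ 0) => // y; rewrite inE /= => ya.
  by rewrite cube_bump0 // mul0r if_same.
apply/nbhs_ballP; exists e => //= z; rewrite -ball_normE /= distrC => za.
rewrite asboolT; first by rewrite cube_bump1 ?mul1r // ltW.
apply: dU; rewrite -ball_normE /= distrC; apply: lt_trans za _.
by rewrite /e; lra.
Qed.

End extension.

Lemma ck_coord (R : realType) n k (i : 'I_n) :
  ck k setT (fun z : 'rV[R]_n => z ord0 i).
Proof. by have /smooth_onP := @smooth_coord R n i; apply. Qed.

Lemma continuous_near_eq (T : topologicalType) (R : realType) (f g : T -> R) x :
  (\forall y \near x, f y = g y) -> {for x, continuous g} -> {for x, continuous f}.
Proof.
move=> fg cg; rewrite /prop_for /continuous_at (nbhs_singleton fg).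
by apply: cvg_trans cg; apply: near_eq_cvg; apply: filterS fg => y ->.
Qed.

(** * Differential spaces and tangent vectors *)

Section fspaces.
Context {R : realType}.
Implicit Types X Y Z : fspace R.

Lemma sm_continuous X (f : X -> R) : sm f -> continuous f.
Proof.
move=> sf x A nA; rewrite nbhsE /=; have := nA; rewrite nbhsE => -[U [oU Ux] UA].
exists (f @^-1` U); last by move=> y /UA.
split=> //; exists [set f @^-1` U]; last by rewrite bigcup_set1.
by move=> _ ->; apply: (@finI_from1 _ _ _ _ (f, U)); rewrite /=.
Qed.

Lemma fspace_nbhsP X (x : X) (A : set X) : nbhs x A <->
  exists n (g : 'I_n -> X -> R) e, [/\ 0 < e, forall i, sm (g i) &
    forall y, (forall i, `|g i y - g i x| < e) -> A y].
Proof.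
split; last first.
  move=> [n [g [e [e0 sg gA]]]].
  suff : \forall y \near x, forall i : 'I_n, `|g i y - g i x| < e.
    by apply: filterS => y; exact: gA.
  apply: (@filter_forall _ _ (fun (i : 'I_n) y => `|g i y - g i x| < e) (nbhs x)) => i; have := sm_continuous (sg i) (x := x).
  by move=> /cvgrPdist_lt /(_ _ e0); apply: filterS => y; rewrite distrC.
rewrite nbhsE => -[U [[D' D'P UE] Ux] UA].
move: Ux; rewrite -UE => -[B D'B Bx].
have [s sP BE] := D'P _ D'B.
have fU (i : 'I_(size (finmap.enum_fset s))) : (tnth (in_tuple (finmap.enum_fset s)) i) \in s.
  by rewrite -[_ \in s]/(_ \in finmap.enum_fset s) mem_tnth.
pose t i := tnth (in_tuple (finmap.enum_fset s)) i.
have tP i : sm (t i).1 /\ open (t i).2 by have /set_mem := sP _ (fU i).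
have tx i : (t i).2 ((t i).1 x) by have := Bx; rewrite -BE => /(_ _ (fU i)).
have /choice[e eP] : forall i, exists e : R, 0 < e /\ ball ((t i).1 x) e `<=` (t i).2.
  move=> i; have [_ oU] := tP i.
  have /nbhs_ballP[e e0 eU] : nbhs ((t i).1 x) (t i).2 by apply: open_nbhs_nbhs.
  by exists e.
(* The least of the radii serves for all [i]; starting from 1 keeps it meaningful for an empty
   family. *)
exists (size (finmap.enum_fset s)), (fun i => (t i).1), (\big[Num.min/1]_i e i); split.
- by apply: lt_bigmin => // i _; have [] := eP i.
- by move=> i; have [] := tP i.
move=> y yP; apply: UA; rewrite -UE; exists B => //.
suff : B y by [].
rewrite -BE => fV /= fVs.
have /tnthP[i ->] : fV \in in_tuple (finmap.enum_fset s) by [].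
have [_] := eP i; apply; rewrite -ball_normE /= distrC.
by apply: lt_le_trans (yP i) _; exact: bigmin_le.
Qed.

Lemma fspace_nearW X (x : X) (P : set X) : (forall y, P y) -> \forall y \near x, P y.
Proof. exact: (@filterE _ (nbhs x) (nbhs_filter x) P). Qed.

(** Most of the calculus uses this property alone. It holds for manifolds and for every generated
    space, so [cotangent] and [M] are handled without charts. *)
Definition sm_closed X := @smooth_closure R X `<=` @sm R X.

Lemma sm_comp X n (g : 'I_n -> X -> R) (F : 'rV[R]_n -> R) : sm_closed X ->
  (forall i, sm (g i)) -> smooth_on setT F -> sm (fun x => F (\row_i g i x)).
Proof. by move=> cX sg sF; apply: cX => x; exists n, g, F; split=> //; exact: fspace_nearW. Qed.

Lemma sm_local X (f : X -> R) : sm_closed X ->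
  (forall x : X, exists2 g, sm g & \forall y \near x, f y = g y) -> sm f.
Proof.
move=> cX fP; apply: cX => x; have [g sg fg] := fP x.
exists 1, (fun=> g), (fun z => z ord0 ord0); split=> //; first exact: smooth_coord.
by apply: filterS fg => y ->; rewrite mxE.
Qed.

Lemma sm_cst X (c : R) : sm_closed X -> sm (fun _ : X => c).
Proof.
move=> cX; apply: (@sm_comp X 0 (fun _ _ => 0) (fun=> c)) => // [[]//|].
by apply/smooth_onP => k; exact: ck_cst.
Qed.

Lemma sm_comp1 X (f : R -> R) (g : X -> R) : sm_closed X ->
  (forall k, ck k setT f) -> sm g -> sm (fun x => f (g x)).
Proof.
move=> cX cf sg; have := @sm_comp X 1 (fun=> g) _ cX (fun=> sg) (smooth_onevar cf).
by congr sm; apply/funext => x; rewrite mxE.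
Qed.

Lemma sm_comp2 X (F : 'rV[R]_2 -> R) (f g : X -> R) : sm_closed X ->
  smooth_on setT F -> sm f -> sm g ->
  sm (fun x => F (\row_i (if i == ord0 then f x else g x))).
Proof.
move=> cX sF sf sg; apply: (@sm_comp X 2 (fun i x => if i == ord0 then f x else g x)) => //.
by move=> i; case: eqP.
Qed.

Lemma smD X (f g : X -> R) : sm_closed X -> sm f -> sm g -> sm (fun x => f x + g x).
Proof.
move=> cX sf sg.
have : smooth_on setT (fun z : 'rV[R]_2 => z ord0 ord0 + z ord0 ord_max).
  by apply/smooth_onP => k; apply: ckD; [exact: openT|exact: ck_coord..].
move=> /(sm_comp2 cX)/(_ sf sg); congr sm; apply/funext => x.
by rewrite !mxE.
Qed.

Lemma smM X (f g : X -> R) : sm_closed X -> sm f -> sm g -> sm (fun x => f x * g x).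
Proof.
move=> cX sf sg.
have : smooth_on setT (fun z : 'rV[R]_2 => z ord0 ord0 * z ord0 ord_max).
  by apply/smooth_onP => k; apply: ckM; [exact: openT|exact: ck_coord..].
move=> /(sm_comp2 cX)/(_ sf sg); congr sm; apply/funext => x.
by rewrite !mxE.
Qed.

Lemma smN X (f : X -> R) : sm_closed X -> sm f -> sm (fun x => - f x).
Proof.
move=> cX sf; have := smM cX (sm_cst (-1) cX) sf.
by congr sm; apply/funext => x; rewrite mulN1r.
Qed.

Lemma smB X (f g : X -> R) : sm_closed X -> sm f -> sm g -> sm (fun x => f x - g x).
Proof. by move=> cX sf sg; apply: smD => //; exact: smN. Qed.

Lemma sm_sum X (I : Type) (r : seq I) (f : I -> X -> R) : sm_closed X ->
  (forall i, sm (f i)) -> sm (fun x => \sum_(i <- r) f i x).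
Proof.
move=> cX sf; elim: r => [|i r IH].
  by under eq_fun do rewrite big_nil; exact: sm_cst.
by under eq_fun do rewrite big_cons; exact: smD.
Qed.

Lemma sm_prod X (I : Type) (r : seq I) (f : I -> X -> R) : sm_closed X ->
  (forall i, sm (f i)) -> sm (fun x => \prod_(i <- r) f i x).
Proof.
move=> cX sf; elim: r => [|i r IH].
  by under eq_fun do rewrite big_nil; exact: sm_cst.
by under eq_fun do rewrite big_cons; exact: smM.
Qed.

Lemma sm_inv X (f : X -> R) x : sm_closed X -> sm f -> f x != 0 ->
  exists2 g, sm g & \forall y \near x, g y = (f y)^-1.
Proof.
(* [smooth_inv c] is the exact inverse from [2 * c] on, that is from half of [|f x|] on, and [|f y|]
   exceeds this for [y] near [x]. *)
move=> cX sf fx; pose c := `|f x| / 4; have c0 : 0 < c by rewrite divr_gt0 // normr_gt0.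
exists (fun y => smooth_inv c (f y)).
  by apply: sm_comp1 => // k; exact: ck_smooth_inv.
have e0 : 0 < `|f x| / 2 by rewrite divr_gt0 // normr_gt0.
have /cvgrPdist_lt/(_ _ e0) := sm_continuous sf (x := x); apply: filterS => y fxy.
apply: smooth_invE => //.
have := ler_distD (f y) (f x) 0; rewrite !subr0 /c => h; lra.
Qed.

Lemma sm_bump X (x : X) (A : set X) : sm_closed X -> nbhs x A ->
  exists b : X -> R, [/\ sm b, b x = 1 & forall y, ~ A y -> b y = 0].
Proof.
move=> cX /fspace_nbhsP[n [g [e [e0 sg gA]]]].
(* The factor [2 / e] makes [plateau], which is 0 on arguments of size at least 2, vanish as soon as
   [e <= |g i y - g i x|]. *)
exists (fun y => \prod_i plateau ((g i y - g i x) * (2 / e))); split.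
- apply: sm_prod => // i; apply: sm_comp1 => // [k|]; first exact: ck_plateau.
  by apply: smM => //; [apply: smB => //|]; exact: sm_cst.
- by apply: big1 => i _; rewrite subrr mul0r plateau1 // normr0.
move=> y nAy; have : ~ forall i, `|g i y - g i x| < e by move=> /gA.
move=> /existsNP[i /negP]; rewrite -leNgt => gi.
rewrite (bigD1 i) //= plateau0 ?mul0r // normrM (gtr0_norm (divr_gt0 _ _)) //.
by rewrite mulrCA ler_peMr // ler_pdivlMr // mul1r.
Qed.

Lemma smooth_map_continuous X Y (phi : X -> Y) : smooth_map phi -> continuous phi.
Proof.
move=> sphi x A /fspace_nbhsP[n [g [e [e0 sg gA]]]].
by apply/fspace_nbhsP; exists n, (fun i => g i \o phi), e; split=> // [i|y /gA//]; exact: sphi.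
Qed.

Lemma smooth_map_comp X Y Z (psi : Y -> Z) (phi : X -> Y) :
  smooth_map psi -> smooth_map phi -> smooth_map (psi \o phi).
Proof. by move=> spsi sphi f /spsi /sphi. Qed.

Lemma smooth_map_id X : smooth_map (@id X).
Proof. by []. Qed.

End fspaces.

Section generated.
Context {R : realType} (T : Type) (A : set (T -> R)).
Let XA := FSpace T A.
Let XG := gen_space A.

Lemma gen_sm (f : T -> R) : A f -> @sm R XG f.
Proof.
move=> Af x; exists 1, (fun=> f), (fun z => z ord0 ord0); split=> //.
  exact: smooth_coord.
by apply: fspace_nearW => y; rewrite mxE.
Qed.

Lemma gen_continuous (f : T -> R) : @sm R XG f -> continuous (f : XA -> R).
Proof.
move=> sf x; have [n [g [F [sg sF fF]]]] := sf x.
apply: (@continuous_near_eq XA R f _ x fF).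
apply: continuous_row => [i|]; first exact: (@sm_continuous R XA _ (sg i)).
exact: smooth_continuous sF _.
Qed.

(** Closing the generators under smooth operations does not refine the topology, since the new
    functions are locally continuous functions of generators. *)
Lemma gen_nbhs (x : T) (B : set T) : nbhs (x : XG) B <-> nbhs (x : XA) B.
Proof.
split=> /fspace_nbhsP[n [g [e [e0 sg gB]]]]; last first.
  by apply/fspace_nbhsP; exists n, g, e; split=> // i; exact/gen_sm/sg.
suff : \forall y \near (x : XA), forall i : 'I_n, `|g i y - g i x| < e.
  by apply: filterS => y; exact: gB.
apply: (@filter_forall _ _ (fun (i : 'I_n) y => `|g i y - g i x| < e) (nbhs (x : XA))) => i; have := gen_continuous (sg i) (x := x).
by move=> /cvgrPdist_lt /(_ _ e0); apply: filterS => y; rewrite distrC.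
Qed.

(** Local expressions substituted into a local expression give another one. The type [K] lists the
    generators of all the inner expressions, so that the composite has a single row as argument. *)
Lemma gen_sm_closed : sm_closed XG.
Proof.
move=> f fP x; have [n [g [F [sg sF fF]]]] := fP x.
have /choice[d dP] : forall i, exists d : {m : nat & (('I_m -> T -> R) * ('rV[R]_m -> R))%type},
    [/\ forall j, A ((projT2 d).1 j), smooth_on setT (projT2 d).2 &
    \forall y \near (x : XA), g i y = (projT2 d).2 (\row_j (projT2 d).1 j y)].
  move=> i; have [m [h [H [sh sH gH]]]] := sg i x.
  by exists (existT _ m (h, H)).
pose K := {i : 'I_n & 'I_(projT1 (d i))}.
pose h (k : 'I_#|{: K}|) := (projT2 (d (tag (enum_val k)))).1 (tagged (enum_val k)).
pose H (i : 'I_n) (z : 'rV[R]_#|{: K}|) : R := (projT2 (d i)).2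
  (\row_j z ord0 (enum_rank (Tagged (fun i => 'I_(projT1 (d i))) j))).
exists #|{: K}|, h, (fun z => F (\row_i H i z)); split.
- by move=> k; have [+ _ _] := dP (tag (enum_val k)); apply.
- apply: smooth_comp => // [|i]; first exact: openT.
  have [_ sH _] := dP i; apply: smooth_comp => // [|j]; first exact: openT.
  exact: smooth_coord.
have fF' : \forall y \near (x : XA), f y = F (\row_i g i y) by apply/gen_nbhs.
have gH : \forall y \near (x : XA), forall i, g i y = (projT2 (d i)).2 (\row_j (projT2 (d i)).1 j y).
  by apply: (@filter_forall _ _ (fun (i : 'I_n) y => g i y = (projT2 (d i)).2 (\row_j (projT2 (d i)).1 j y)) (nbhs (x : XA))) => i; have [] := dP i.
apply: filterS2 fF' gH => y -> gH; congr F.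
apply/rowP => i; rewrite !mxE gH /H; congr ((projT2 (d i)).2 _).
by apply/rowP => j; rewrite !mxE /h enum_rankK.
Qed.

Lemma smooth_map_gen (X : fspace R) (phi : X -> T) : sm_closed X ->
  (forall f, A f -> sm (f \o phi)) -> @smooth_map R X XG phi.
Proof.
move=> cX sphi f sf; apply: cX => x.
have [n [g [F [sg sF fF]]]] := sf (phi x).
exists n, (fun i => g i \o phi), F; split=> // [i|]; first exact/sphi/sg.
have : continuous (phi : X -> XA).
  move=> y B /fspace_nbhsP[m [h [e [e0 sh hB]]]]; apply/fspace_nbhsP.
  by exists m, (fun i => h i \o phi), e; split=> // [i|z /hB//]; exact/sphi/sh.
by move=> /(_ x _ fF).
Qed.

End generated.

Section tangents.
Context {R : realType}.
Implicit Types X Y Z : fspace R.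
Local Notation tv X := ((pt X -> R) -> R^o).

Lemma tangent_nonsm X (x : X) (v : tv X) f : tangent x v -> ~ sm f -> v f = 0.
Proof. by case=> + _ _; apply. Qed.

Lemma tangentL X (x : X) (v : tv X) a f g : tangent x v -> sm f -> sm g ->
  v (fun y => a * f y + g y) = a * v f + v g.
Proof. by case=> _ + _; apply. Qed.

Lemma tangentM X (x : X) (v : tv X) f g : tangent x v -> sm f -> sm g ->
  v (fun y => f y * g y) = v f * g x + f x * v g.
Proof. by case=> _ _; apply. Qed.

Lemma tangent_eq X (x x' : X) (v w : tv X) : tangent x v -> tangent x' w ->
  (forall f, sm f -> v f = w f) -> v = w.
Proof.
move=> tx tw vw; apply/funext => f.
have [sf|nf] := pselect (sm f); first exact: vw.
by rewrite (tangent_nonsm tx nf) (tangent_nonsm tw nf).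
Qed.

Lemma tangent_lin X (x : X) a (v w : tv X) : tangent x v -> tangent x w ->
  tangent x (a *: v + w).
Proof.
move=> tx tw; split=> [f nf|c f g sf sg|f g sf sg]; rewrite !fctE.
- by rewrite (tangent_nonsm tx nf) (tangent_nonsm tw nf) scaler0 addr0.
- rewrite (tangentL _ tx) // (tangentL _ tw) // -!/(_ * _) /GRing.scale /=; ring.
- rewrite (tangentM tx) // (tangentM tw) // /GRing.scale /=; ring.
Qed.

Lemma tangent0 X (x : X) : tangent x (0 : tv X).
Proof.
have z f : (0 : tv X) f = 0 by [].
by split=> [f nf|c f g sf sg|f g sf sg]; rewrite !z ?mulr0 ?mul0r ?addr0.
Qed.

Lemma tangentZ X (x : X) a (v : tv X) : tangent x v -> tangent x (a *: v).
Proof. by move=> tx; rewrite -[_ *: _]addr0; apply: tangent_lin => //; exact: tangent0. Qed.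

Lemma tangentD X (x : X) (v w : tv X) : tangent x v -> tangent x w -> tangent x (v + w).
Proof. by move=> tx tw; rewrite -[v]scale1r; exact: tangent_lin. Qed.

Lemma tangentN X (x : X) (v : tv X) : tangent x v -> tangent x (- v).
Proof. by move=> tx; rewrite -scaleN1r; exact: tangentZ. Qed.

Lemma tangentB X (x : X) (v w : tv X) : tangent x v -> tangent x w -> tangent x (v - w).
Proof. by move=> tx tw; apply: tangentD => //; exact: tangentN. Qed.

Lemma tangent_sum X (x : X) (I : Type) (r : seq I) (v : I -> tv X) :
  (forall i, tangent x (v i)) -> tangent x (\sum_(i <- r) v i).
Proof.
move=> tx; elim/big_ind: _ => //; first exact: tangent0.
by move=> v1 v2; exact: tangentD.
Qed.

Section closed.
Variable X : fspace R.
Hypothesis cX : sm_closed X.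
Variables (x : X) (v : tv X).
Hypothesis tx : tangent x v.

Lemma tangent_fun0 : v (fun=> 0) = 0.
Proof.
have := @tangentL _ _ _ (-1) (fun=> 0) (fun=> 0) tx (sm_cst 0 cX) (sm_cst 0 cX).
by under eq_fun do rewrite mulr0 addr0; rewrite mulN1r addNr.
Qed.

Lemma tangent_cst c : v (fun=> c) = 0.
Proof.
have v1 : v (fun=> 1) = 0.
  have := tangentM tx (sm_cst 1 cX) (sm_cst 1 cX).
  under eq_fun do rewrite mulr1; rewrite mulr1 mul1r.
  by move=> /eqP; rewrite -subr_eq subrr eq_sym => /eqP.
have := @tangentL _ _ _ c (fun=> 1) (fun=> 0) tx (sm_cst 1 cX) (sm_cst 0 cX).
by under eq_fun do rewrite mulr1 addr0; rewrite v1 tangent_fun0 mulr0 addr0.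
Qed.

Lemma tangent_funD f g : sm f -> sm g -> v (fun y => f y + g y) = v f + v g.
Proof.
by move=> sf sg; rewrite -[v f]mul1r -(tangentL _ tx) //; under [in RHS]eq_fun do rewrite mul1r.
Qed.

Lemma tangent_funZ c f : sm f -> v (fun y => c * f y) = c * v f.
Proof.
move=> sf; rewrite -[RHS]addr0 -tangent_fun0 -(tangentL _ tx) //; last exact: sm_cst.
by under [in RHS]eq_fun do rewrite addr0.
Qed.

Lemma tangent_funZr c f : sm f -> v (fun y => f y * c) = v f * c.
Proof.
by move=> sf; rewrite mulrC -tangent_funZ //; under eq_fun do rewrite mulrC.
Qed.

Lemma tangent_funN f : sm f -> v (fun y => - f y) = - v f.
Proof.
by move=> sf; rewrite -mulN1r -tangent_funZ //; under [in RHS]eq_fun do rewrite mulN1r.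
Qed.

Lemma tangent_funB f g : sm f -> sm g -> v (fun y => f y - g y) = v f - v g.
Proof. by move=> sf sg; rewrite tangent_funD ?tangent_funN //; exact: smN. Qed.

Lemma tangent_funsum (I : Type) (r : seq I) (f : I -> X -> R) : (forall i, sm (f i)) ->
  v (fun y => \sum_(i <- r) f i y) = \sum_(i <- r) v (f i).
Proof.
move=> sf; elim: r => [|i r IH].
  by rewrite big_nil -[RHS]tangent_fun0; under eq_fun do rewrite big_nil.
rewrite big_cons -IH -tangent_funD //; last exact: sm_sum.
by under eq_fun do rewrite big_cons.
Qed.

(** For a bump [b] that is 0 wherever [f] and [g] differ, the product [b * (f - g)] is zero, and the
    Leibniz rule at [x] returns [v (f - g)]. *)
Lemma tangent_local f g : sm f -> sm g -> (\forall y \near x, f y = g y) -> v f = v g.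
Proof.
move=> sf sg fg; have [b [sb b1 b0]] := sm_bump cX fg.
apply/eqP; rewrite -subr_eq0 -tangent_funB //; apply/eqP.
have sfg : sm (fun y => f y - g y) by exact: smB.
have := tangentM tx sb sfg.
have -> : (fun y => b y * (f y - g y)) = fun=> 0.
  apply/funext => y; have [->|nfg] := pselect (f y = g y); first by rewrite subrr mulr0.
  by rewrite b0 // mul0r.
by rewrite tangent_fun0 (nbhs_singleton fg) subrr mulr0 add0r b1 mul1r.
Qed.

(** In the expansion of [hadamard] at the image of [x], the Leibniz rule keeps only [v (g i)] times
    the value of [G i] at that image, which is a partial derivative of [F]. *)
Lemma tangent_chain n (g : 'I_n -> X -> R) (F : 'rV[R]_n -> R) :
  (forall i, sm (g i)) -> smooth_on setT F ->
  v (fun y => F (\row_i g i y)) = \sum_i 'D_('e_i) F (\row_i g i x) * v (g i).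
Proof.
move=> sg sF; have [G [sG [Ga FG]]] := hadamard (\row_i g i x) sF.
have sGg i : sm (fun y => G i (\row_i g i y)) by apply: sm_comp.
have sgx i : sm (fun y => g i y - g i x) by apply: smB => //; exact: sm_cst.
have -> : (fun y => F (\row_i g i y)) = fun y => F (\row_i g i x) +
    \sum_i (g i y - g i x) * G i (\row_i g i y).
  apply/funext => y; rewrite FG; congr (_ + _).
  by apply: eq_bigr => i _; rewrite !mxE.
rewrite tangent_funD; [|exact: sm_cst|by apply: sm_sum => // i; exact: smM].
rewrite tangent_cst add0r tangent_funsum; last by move=> i; exact: smM.
apply: eq_bigr => i _; rewrite (tangentM tx) // subrr mul0r addr0 -Ga mulrC.
by congr (_ * _); rewrite tangent_funB // ?tangent_cst ?subr0 //; exact: sm_cst.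
Qed.

End closed.

Lemma pushE X Y (phi : X -> Y) (v : tv X) f : sm f -> push phi v f = v (f \o phi).
Proof. by move=> sf; rewrite /push asboolT. Qed.

Lemma push_nonsm X Y (phi : X -> Y) (v : tv X) f : ~ sm f -> push phi v f = 0.
Proof. by move=> sf; rewrite /push asboolF. Qed.

Lemma push_tangent X Y (phi : X -> Y) (x : X) (v : tv X) : sm_closed Y ->
  smooth_map phi -> tangent x v -> tangent (phi x) (push phi v).
Proof.
move=> cY sphi tx; split=> [f nf|a f g sf sg|f g sf sg].
- exact: push_nonsm.
- rewrite !pushE //; last by apply: smD => //; apply: smM => //; exact: sm_cst.
  by rewrite -(tangentL a tx) //; exact: sphi.
- rewrite !pushE //; last exact: smM.
  by rewrite -(tangentM tx) //; exact: sphi.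
Qed.

Lemma push_comp X Y Z (psi : Y -> Z) (phi : X -> Y) (v : tv X) : smooth_map psi ->
  push psi (push phi v) = push (psi \o phi) v.
Proof.
move=> spsi; apply/funext => f; have [sf|nf] := pselect (sm f).
  by rewrite !pushE //; exact: spsi.
by rewrite !push_nonsm.
Qed.

Lemma push_lin X Y (phi : X -> Y) a (v w : tv X) :
  push phi (a *: v + w) = a *: push phi v + push phi w.
Proof.
apply/funext => f; have [sf|nf] := pselect (sm f); first by rewrite !fctE !pushE.
by rewrite !fctE !push_nonsm // scaler0 addr0.
Qed.

Lemma push0 X Y (phi : X -> Y) : push phi (0 : tv X) = 0.
Proof. by apply/funext => f; rewrite /push; case: ifP. Qed.

Lemma pushZ X Y (phi : X -> Y) a (v : tv X) : push phi (a *: v) = a *: push phi v.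
Proof. by rewrite -[a *: v]addr0 push_lin push0 addr0. Qed.

Lemma pushD X Y (phi : X -> Y) (v w : tv X) : push phi (v + w) = push phi v + push phi w.
Proof. by rewrite -[v in LHS]scale1r push_lin scale1r. Qed.

Lemma pushN X Y (phi : X -> Y) (v : tv X) : push phi (- v) = - push phi v.
Proof. by rewrite -scaleN1r pushZ scaleN1r. Qed.

Lemma pushB X Y (phi : X -> Y) (v w : tv X) : push phi (v - w) = push phi v - push phi w.
Proof. by rewrite pushD pushN. Qed.

Lemma push_sum X Y (phi : X -> Y) (I : Type) (r : seq I) (v : I -> tv X) :
  push phi (\sum_(i <- r) v i) = \sum_(i <- r) push phi (v i).
Proof.
elim: r => [|i r IH]; first by rewrite !big_nil push0.
by rewrite !big_cons pushD IH.
Qed.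

Lemma push_id X (x : X) (v : tv X) : tangent x v -> push (@id X) v = v.
Proof.
move=> tx; apply/funext => f; have [sf|nf] := pselect (sm f); first by rewrite pushE.
by rewrite push_nonsm // (tangent_nonsm tx).
Qed.

Lemma bracket_tangent X (V W : X -> tv X) (x : X) : sm_closed X ->
  vfield V -> vfield W -> tangent x (bracket V W x).
Proof.
move=> cX [tV sV] [tW sW]; have tVx := tV x; have tWx := tW x.
split=> [f nf|a f g sf sg|f g sf sg]; rewrite /bracket.
- have -> : (fun y => W y f) = fun=> 0 by apply/funext => y; exact: tangent_nonsm (tW y) nf.
  have -> : (fun y => V y f) = fun=> 0 by apply/funext => y; exact: tangent_nonsm (tV y) nf.
  by rewrite (tangent_fun0 cX tVx) (tangent_fun0 cX tWx) subrr.
- have -> : (fun y => W y (fun z => a * f z + g z)) = fun y => a * W y f + W y g.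
    by apply/funext => y; exact: tangentL (tW y) _ _.
  have -> : (fun y => V y (fun z => a * f z + g z)) = fun y => a * V y f + V y g.
    by apply/funext => y; exact: tangentL (tV y) _ _.
  rewrite (tangentL a tVx) ?(tangentL a tWx); try by [exact: sV|exact: sW].
  ring.
- have -> : (fun y => W y (fun z => f z * g z)) = fun y => W y f * g y + f y * W y g.
    by apply/funext => y; exact: tangentM (tW y) _ _.
  have -> : (fun y => V y (fun z => f z * g z)) = fun y => V y f * g y + f y * V y g.
    by apply/funext => y; exact: tangentM (tV y) _ _.
  have sVf := sV _ sf; have sVg := sV _ sg; have sWf := sW _ sf; have sWg := sW _ sg.
  rewrite (tangent_funD tVx); [|exact: smM..].
  rewrite (tangent_funD tWx); [|exact: smM..].
  rewrite !(tangentM tVx) // !(tangentM tWx) //; ring.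
Qed.

End tangents.

(** * Smooth functions on products and derivatives of slices *)

Section products.
Context {R : realType}.
Implicit Types X Y Z : fspace R.
Local Notation tv X := ((pt X -> R) -> R^o).

Lemma prod_sm_closed X Y : sm_closed (prod_space X Y).
Proof. exact: gen_sm_closed. Qed.

Lemma smooth_fst X Y : smooth_map (X := prod_space X Y) (Y := X) fst.
Proof. by move=> f sf; apply: gen_sm; left; exists f. Qed.

Lemma smooth_snd X Y : smooth_map (X := prod_space X Y) (Y := Y) snd.
Proof. by move=> f sf; apply: gen_sm; right; exists f. Qed.

Lemma smooth_pair X Y Z (phi : Z -> X) (psi : Z -> Y) : sm_closed Z ->
  smooth_map phi -> smooth_map psi ->
  smooth_map (X := Z) (Y := prod_space X Y) (fun z => (phi z, psi z)).
Proof.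
by move=> cZ sphi spsi; apply: smooth_map_gen => // f [|] [g sg <-]; [exact: sphi|exact: spsi].
Qed.

Lemma smooth_map_cst X Y (y : Y) : sm_closed X -> smooth_map (fun _ : X => y).
Proof. by move=> cX f sf; exact: sm_cst. Qed.

Lemma sm_slicel X Y (h : X * Y -> R) y : sm_closed X -> @sm R (prod_space X Y) h ->
  @sm R X (fun x => h (x, y)).
Proof.
move=> cX; apply: (@smooth_pair X Y X id (fun=> y)) => //; exact: smooth_map_cst.
Qed.

Lemma sm_slicer X Y (h : X * Y -> R) x : sm_closed Y -> @sm R (prod_space X Y) h ->
  @sm R Y (fun y => h (x, y)).
Proof.
move=> cY; apply: (@smooth_pair X Y Y (fun=> x) id) => //; exact: smooth_map_cst.
Qed.

Lemma prod_nbhs X Y (x : X) (y : Y) (B : set X) (C : set Y) :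
  nbhs x B -> nbhs y C -> nbhs ((x, y) : prod_space X Y) [set p | B p.1 /\ C p.2].
Proof.
move=> nB nC; apply: (@filterI (prod_space X Y) (nbhs ((x, y) : prod_space X Y)) _
  [set p | B p.1] [set p | C p.2]).
- exact: (smooth_map_continuous (@smooth_fst X Y) (x := (x, y)) nB).
- exact: (smooth_map_continuous (@smooth_snd X Y) (x := (x, y)) nC).
Qed.

(* Each generator of the product is a function of one factor only, hence of the
   form [f x + k y]. *)
Lemma prod_rep X Y (h : X * Y -> R) (x0 : X) (y0 : Y) : sm_closed X -> sm_closed Y ->
  @sm R (prod_space X Y) h ->
  exists n (f : 'I_n -> X -> R) (k : 'I_n -> Y -> R) (F : 'rV[R]_n -> R) B C,
    [/\ nbhs x0 B, nbhs y0 C, (forall i, sm (f i)) /\ (forall i, sm (k i)),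
      smooth_on setT F & 
      forall x y, B x -> C y -> h (x, y) = F (\row_i (f i x + k i y))].
Proof.
move=> cX cY sh; have [n [g [F [sg sF hF]]]] := sh (x0, y0).
have rep (g0 : X * Y -> R) : ([set (f \o fst : X * Y -> R) | f in @sm R X] `|`
    [set (f \o snd : X * Y -> R) | f in @sm R Y]) g0 ->
  exists fk : (X -> R) * (Y -> R), [/\ sm fk.1, sm fk.2 & forall x y, g0 (x, y) = fk.1 x + fk.2 y].
  case=> [[f sf <-]|[k sk <-]].
    by exists (f, fun=> 0); split=> // [|x y] /=; [exact: sm_cst|rewrite addr0].
  by exists (fun=> 0, k); split=> // [|x y] /=; [exact: sm_cst|rewrite add0r].
have /choice[fk fkP] := fun i => rep _ (sg i).
have [m [g' [e [e0 sg' gB]]]] := (fspace_nbhsP _ _).1 hF.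
have /choice[fk' fkP'] := fun i => rep _ (sg' i).
(* A generator is a sum of one function on each factor, so half of [e] is allotted to each. *)
have e2 : 0 < e / 2 by rewrite divr_gt0.
exists n, (fun i => (fk i).1), (fun i => (fk i).2), F,
  [set x | forall i : 'I_m, `|(fk' i).1 x - (fk' i).1 x0| < e / 2],
  [set y | forall i : 'I_m, `|(fk' i).2 y - (fk' i).2 y0| < e / 2]; split=> //.
- by apply/fspace_nbhsP; exists m, (fun i => (fk' i).1), (e / 2); split=> // i; have [] := fkP' i.
- by apply/fspace_nbhsP; exists m, (fun i => (fk' i).2), (e / 2); split=> // i; have [] := fkP' i.
- by split=> i; have [] := fkP i.
move=> x y /= Bx Cy; rewrite (gB (x, y)).
  by congr F; apply/rowP => i; rewrite !mxE; have [_ _ ->] := fkP i.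
move=> i; have [_ _ E] := fkP' i; rewrite !E opprD addrACA (splitr e).
by apply: le_lt_trans (ler_normD _ _) _; rewrite ltrD.
Qed.

Lemma tangent_slice X Y n (f : 'I_n -> X -> R) (k : 'I_n -> Y -> R)
    (F : 'rV[R]_n -> R) (h : X * Y -> R) B C (x : X) (y : Y) (v : tv X) :
  sm_closed X -> @sm R (prod_space X Y) h -> nbhs x B -> C y ->
  (forall i, sm (f i)) -> smooth_on setT F ->
  (forall x y, B x -> C y -> h (x, y) = F (\row_i (f i x + k i y))) ->
  tangent x v ->
  v (fun x => h (x, y)) = \sum_i 'D_('e_i) F (\row_i (f i x + k i y)) * v (f i).
Proof.
move=> cX sh nB Cy sf sF hF tx.
have sfk i : sm (fun x => f i x + k i y) by apply: smD => //; exact: sm_cst.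
have sl := sm_slicel y cX sh.
have sFk : sm (fun x => F (\row_i (f i x + k i y))).
  exact: (sm_comp (g := fun i x => f i x + k i y)).
rewrite (tangent_local cX tx sl sFk); last first.
  by apply: filterS nB => z Bz; exact: hF.
rewrite (tangent_chain cX tx (g := fun i x => f i x + k i y)) //.
apply: eq_bigr => i _; congr (_ * _).
by rewrite (tangent_funD tx) ?(tangent_cst cX tx) ?addr0 //; exact: sm_cst.
Qed.

Lemma near_nbhs (T : topologicalType) (x : T) (B : set T) : nbhs x B -> \forall y \near x, nbhs y B.
Proof. exact: nbhs_interior. Qed.

(** The coefficients [k i] are smooth on the product and the vector enters through [v (f i)] only:
    how the derivative of a slice depends on the vector and on [y] is then read off a finite sum. *)
Lemma slice_expansion X Y (h : X * Y -> R) (x0 : X) (y0 : Y) : sm_closed X -> sm_closed Y ->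
  @sm R (prod_space X Y) h ->
  exists n (f : 'I_n -> X -> R) (k : 'I_n -> X * Y -> R) B C,
    [/\ nbhs x0 B, nbhs y0 C, forall i, sm (f i), forall i, @sm R (prod_space X Y) (k i) &
      forall x y v, B x -> C y -> tangent x v ->
        v (fun x => h (x, y)) = \sum_i v (f i) * k i (x, y)].
Proof.
move=> cX cY sh; have [n [f [k [F [B [C [nB nC [sf sk] sF hF]]]]]]] := prod_rep x0 y0 cX cY sh.
have cP := @prod_sm_closed X Y.
exists n, f, (fun i p => 'D_('e_i) F (\row_i (f i p.1 + k i p.2))), [set x | nbhs x B], C.
split=> //; first exact: near_nbhs.
  move=> i; apply: (@sm_comp _ (prod_space X Y) n (fun i p => f i p.1 + k i p.2) (fun z => 'D_('e_i) F z)) => //.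
    move=> j; apply: smD => //; [exact: (@smooth_fst X Y (f j))|exact: (@smooth_snd X Y (k j))].
  exact: smooth_derive.
move=> x y v /= nx Cy tx; rewrite (tangent_slice cX sh nx Cy sf sF hF tx).
by apply: eq_bigr => i _; rewrite mulrC.
Qed.

Lemma sm_vfield_slice X Y (h : X * Y -> R) (V : X -> tv X) : sm_closed X -> sm_closed Y ->
  @sm R (prod_space X Y) h -> vfield V ->
  @sm R (prod_space X Y) (fun p => V p.1 (fun x => h (x, p.2))).
Proof.
move=> cX cY sh [tV sV]; have cP := @prod_sm_closed X Y.
apply: sm_local => // -[x0 y0].
have [n [f [k [B [C [nB nC sf sk hE]]]]]] := slice_expansion x0 y0 cX cY sh.
exists (fun p => \sum_i V p.1 (f i) * k i p).
  apply: sm_sum => // i; apply: smM => //.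
  exact: (@smooth_fst X Y (fun x => V x (f i)) (sV _ (sf i))).
have nP := prod_nbhs nB nC.
by apply: filterS nP => -[x y] [/= Bx Cy]; exact: hE.
Qed.

Lemma sm_section_slice X Y (h : X * Y -> R) (x0 : X) (xi : Y -> tv X) : sm_closed X -> sm_closed Y ->
  @sm R (prod_space X Y) h -> (forall y, tangent x0 (xi y)) ->
  (forall f, sm f -> sm (fun y => xi y f : R)) ->
  sm (fun y => xi y (fun x => h (x, y)) : R).
Proof.
move=> cX cY sh txi sxi; apply: sm_local => // y0.
have [n [f [k [B [C [nB nC sf sk hE]]]]]] := slice_expansion x0 y0 cX cY sh.
exists (fun y => \sum_i xi y (f i) * k i (x0, y)).
  apply: sm_sum => // i; apply: smM => //; first exact: sxi.
  exact: sm_slicer cY (sk i).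
by apply: filterS nC => y Cy; apply: hE => //; exact: nbhs_singleton.
Qed.

Lemma sm_slice_tangent X Y (h : X * Y -> R) (x0 : X) (v : tv X) : sm_closed X -> sm_closed Y ->
  @sm R (prod_space X Y) h -> tangent x0 v -> sm (fun y => v (fun x => h (x, y)) : R).
Proof.
move=> cX cY sh tv; apply: (@sm_section_slice X Y h x0 (fun=> v)) => // f _.
exact: sm_cst.
Qed.

(** Leibniz rule for the two occurrences of [y]: by [slice_expansion] one of them sits in
    [xi y (f i)], the other in [k i]. This will differentiate the vector field generated by a
    section. *)
Lemma section_slice_derive X Y (h : X * Y -> R) (x0 : X) (y0 : Y) (xi : Y -> tv X) (u : tv Y) :
  sm_closed X -> sm_closed Y ->
  @sm R (prod_space X Y) h -> (forall y, tangent x0 (xi y)) ->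
  (forall f, sm f -> sm (fun y => xi y f : R)) -> tangent y0 u ->
  u (fun y => xi y (fun x => h (x, y))) =
  u (fun y => xi y (fun x => h (x, y0))) + u (fun y => xi y0 (fun x => h (x, y))).
Proof.
move=> cX cY sh txi sxi tu.
have [n [f [k [B [C [nB nC sf sk hE]]]]]] := slice_expansion x0 y0 cX cY sh.
have Bx := nbhs_singleton nB; have Cy := nbhs_singleton nC.
have sxf i : sm (fun y => xi y (f i) : R) by exact: sxi.
have skx i : sm (fun y => k i (x0, y)) by exact: sm_slicer cY (sk i).
have -> : u (fun y => xi y (fun x => h (x, y))) =
    u (fun y => \sum_i xi y (f i) * k i (x0, y)).
  apply: (tangent_local cY tu).
  - exact: (sm_section_slice cX cY sh txi sxi).
  - by apply: sm_sum => // i; exact: smM.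
  - by apply: filterS nC => y Cy'; exact: hE.
have -> : (fun y => xi y (fun x => h (x, y0))) = (fun y => \sum_i xi y (f i) * k i (x0, y0)).
  by apply/funext => y; exact: hE.
have -> : u (fun y => xi y0 (fun x => h (x, y))) =
    u (fun y => \sum_i xi y0 (f i) * k i (x0, y)).
  apply: (tangent_local cY tu).
  - exact: sm_slice_tangent (txi y0).
  - by apply: sm_sum => // i; apply: smM => //; exact: sm_cst.
  - by apply: filterS nC => y Cy'; exact: hE.
rewrite !(tangent_funsum cY tu); first last.
- by move=> i; exact: smM.
- by move=> i; apply: smM => //; exact: sm_cst.
- by move=> i; apply: smM => //; exact: sm_cst.
rewrite -big_split; apply: eq_bigr => i _ /=.
rewrite !(tangentM tu) //; try exact: sm_cst.
by rewrite !(tangent_cst cY tu) mulr0 addr0 mul0r add0r.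
Qed.

(** Locally [h] is [F] of the sums [f i x + k i y], and both sides are the second derivative of [F]
    paired with the [v (f i)] and the [u (k i)]; [smooth_derive_comm] makes it symmetric. *)
Lemma slice_comm X Y (h : X * Y -> R) (x0 : X) (y0 : Y) (v : tv X) (u : tv Y) :
  sm_closed X -> sm_closed Y -> @sm R (prod_space X Y) h -> tangent x0 v -> tangent y0 u ->
  u (fun y => v (fun x => h (x, y))) = v (fun x => u (fun y => h (x, y))).
Proof.
move=> cX cY sh tv tu.
have [n [f [k [F [B [C [nB nC [sf sk] sF hF]]]]]]] := prod_rep x0 y0 cX cY sh.
have sFD i : smooth_on setT (fun z => 'D_('e_i) F z) by exact: smooth_derive.
have sfk i y : sm (fun x => f i x + k i y) by apply: smD => //; exact: sm_cst.
have skf i x : sm (fun y => f i x + k i y) by apply: smD => //; exact: sm_cst.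
have sDk i : sm (fun y => 'D_('e_i) F (\row_i (f i x0 + k i y))).
  exact: (sm_comp (g := fun i y => f i x0 + k i y) cY (skf^~ x0) (sFD i)).
have sDf i : sm (fun x => 'D_('e_i) F (\row_i (f i x + k i y0))).
  exact: (sm_comp (g := fun i x => f i x + k i y0) cX (sfk^~ y0) (sFD i)).
have -> : u (fun y => v (fun x => h (x, y))) =
    u (fun y => \sum_i 'D_('e_i) F (\row_i (f i x0 + k i y)) * v (f i)).
  apply: (tangent_local cY tu).
  - exact: sm_slice_tangent tv.
  - by apply: sm_sum => // i; apply: smM => //; exact: sm_cst.
  - by apply: filterS nC => y Cy; exact: tangent_slice nB Cy sf sF hF tv.
pose h' (p : Y * X) := h (p.2, p.1).
have sh' : @sm R (prod_space Y X) h'.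
  apply: (@smooth_pair X Y (prod_space Y X) snd fst (@prod_sm_closed Y X) _ _ h sh).
    exact: smooth_snd.
  exact: smooth_fst.
have -> : v (fun x => u (fun y => h (x, y))) =
    v (fun x => \sum_i 'D_('e_i) F (\row_i (f i x + k i y0)) * u (k i)).
  apply: (tangent_local cX tv).
  - exact: (sm_slice_tangent cY cX sh' tu).
  - by apply: sm_sum => // i; apply: smM => //; exact: sm_cst.
  apply: filterS nB => x Bx.
  have hF' y x' : C y -> B x' -> h' (y, x') = F (\row_i (k i y + f i x')).
    by move=> Cy Bx'; rewrite /h' /= hF //; congr F; apply/rowP => i; rewrite !mxE addrC.
  rewrite (tangent_slice cY sh' nC Bx sk sF hF' tu).
  suff -> : \row_i (k i y0 + f i x) = \row_i (f i x + k i y0) by [].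
  by apply/rowP => j; rewrite !mxE addrC.
rewrite (tangent_funsum cY tu); last by move=> i; apply: smM => //; exact: sm_cst.
rewrite (tangent_funsum cX tv); last by move=> i; apply: smM => //; exact: sm_cst.
under eq_bigr do rewrite (tangent_funZr cY tu) //.
under [RHS]eq_bigr do rewrite (tangent_funZr cX tv) //.
have uE i : u (fun y => 'D_('e_i) F (\row_i (f i x0 + k i y))) =
    \sum_j 'D_('e_j) (fun z => 'D_('e_i) F z) (\row_i (f i x0 + k i y0)) * u (k j).
  rewrite (tangent_chain cY tu (F := fun z => 'D_('e_i) F z) (skf^~ x0)) //.
  apply: eq_bigr => j _; congr (_ * _).
  by rewrite (tangent_funD tu) ?(tangent_cst cY tu) ?add0r //; exact: sm_cst.
have vE i : v (fun x => 'D_('e_i) F (\row_i (f i x + k i y0))) =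
    \sum_j 'D_('e_j) (fun z => 'D_('e_i) F z) (\row_i (f i x0 + k i y0)) * v (f j).
  rewrite (tangent_chain cX tv (F := fun z => 'D_('e_i) F z) (sfk^~ y0)) //.
  apply: eq_bigr => j _; congr (_ * _).
  by rewrite (tangent_funD tv) ?(tangent_cst cX tv) ?addr0 //; exact: sm_cst.
under eq_bigr do rewrite uE mulr_suml.
under [RHS]eq_bigr do rewrite vE mulr_suml.
rewrite exchange_big; apply: eq_bigr => i _; apply: eq_bigr => j _ /=.
by rewrite smooth_derive_comm // mulrAC.
Qed.

End products.

(** * Immersions *)

Section near.
Context {T : topologicalType}.
Implicit Types (x : T) (P Q : set T).

Lemma nearS x P Q : P `<=` Q -> nbhs x P -> nbhs x Q.
Proof. exact: filterS. Qed.

Lemma nearI x P Q : nbhs x P -> nbhs x Q -> nbhs x (P `&` Q).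
Proof. exact: filterI. Qed.

Lemma near_all (I : finType) x (P : I -> set T) :
  (forall i, nbhs x (P i)) -> nbhs x [set y | forall i, P i y].
Proof. by move=> nP; apply: (@filter_forall _ _ P). Qed.

End near.

Section noninjective.
Context {R : realType} {V : normedModType R}.

Lemma closed_le_fun (f g : V -> R) : continuous f -> continuous g ->
  closed [set y | f y <= g y].
Proof.
move=> cf cg; rewrite (_ : mkset _ = (fun y => f y - g y) @^-1` [set x | x <= 0]).
  apply: preimage_closed; last exact: closed_le.
  by move=> y _; apply: cvgB; [exact: cf|exact: cg].
by apply/seteqP; split=> y /=; rewrite subr_le0.
Qed.

Lemma derive0_small (F : V -> R) (x v : V) (e : R) : derivable F x v ->
  'D_v F x = 0 -> 0 < e -> \forall h \near 0^'+, `|F (h *: v + x) - F x| <= e * h.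
Proof.
move=> dF D0 e0.
have c : (fun h : R => h^-1 *: (F (h *: v + x) - F x)) @ 0^' --> 'D_v F x.
  by have := dF => /cvg_ex[l lP]; rewrite /derive /= (cvg_lim _ lP).
rewrite D0 in c; have {}c := cvg_dnbhs_at_right c.
have /cvgr0Pnorm_le/(_ _ e0) c' := c.
near=> h.
have h0 : 0 < h by near: h; exact: nbhs_right_gt.
have : `|h^-1 *: (F (h *: v + x) - F x)| <= e by near: h; exact: c'.
by rewrite normrZ normfV (gtr0_norm h0) mulrC ler_pdivrMr.
Unshelve. all: by end_near. Qed.


(* Along [v] the functions [F j] have zero derivative, so the largest value of [l]
   on the compact set of the points [y] of a cone with
   [sum_j |F j y - F j a| <= e * l (y - a)] is the imposed bound [T]; this
   replaces an integral curve of [v] issued from [a]. *)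
Lemma noninjective_flow (I : finType) (F : I -> V -> R) (l : V -> R) (C : R)
    (v : V -> V) (a : V) (B : set V) :
  (forall p M, compact [set y : V | `|y - p| <= M]) ->
  (forall j, continuous (F j)) -> (forall j y u, derivable (F j) y u) ->
  linear l -> continuous l ->
  (\forall y \near a, [/\ `|v y| <= C, 1 <= 2 * l (v y) & forall j, 'D_(v y) (F j) y = 0]) ->
  nbhs a B -> exists y, [/\ B y, y != a & forall j, F j y = F j a].
Proof.
move=> cpt cF dF ll cl nv nB.
have lD z w : l (z + w) = l z + l w by have := ll 1 z w; rewrite scale1r [_ *: l z]mul1r.
have l0 : l 0 = 0 by have := lD 0 0; rewrite addr0 => /eqP; rewrite -subr_eq subrr eq_sym => /eqP.
have lZ c z : l (c *: z) = c * l z by have := ll c z 0; rewrite !addr0 l0 addr0.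
have C0 : 0 < C.
  have [va lva _] := nbhs_singleton nv.
  have := le_trans (normr_ge0 _) va; rewrite le_eqVlt => /orP[/eqP C0|//].
  move: va; rewrite -C0 normr_le0 => /eqP va0; move: lva; rewrite va0 l0 mulr0.
  by rewrite ler10.
pose S y := \sum_j `|F j y - F j a|.
have cS : continuous S.
  rewrite /S; elim: (index_enum I) => [|j r IH] y.
    by under eq_fun do rewrite big_nil; exact: cvg_cst.
  under eq_fun do rewrite big_cons; apply: cvgD; last exact: IH.
  by apply: cvg_norm; apply: cvgB; [exact: cF|exact: cvg_cst].
have S0 y : 0 <= S y by exact: sumr_ge0.
have [r r0 rP] : exists2 r, 0 < r & forall y, `|y - a| <= r ->
    [/\ B y, `|v y| <= C, 1 <= 2 * l (v y) & forall j, 'D_(v y) (F j) y = 0].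
  have nBP : nbhs a (B `&` [set y | [/\ `|v y| <= C, 1 <= 2 * l (v y) &
      forall j, 'D_(v y) (F j) y = 0]]) by exact: filterI.
  move: nBP => /nbhs_ballP[r /= r0 rP].
  exists (r / 2); first by rewrite divr_gt0.
  move=> y yr; have [|By []//] := rP y.
  rewrite -ball_normE /= distrC; apply: le_lt_trans yr _.
  by rewrite ltr_pdivrMr // ltr_pMr // ltr1n.
(* Since [|v y| <= C <= K * l (v y)], moving along [v] preserves the cone
   [|y - a| <= K * l (y - a)]; the height [T = r / K] keeps the truncated cone in the ball of radius
   [r]. *)
pose K := 2 * C; have K0 : 0 < K by rewrite mulr_gt0.
pose T := r / K; have T0 : 0 < T by rewrite divr_gt0.
pose E := [set y | `|y - a| <= K * l (y - a) /\ l (y - a) <= T].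
have Er y : E y -> `|y - a| <= r.
  move=> [y1 y2]; apply: le_trans y1 _.
  by rewrite -ler_pdivlMl // mulrC.
have clB : continuous (fun y => l (y - a)).
  move=> y; apply: (@continuous_comp _ _ _ (fun y => y - a) l); last exact: cl.
  by apply: cvgB; [exact: cvg_id|exact: cvg_cst].
have cE : closed E.
  rewrite (_ : E = [set y | `|y - a| <= K * l (y - a)] `&` [set y | l (y - a) <= T]) //.
  apply: closedI; apply: closed_le_fun => //; first exact: continuous_normB.
    by move=> y; apply: cvgM; [exact: cvg_cst|exact: clB].
  by move=> y; exact: cvg_cst.
have lge0 y : E y -> 0 <= l (y - a).
  by move=> [y1 _]; have := le_trans (normr_ge0 _) y1; rewrite pmulr_rge0.
(* If the largest height on [A] were below [T], a short step along [v] from a highest point would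
   stay in [A] and be higher. *)
have reach e : 0 < e -> exists y, [/\ E y, l (y - a) = T & S y <= e * T].
  move=> e0; pose A := E `&` [set y | S y <= e * l (y - a)].
  have cA : compact A.
    apply: (@subclosed_compact _ _ [set y | `|y - a| <= r]) => //.
      apply: closedI => //; apply: closed_le_fun => //.
      by move=> y; apply: cvgM; [exact: cvg_cst|exact: clB].
    by move=> y [/Er].
  have Aa : A a.
    split; first by split; rewrite subrr l0 ?normr0 ?mulr0 //; exact: ltW.
    by rewrite /= /S subrr l0 mulr0 big1 // => j _; rewrite subrr normr0.
  have [||y yA ymax] := @compact_EVT_max _ R (fun y => l (y - a)) A _ cA.
  - by exists a.
  - exact: continuous_subspaceT.
  move: yA; rewrite inE => -[Ey Sy].
  have [y1 y2] := Ey.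
  have [lT|lT] := ltP (l (y - a)) T; last first.
    have lyT : l (y - a) = T by apply/eqP; rewrite eq_le y2 lT.
    by exists y; split=> //; rewrite -lyT.
  have [_ vC lv Dv] := rP y (Er y Ey).
  (* Over a step [h] the sum [S] grows by at most [#|I| * d * h <= e / 2 * h], and [e * l] grows at
     least as much because [1 / 2 <= l (v y)]; the added 1 covers an empty [I]. *)
  pose d := e / (2 * (#|I|%:R + 1)).
  have I1 : 0 < #|I|%:R + 1 :> R by rewrite ltr_wpDl.
  have d0 : 0 < d by rewrite divr_gt0 // mulr_gt0.
  have nF : \forall h \near 0^'+, forall j, `|F j (h *: v y + y) - F j y| <= d * h.
    apply: (@filter_forall _ _ (fun j h => `|F j (h *: v y + y) - F j y| <= d * h)) => j.
    by apply: derive0_small.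
  have lv0 : 0 < l (v y) by lra.
  have Tl0 : 0 < (T - l (y - a)) / l (v y) by rewrite divr_gt0 // subr_gt0.
  have [h [h0 hT hF]] : exists h : R, [/\ 0 < h, h < (T - l (y - a)) / l (v y) &
      forall j, `|F j (h *: v y + y) - F j y| <= d * h].
    near (0 : R)^'+ => h; exists h; split.
    - by near: h; exact: nbhs_right_gt.
    - by near: h; exact: nbhs_right_lt.
    - by near: h.
  have lh : l (h *: v y + y - a) = h * l (v y) + l (y - a) by rewrite -addrA lD lZ.
  suff Ah : A (h *: v y + y).
    have := ymax _ (mem_set Ah); rewrite lh -subr_ge0 opprD addrCA subrr addr0.
    by rewrite oppr_ge0 leNgt mulr_gt0.
  split; first split.
  - rewrite lh mulrDr -addrA; apply: le_trans (ler_normD _ _) _; apply: lerD => //.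
    rewrite normrZ (gtr0_norm h0) mulrCA ler_pM2l //; apply: le_trans vC _.
    by rewrite /K -mulrA mulrCA ler_peMr // ltW.
  - by rewrite lh -lerBrDr -ler_pdivlMr // ltW.
  rewrite /= lh mulrDr [leRHS]addrC.
  have : S (h *: v y + y) <= S y + \sum_(j : I) d * h.
    rewrite /S -big_split; apply: ler_sum => j _ /=.
    rewrite -[F j (h *: v y + y)](subrK (F j y)) -addrA addrC.
    by apply: le_trans (ler_normD _ _) _; rewrite lerD2l.
  move=> Sh; apply: le_trans Sh _; apply: lerD => //.
  rewrite sumr_const -mulr_natl mulrA.
  have Nd : #|I|%:R * d <= e / 2.
    have -> : e / 2 = (#|I|%:R + 1) * d by rewrite /d; field; rewrite gt_eqF.
    by rewrite ler_pM2r // lerDl.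
  apply: le_trans (ler_wpM2r (ltW h0) Nd) _.
  by rewrite [leRHS]mulrA [leLHS]mulrAC ler_pM2l ?mulr_gt0 //; lra.
have [y1 [Ey1 ly1 _]] := reach 1 ltr01.
pose A := E `&` [set y | T <= l (y - a)].
have cA : compact A.
  apply: (@subclosed_compact _ _ [set y | `|y - a| <= r]) => //.
    by apply: closedI => //; apply: closed_le_fun => // y; exact: cvg_cst.
  by move=> y [/Er].
have [||y0 y0A ymin] := @compact_EVT_min _ R S A _ cA.
- by exists y1; split=> //=; rewrite ly1.
- exact: continuous_subspaceT.
move: y0A; rewrite inE => -[Ey0 ly0].
have Sy0 : S y0 = 0.
  apply/eqP; rewrite eq_le S0 andbT leNgt; apply/negP => Sy0.
  (* With this slope, [reach] produces a point of height [T] where [S] is at most half of its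
     minimum. *)
  have e0 : 0 < S y0 / (2 * T) by rewrite divr_gt0 // mulr_gt0.
  have [y [Ey ly Sy]] := reach _ e0.
  have Ay : A y by split=> //=; rewrite ly.
  have := le_trans (ymin _ (mem_set Ay)) Sy.
  have -> : S y0 / (2 * T) * T = S y0 / 2 by field; rewrite gt_eqF.
  by lra.
have [By0 _ _ _] := rP y0 (Er _ Ey0).
exists y0; split=> //.
  by apply/eqP => ya; move: ly0; rewrite /= ya subrr l0 leNgt T0.
move=> j; apply/eqP; rewrite -subr_eq0 -normr_eq0; apply/eqP.
by move/psumr_eq0P: Sy0 => ->.
Unshelve. all: by end_near. Qed.

End noninjective.

Section manifolds.
Context {R : realType}.
Implicit Types X Y : fspace R.
Local Notation tv X := ((pt X -> R) -> R^o).

Lemma manifold_sm_closed n X : manifold n X -> sm_closed X.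
Proof. by case. Qed.

Lemma continuous_rowf X n (phi : X -> 'rV[R]_n) (x : X) (B : set 'rV[R]_n) :
  (forall i, sm (fun y => phi y ord0 i)) -> nbhs (phi x) B -> \forall y \near x, B (phi y).
Proof.
move=> sphi nB.
have e y : phi y = \row_i phi y ord0 i by apply/rowP => i; rewrite mxE.
have := @near_row R X n (fun i y => phi y ord0 i) x B.
rewrite -e => /(_ _ nB) H.
apply: (nearS _ (H _)) => [y|i]; first by rewrite -e.
exact: (sm_continuous (sphi i) (x := x)).
Qed.

Lemma chart_inverse_continuous X n (U : set X) (phi : X -> 'rV[R]_n)
    (theta : 'rV[R]_n -> X) (x : X) (B : set X) :
  open (phi @` U) -> U x ->
  (forall y, U y -> theta (phi y) = y) ->
  (forall f : X -> R, sm f ->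
     exists2 F, smooth_on (phi @` U) F & {in U, f =1 F \o phi}) ->
  nbhs x B -> nbhs (phi x) [set y | (phi @` U) y /\ B (theta y)].
Proof.
move=> oW Ux thetaK chart /fspace_nbhsP[m [g [e [e0 sg gB]]]].
have /choice[F FP] : forall i, exists F, smooth_on (phi @` U) F /\ {in U, g i =1 F \o phi}.
  by move=> i; have [F sF gF] := chart _ (sg i); exists F.
have Wx : (phi @` U) (phi x) by exists x.
have nW : nbhs (phi x) (phi @` U) by exact: open_nbhs_nbhs.
have nF : nbhs (phi x) [set y | forall i, `|F i y - F i (phi x)| < e].
  apply: (near_all (P := fun i y => `|F i y - F i (phi x)| < e)) => i.
  have [sF _] := FP i.
  have /cvgrPdist_lt/(_ _ e0) := smooth_continuous sF Wx.
  by apply: nearS => y; rewrite /= distrC.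
apply: (nearS _ (nearI nW nF)) => y [Wy Fy]; split=> //.
case: Wy Fy => z Uz <- Fz; apply: gB => i; rewrite thetaK //.
have [_ gF] := FP i; have := Fz i.
have /= <- := gF z (mem_set Uz); by have /= <- := gF x (mem_set Ux).
Qed.

(** In charts the components of [phi] have zero derivative along [V]. If [V] were nonzero at a
    point, [noninjective_flow] would give a second point nearby with the same image. *)
Lemma injective_immersion X Y n m (phi : X -> Y) (V : X -> tv X) :
  manifold n X -> manifold m Y -> smooth_map phi -> injective phi -> vfield V ->
  (forall x, push phi (V x) = 0) -> forall x, V x = 0.
Proof.
move=> mX mY sphi injphi [tV sV] V0 x0; apply: contrapT => Vx0.
have cX := manifold_sm_closed mX.
have [U [ch [[oU Ux0 sch injch oW] chart]]] := manifold_chart mX x0.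
have [U' [ch' [[oU' U'x0 sch' injch' oW'] chart']]] := manifold_chart mY (phi x0).
pose W := ch @` U; pose a := ch x0; have Wa : W a by exists x0.
pose theta y := xget x0 [set x | U x /\ ch x = y].
have thetaP y : W y -> U (theta y) /\ ch (theta y) = y.
  by move=> [x Ux chx]; apply: (@xgetPex _ x0 [set x | U x /\ ch x = y]); exists x.
have thetaK x : U x -> theta (ch x) = x.
  move=> Ux; have [Ut cht] := thetaP (ch x) (imageP ch Ux).
  by apply: injch => //; rewrite inE.
have /choice[H HP] : forall i, exists H, smooth_on W H /\
    {in U, (fun x => V x (fun y => ch y ord0 i) : R) =1 H \o ch}.
  by move=> i; have [F sF gF] := chart _ (sV _ (sch i)); exists F.
pose f j : X -> R := fun x => ch' (phi x) ord0 j.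
have sf j : sm (f j) by exact: sphi (sch' j).
(* [noninjective_flow] asks for functions derivable everywhere, so the components are extended from
   the chart; agreement is guaranteed near [a] only, and the second point is later kept in that
   region. *)
have /choice[F FP] : forall j, exists F : 'rV[R]_n -> R, smooth_on setT F /\
    \forall y \near a, forall x, U x -> ch x = y -> F y = f j x.
  move=> j; have [F0 sF0 fF0] := chart _ (sf j).
  have [F sF FF0] := smooth_extension oW Wa sF0.
  exists F; split=> //; apply: nearS FF0 => y /= -> x Ux <-.
  by rewrite (fF0 x) ?inE.
pose v (y : 'rV[R]_n) : 'rV[R]_n := \row_i V (theta y) (fun y => ch y ord0 i).
have vE y : W y -> v y = \row_i H i y.
  move=> Wy; have [Ut cht] := thetaP y Wy; apply/rowP => i; rewrite !mxE.
  by have [_ ->] := HP i; rewrite ?inE //= cht.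
have nW : nbhs a W by exact: open_nbhs_nbhs.
have chain (G : 'rV[R]_n -> R) (g : X -> R) x : U x -> sm g -> smooth_on setT G ->
    (\forall y \near ch x, forall x', U x' -> ch x' = y -> G y = g x') ->
    V x g = 'D_(v (ch x)) G (ch x).
  move=> Ux sg sG nG.
  have row_ch y : \row_i ch y ord0 i = ch y by apply/rowP => i; rewrite mxE.
  have sGc : sm (fun y => G (ch y)).
    have := sm_comp cX sch sG; congr sm; apply/funext => y; by rewrite row_ch.
  rewrite (tangent_local cX (tV x) sg sGc); last first.
    have nU : nbhs x U by exact: open_nbhs_nbhs.
    apply: (nearS _ (nearI nU (continuous_rowf sch nG))) => y [Uy nGy].
    by rewrite (nGy y).
  have -> : (fun y => G (ch y)) = fun y => G (\row_i ch y ord0 i).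
    by apply/funext => y; rewrite row_ch.
  rewrite (tangent_chain cX (tV x) sch sG) row_ch smooth_dir //.
  by apply: eq_bigr => i _; rewrite mulrC mxE thetaK.
have va0 : v a != 0.
  apply/eqP => va0; apply: Vx0.
  apply: (tangent_eq (tV x0) (tangent0 x0)) => g sg.
  have [G0 sG0 gG0] := chart _ sg.
  have [G sG GG0] := smooth_extension oW Wa sG0.
  rewrite (chain G) // -/a ?va0 ?derive0 //.
  by apply: nearS GG0 => y /= -> x Ux <-; rewrite (gG0 x) ?inE.
have [i0 vi0] : exists i, v a ord0 i != 0.
  apply/existsP; apply: contraNT va0 => /existsPn va.
  by apply/eqP/rowP => i; rewrite [RHS]mxE; apply/eqP; have := va i; rewrite negbK.
(* A coordinate in which [v a] does not vanish, scaled so that [l (v a) = 1]; by continuity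
   [1 <= 2 * l (v y)] near [a]. *)
pose l (z : 'rV[R]_n) : R := (v a ord0 i0)^-1 * z ord0 i0.
have ll : linear l by move=> c z w; rewrite /l !mxE mulrDr mulrCA.
have la : l (v a) = 1 by rewrite /l mulVf.
have cl : continuous l.
  by move=> z; apply: (@ck_cont R _ 0 setT l) => //; apply: ckM;
    [exact: openT|exact: ck_cst|exact: ck_coord].
have cH i : {for a, continuous (H i)}.
  by have [sH _] := HP i; exact: smooth_continuous sH Wa.
have e1 : 0 < 2^-1 :> R by rewrite invr_gt0.
have nv1 : nbhs a [set y | forall i, `|H i a - H i y| <= 1].
  apply: (near_all (P := fun i y => `|H i a - H i y| <= 1)) => i.
  by have /cvgrPdist_le/(_ _ ltr01) := cH i.
have nv2 : nbhs a [set y | `|l (\row_i H i a) - l (\row_i H i y)| <= 2^-1].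
  have c := @continuous_row R 'rV[R]_n n H a l cH (@cl _).
  by have /cvgrPdist_le/(_ _ e1) := c.
have [A nA DF] : exists2 A, nbhs a A & forall y, A y -> forall j, 'D_(v y) (F j) y = 0.
  exists (W `&` [set y | forall j, \forall z \near y, forall x, U x -> ch x = z -> F j z = f j x]).
    apply: nearI => //; apply: near_all => j; apply: nbhs_interior.
    by have [] := FP j.
  move=> y [Wy nF] j; have [Ut cht] := thetaP y Wy; have [sF _] := FP j.
  have := chain (F j) (f j) (theta y) Ut (sf j) sF; rewrite cht => <-; last exact: nF.
  have := V0 (theta y); move/(congr1 (fun w => w (fun z => ch' z ord0 j))).
  by rewrite pushE.
have nB : nbhs a ([set y | W y /\ U' (phi (theta y))] `&` 
    [set y | forall j, forall x, U x -> ch x = y -> F j y = f j x]).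
  apply: nearI.
    apply: (@chart_inverse_continuous X n U ch theta x0 [set x | U' (phi x)]) => //.
    by apply: (smooth_map_continuous sphi (x := x0)); exact: open_nbhs_nbhs.
  by apply: near_all => j; have [] := FP j.
have [] := @noninjective_flow R _ _ F l (`|v a| + 1) v a _ (@compact_nball R n) _ _ ll cl _ nB.
- by move=> j y; have [sF _] := FP j; exact: smooth_continuous sF _.
- by move=> j y u; have [sF _] := FP j; exact: smooth_derivable sF _.
- apply: (nearS _ (nearI nW (nearI nA (nearI nv1 nv2)))) => y [Wy [Ay [v1 v2]]].
  split; last exact: DF.
    rewrite -[v y](subrK (v a)) addrC; apply: le_trans (ler_normD _ _) _.
    rewrite lerD2l rV_norm_le //; apply/forallP => i.
    by rewrite vE // (vE a) // !mxE distrC.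
  have := v2; rewrite /= -!vE // la => h; have := ler_norm (1 - l (v y)); lra.
move=> y [[[Wy U'y] FE] ya Fya]; have [Ut cht] := thetaP y Wy.
move/eqP: ya; apply; rewrite -cht; congr ch.
apply: injphi; apply: injch'; rewrite ?inE //.
apply/rowP => j; rewrite -[LHS]/(f j (theta y)) -[RHS]/(f j x0).
rewrite -(FE j _ Ut cht) Fya.
by have [_ nF] := FP j; exact: (nbhs_singleton nF).
Qed.

End manifolds.

(** * Frames *)

Section linalg.
Context {R : realType}.

(** The points are chosen one by one: as long as [k < n], some nonzero combination of the [b i]
    vanishes at the [k] chosen points, and independence provides a new point where it does not. *)
Lemma lin_indep_eval (T : Type) n (b : 'I_n -> T -> R^o) : lin_indep b ->
  exists t : 'I_n -> T, (\matrix_(i, j) b i (t j)) \in unitmx.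
Proof.
move=> ib.
have step k : (k <= n)%N -> exists t : 'I_k -> T,
    forall y : 'cV[R]_k, (\matrix_(i, j) b i (t j)) *m y = 0 -> y = 0.
  elim: k => [|k IH] kn; first by exists (fun i : 'I_0 => False_rect T (notF (ltn_ord i))) => y _; apply/colP => -[].
  have [t tP] := IH (ltnW kn).
  pose A : 'M[R]_(n, k) := \matrix_(i, j) b i (t j).
  have kA : kermx A != 0.
    rewrite -mxrank_eq0 mxrank_ker subn_eq0 -ltnNge.
    exact: leq_ltn_trans (rank_leq_col A) kn.
  have [c [cA c0]] : exists c : 'rV[R]_n, c *m A = 0 /\ c != 0.
    have /rowV0Pn[c ck c0] := kA; exists c; split=> //.
    by apply/sub_kermxP.
  have [s cs] : exists s, \sum_i c ord0 i * b i s != 0.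
    apply: contrapT => /forallNP H; move/eqP: c0; apply; apply/rowP => i; rewrite mxE.
    apply: (ib (fun i => c ord0 i)); apply/funext => s.
    have /negP := H s; rewrite negbK => /eqP Hs.
    by rewrite fct_sumE; exact: Hs.
  exists (fun j : 'I_k.+1 => if unlift ord_max j is Some j' then t j' else s) => y Ay.
  have E i : \sum_j b i (t j) * y (lift ord_max j) ord0 + b i s * y ord_max ord0 = 0.
    have := congr1 (fun M : 'cV[R]_n => M i ord0) Ay; rewrite !mxE.
    rewrite big_ord_recr /= mxE unlift_none => e; rewrite -[RHS]e; congr (_ + _).
    apply: eq_bigr => j _; rewrite mxE.
    have -> : widen_ord (leqnSn k) j = lift ord_max j by apply/val_inj; exact: esym (lift_max j).
    by rewrite liftK.
  have ymax : y ord_max ord0 = 0.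
    have : \sum_i c ord0 i * (\sum_j b i (t j) * y (lift ord_max j) ord0 + b i s * y ord_max ord0) = 0.
      by apply: big1 => i _; rewrite E mulr0.
    under eq_bigr do rewrite mulrDr mulrA.
    rewrite big_split /= -mulr_suml.
    have -> : \sum_i c ord0 i * (\sum_j b i (t j) * y (lift ord_max j) ord0) = 0.
      under eq_bigr do rewrite mulr_sumr.
      rewrite exchange_big /=; apply: big1 => j _.
      under eq_bigr do rewrite mulrA.
      rewrite -mulr_suml; have := congr1 (fun M : 'rV[R]_k => M ord0 j) cA; rewrite !mxE.
      under eq_bigr do rewrite mxE.
      by move=> ->; rewrite mul0r.
    by rewrite add0r => /eqP; rewrite mulf_eq0 (negPf cs) => /eqP.
  have y0 : \col_j y (lift ord_max j) ord0 = 0.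
    apply: tP; apply/colP => i; rewrite !mxE -[RHS](E i) ymax mulr0 addr0.
    by apply: eq_bigr => j _; rewrite !mxE.
  apply/colP => j; rewrite mxE; case: (unliftP ord_max j) => [j' ->|->//].
  by have := congr1 (fun M : 'cV[R]_k => M j' ord0) y0; rewrite !mxE.
have [t tP] := step n (leqnn n); exists t.
rewrite -unitmx_tr -row_free_unit -kermx_eq0; apply/eqP/row_matrixP => i.
rewrite row0; apply: trmx_inj; rewrite trmx0; apply: tP.
by rewrite -[X in X *m _]trmxK -trmx_mul -row_mul mulmx_ker row0 trmx0.
Qed.

End linalg.

Section frames.
Context {R : realType}.
Implicit Types X : fspace R.
Local Notation tv X := ((pt X -> R) -> R^o).

Lemma sm_det X n (M : X -> 'M[R]_n) : sm_closed X ->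
  (forall i j, sm (fun x => M x i j)) -> sm (fun x => \det (M x)).
Proof.
move=> cX sM; apply: sm_sum => // s; apply: smM => //; first exact: sm_cst.
exact: sm_prod.
Qed.

Lemma sm_adj X n (M : X -> 'M[R]_n) i j : sm_closed X ->
  (forall i j, sm (fun x => M x i j)) -> sm (fun x => (\adj (M x)) i j).
Proof.
move=> cX sM; under eq_fun do rewrite mxE; apply: smM => //; first exact: sm_cst.
by apply: sm_det => // k l; under eq_fun do rewrite !mxE; exact: sM.
Qed.

Lemma vfield_scale X (a : X -> R) (V : X -> tv X) : sm_closed X -> sm a -> vfield V ->
  vfield (fun x => a x *: V x).
Proof.
move=> cX sa [tV sV]; split=> [x|f sf]; first exact: tangentZ.
by apply: (smM cX sa); exact: sV.
Qed.

Lemma vfield_sum X n (V : 'I_n -> X -> tv X) : sm_closed X -> (forall i, vfield (V i)) ->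
  vfield (fun x => \sum_i V i x).
Proof.
move=> cX vV; split=> [x|f sf]; first by apply: tangent_sum => i; have [] := vV i.
have -> : (fun x => (\sum_i V i x) f : R) = fun x => \sum_i (V i x f : R).
  by apply/funext => x; rewrite fct_sumE.
by apply: sm_sum => // i; have [_] := vV i; apply.
Qed.

(* Cramer's rule, applied to the derivatives of finitely many functions. *)
Lemma frame_coef X n (V : 'I_n -> X -> tv X) (x0 : X) : sm_closed X ->
  (forall i, vfield (V i)) -> lin_indep (V^~ x0) ->
  exists (f : 'I_n -> X -> R) (B : 'I_n -> 'I_n -> X -> R),
    [/\ forall j, sm (f j), forall j i, sm (B j i) &
      \forall x \near x0, forall c : 'I_n -> R, forall i,
        c i = \sum_j (\sum_i c i *: V i x) (f j) * B j i x].
Proof.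
move=> cX vV iV; have [f fP] := lin_indep_eval iV.
pose M x : 'M[R]_n := \matrix_(i, j) V i x (f j).
(* Derivations vanish on functions that are not smooth, so such an [f j] would give a zero
   column. *)
have sf j : sm (f j).
  apply: contrapT => nf; move: fP; rewrite unitmxE unitfE => /eqP; apply.
  rewrite (expand_det_col _ j) big1 // => i _; rewrite mxE.
  by have [tV _] := vV i; rewrite (tangent_nonsm (tV x0) nf) mul0r.
have sM i j : sm (fun x => M x i j).
  by under eq_fun do rewrite mxE; have [_] := vV i; apply.
have dM : \det (M x0) != 0 by move: fP; rewrite unitmxE unitfE.
have [d sd dE] := sm_inv cX (sm_det cX sM) dM.
exists f, (fun j i x => (\adj (M x)) j i * d x); split=> // [j i|].
  by apply: smM => //; exact: sm_adj.
have nM : \forall x \near x0, \det (M x) != 0.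
  have nb : nbhs (\det (M x0)) [set t : R | t != 0].
    by apply: open_nbhs_nbhs; split=> //; exact: open_neq.
  exact: (sm_continuous (sm_det cX sM) nb).
apply: (nearS _ (nearI dE nM)) => x /= [-> Mx] c i.
pose cv : 'rV[R]_n := \row_i c i.
have cM j : (\sum_i c i *: V i x) (f j) = (cv *m M x) ord0 j.
  by rewrite fct_sumE !mxE; apply: eq_bigr => k _; rewrite !mxE.
under eq_bigr do rewrite cM mulrA.
rewrite -mulr_suml; have -> : \sum_j (cv *m M x) ord0 j * (\adj (M x)) j i =
    (cv *m M x *m \adj (M x)) ord0 i by rewrite [RHS]mxE.
by rewrite -mulmxA mul_mx_adj mul_mx_scalar !mxE mulrAC divff ?mul1r.
Qed.

(** A local substitute for coordinates: the [f j] play the part of coordinate functions and the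
    [Z j] that of the associated frame, so a vector is known from its values on finitely many
    functions. *)
Lemma tangent_expansion X n (x0 : X) : sm_closed X -> Defs.distribution n (@tangent R X) ->
  exists (f : 'I_n -> X -> R) (Z : 'I_n -> X -> tv X),
    [/\ forall j, sm (f j), forall j, vfield (Z j) &
      \forall x \near x0, forall v, tangent x v -> v = \sum_j v (f j) *: Z j x].
Proof.
move=> cX dX; have [V [vV nV]] := dX x0.
have [iV _] := nbhs_singleton nV.
have [f [B [sf sB E]]] := frame_coef cX vV iV.
exists f, (fun j x => \sum_i B j i x *: V i x); split=> // [j|].
  by apply: vfield_sum => // i; exact: vfield_scale.
apply: (nearS _ (nearI nV E)) => x [[_ tE] cE] v; rewrite tE => -[c vE].
under eq_bigr do rewrite scaler_sumr.
rewrite exchange_big /= {1}vE; apply: eq_bigr => i _.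
under eq_bigr do rewrite scalerA.
by rewrite -scaler_suml; congr (_ *: _); rewrite {1}(cE c i) -vE.
Qed.

Definition split_family m n (T : Type) (a : 'I_m -> T) (b : 'I_n -> T) (i : 'I_(m + n)) : T :=
  match fintype.split i with inl j => a j | inr j => b j end.

Lemma direct_sum_frame (V : lmodType R) m n (a : 'I_m -> V) (b : 'I_n -> V) (A B E : set V) :
  lin_indep a -> lin_indep b -> A = lin_span a -> B = lin_span b ->
  direct_sum A B E ->
  lin_indep (split_family a b) /\ E = lin_span (split_family a b).
Proof.
move=> ia ib AE BE [EE AB].
have sumE (c : 'I_(m + n) -> R) : \sum_i c i *: split_family a b i =
    \sum_i c (lshift n i) *: a i + \sum_i c (rshift m i) *: b i.
  rewrite big_split_ord /=; congr (_ + _); apply: eq_bigr => i _; rewrite /split_family.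
    by rewrite (unsplitK (inl i)).
  by rewrite (unsplitK (inr i)).
split.
  move=> c; rewrite sumE => /eqP; rewrite addr_eq0 => /eqP c0.
  have : (A `&` B) (\sum_i c (lshift n i) *: a i).
    split; first by rewrite AE; exists (fun i => c (lshift n i)).
    rewrite c0 BE; exists (fun i => - c (rshift m i)).
    by rewrite -sumrN; apply: eq_bigr => i _; rewrite scaleNr.
  rewrite AB /= => a0; have b0 : \sum_i c (rshift m i) *: b i = 0.
    by apply/eqP; rewrite -oppr_eq0 -c0 a0.
  move=> i; rewrite -(splitK i); case: (fintype.split i) => j /=; first exact: ia a0 j.
  exact: ib b0 j.
rewrite EE; apply/seteqP; split=> v /=.
  rewrite AE BE => -[_ [c ->] [_ [d ->] <-]].
  exists (split_family c d); rewrite sumE; congr (_ + _); apply: eq_bigr => i _;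
  by rewrite /split_family ?(unsplitK (inl i)) ?(unsplitK (inr i)).
move=> [c ->]; rewrite sumE.
exists (\sum_i c (lshift n i) *: a i); first by rewrite AE; exists (fun i => c (lshift n i)).
exists (\sum_i c (rshift m i) *: b i); first by rewrite BE; exists (fun i => c (rshift m i)).
by [].
Qed.

(** Local frames of the whole tangent bundle of [Q] will be obtained in this way from [D] and [W],
    without charts. *)
Lemma distribution_direct_sum X m n (A B E : X -> set (tv X)) :
  Defs.distribution m A -> Defs.distribution n B -> (forall x, direct_sum (A x) (B x) (E x)) ->
  Defs.distribution (m + n) E.
Proof.
move=> dA dB ABE x; have [a [va na]] := dA x; have [b [vb nb]] := dB x.
exists (split_family a b); split=> [i|].
  by rewrite /split_family; case: (fintype.split _).
apply: (nearS _ (nearI na nb)) => y [[ia AE] [ib BE]].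
have <- : split_family (a^~ y) (b^~ y) = fun i => split_family a b i y.
  by apply/funext => i; rewrite /split_family; case: (fintype.split i).
exact: direct_sum_frame ia ib AE BE (ABE y).
Qed.

End frames.

(** * The real line and velocities at the origin *)

Section line.
Context {R : realType}.

(** Vertical vectors will be velocities of curves [t |-> a + t b]; with the parameter line as a
    space, [push] and the slice lemmas for products apply to them. *)
Definition line : fspace R := gen_space [set (@id R)].

Lemma line_sm_closed : sm_closed line.
Proof. exact: gen_sm_closed. Qed.

Lemma sm_line_id : @sm R line id.
Proof. exact: gen_sm. Qed.

Lemma line_derivable (f : line -> R) (t : R) : @sm R line f -> derivable (f : R -> R) t 1.
Proof.
move=> sf; have [n [g [F [sg sF fF]]]] := sf t.
have gE i : g i = id by apply: sg.
have nF : \forall s \near (t : R), F (\row_(i < n) s) = f s.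
  have [m [h [e [e0 sh hF]]]] := (fspace_nbhsP _ _).1 fF.
  have : nbhs t (ball t e) by exact: nbhsx_ballx.
  apply: nearS => s; rewrite -ball_normE /= distrC => st.
  rewrite hF; first by congr F; apply/rowP => i; rewrite !mxE gE.
  by move=> i; rewrite (sh i).
apply: near_eq_derivable nF _.
have [||//] := @is_derive_comp R _ n F (fun _ s => s) t 1 sF.
- by move=> i; exact: cvg_id.
- by move=> i; exact: derivable_id.
Qed.

Definition line_tangent (f : line -> R) : R^o :=
  if `[< @sm R line f >] then 'D_1 (f : R -> R) 0 else 0.

Lemma line_tangentE f : @sm R line f -> line_tangent f = 'D_1 (f : R -> R) 0.
Proof. by move=> sf; rewrite /line_tangent asboolT. Qed.

Lemma line_tangentP : tangent (0 : line) line_tangent.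
Proof.
have cL := line_sm_closed.
split=> [f nf|a f g sf sg|f g sf sg]; first by rewrite /line_tangent asboolF.
- rewrite !line_tangentE //; last by apply: smD => //; apply: smM => //; exact: sm_cst.
  have df := line_derivable (t := 0) sf; have dg := line_derivable (t := 0) sg.
  rewrite -[LHS]/('D_1 (a *: (f : R -> R) + (g : R -> R)) 0) deriveD ?deriveZ //.
  exact: derivableZ.
- rewrite !line_tangentE //; last exact: smM.
  have df := line_derivable (t := 0) sf; have dg := line_derivable (t := 0) sg.
  by rewrite [LHS](deriveM df dg) addrC; congr (_ + _); exact: mulrC.
Qed.

Lemma line_tangent_affine (a b : R) : line_tangent (fun t => a + t * b) = b.
Proof.
have cL := line_sm_closed; have tL := line_tangentP.
have sb : @sm R line (fun t => t * b) by apply: smM => //; [exact: sm_line_id|exact: sm_cst].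
have sa := @sm_cst R line a cL.
rewrite (tangent_funD tL) // (tangent_cst cL tL) add0r (tangent_funZr cL tL); last exact: sm_line_id.
by rewrite line_tangentE ?derive_id ?mul1r //; exact: sm_line_id.
Qed.

Lemma line_tangent_quadratic (a b c : R) :
  line_tangent (fun t => a + t * b + t * t * c) = b.
Proof.
have cL := line_sm_closed; have tL := line_tangentP.
have sid := sm_line_id.
have sb : @sm R line (fun t => a + t * b).
  by apply: smD => //; [exact: sm_cst|apply: smM => //; exact: sm_cst].
have stt : @sm R line (fun t => t * t) by exact: smM.
rewrite (tangent_funD tL) //; last by apply: smM => //; exact: sm_cst.
rewrite line_tangent_affine (tangent_funZr cL tL) // (tangentM tL) //.
by rewrite mulr0 mul0r addr0 mul0r addr0.
Qed.

End line.

(** * The cotangent bundle *)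

Section cotangent_bundle.
Context {R : realType} {X : fspace R} {n : nat}.
Hypotheses (cX : sm_closed X) (dX : Defs.distribution n (@tangent R X)).
Local Notation tv X := ((pt X -> R) -> R^o).
Local Notation T := (cotangent X).

Lemma cotangent_sm_closed : sm_closed T.
Proof. exact: gen_sm_closed. Qed.

Lemma smooth_base : smooth_map (X := T) (@base R X).
Proof. by move=> f sf; apply: gen_sm; left; exists f. Qed.

Lemma sm_fiberwise (V : X -> tv X) : vfield V -> @sm R T (fiberwise V).
Proof. by move=> vV; apply: gen_sm; right; exists V. Qed.

Lemma smooth_map_cotangent (Y : fspace R) (phi : Y -> T) : sm_closed Y ->
  smooth_map (fun y => base (phi y)) ->
  (forall V, vfield V -> sm (fun y => fiberwise V (phi y))) -> smooth_map phi.
Proof.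
move=> cY sb sf; apply: smooth_map_gen => // f [] [g sg <-]; [exact: sb|exact: sf].
Qed.

Lemma cov_lin (a : covec X) c v w : tangent (base a) v -> tangent (base a) w ->
  cov a (c *: v + w) = c * cov a v + cov a w.
Proof. by have [_] := covP a; apply. Qed.

Lemma cov0 (a : covec X) : cov a 0 = 0.
Proof.
have t0 := @tangent0 R X (base a).
have := cov_lin (-1) t0 t0; rewrite scaler0 addr0 mulN1r => /eqP.
by rewrite addNr => /eqP.
Qed.

Lemma covZ (a : covec X) c v : tangent (base a) v -> cov a (c *: v) = c * cov a v.
Proof.
by move=> tv; rewrite -[c *: v]addr0 cov_lin ?cov0 ?addr0 //; exact: tangent0.
Qed.

Lemma covD (a : covec X) v w : tangent (base a) v -> tangent (base a) w ->
  cov a (v + w) = cov a v + cov a w.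
Proof. by move=> tv tw; rewrite -[v in LHS]scale1r cov_lin // mul1r. Qed.

Lemma covN (a : covec X) v : tangent (base a) v -> cov a (- v) = - cov a v.
Proof. by move=> tv; rewrite -scaleN1r covZ // mulN1r. Qed.

Lemma cov_sum (a : covec X) (I : Type) (r : seq I) (v : I -> tv X) :
  (forall i, tangent (base a) (v i)) ->
  cov a (\sum_(i <- r) v i) = \sum_(i <- r) cov a (v i).
Proof.
move=> tv; elim: r => [|i r IH]; first by rewrite !big_nil cov0.
by rewrite !big_cons covD ?IH //; exact: tangent_sum.
Qed.

Lemma covec_eq (a b : covec X) : base a = base b ->
  (forall v, tangent (base a) v -> cov a v = cov b v) -> a = b.
Proof.
case: a b => [q a Pa] [q' b Pb] /= qq'; rewrite -qq' in b Pb * => {q' qq'} ab.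
have e : a = b.
  apply/funext => v; have [tv|nt] := pselect (tangent q v); first exact: ab.
  by have [-> //] := Pa; have [-> //] := Pb.
by rewrite e in Pa ab *; congr Covec; exact: Prop_irrelevance.
Qed.

Definition lin_form (q : X) (a : tv X -> R) : Prop :=
  forall c v w, tangent q v -> tangent q w -> a (c *: v + w) = c * a v + a w.

Lemma mk_covecP (q : X) (a : tv X -> R) : lin_form q a ->
  covector q (fun v => if `[< tangent q v >] then a v else 0).
Proof.
move=> la; split=> [v nt|c v w tv tw]; first by rewrite asboolF.
by rewrite !asboolT ?la //; exact: tangent_lin.
Qed.

Definition mk_covec q a (la : lin_form q a) : covec X := Covec (mk_covecP la).

Lemma cov_mk q a (la : lin_form q a) v : tangent q v -> cov (mk_covec la) v = a v.
Proof. by move=> tv; rewrite /= asboolT. Qed.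

Section translation.
Variable b : T -> tv X -> R.
Hypothesis lb : forall a : T, lin_form (base a) (b a).

Lemma translate_lin (t : R) (a : T) : lin_form (base a) (fun v => cov a v + t * b a v).
Proof. by move=> c v w tv tw; rewrite cov_lin // lb //; ring. Qed.

Definition translate (t : line) (a : T) : T := mk_covec (@translate_lin t a).

Lemma cov_translate t a v : tangent (base a) v ->
  cov (translate t a) v = cov a v + t * b a v.
Proof. by move=> tv; rewrite cov_mk. Qed.

Hypothesis sb : forall V, vfield V -> @sm R T (fun a => b a (V (base a))).

Lemma smooth_translate :
  smooth_map (X := prod_space line T) (Y := T) (fun p => translate p.1 p.2).
Proof.
have cP := @prod_sm_closed R line T.
apply: smooth_map_cotangent => //.
  exact: (smooth_map_comp smooth_base (@smooth_snd R line T)).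
move=> V vV; have [tV _] := vV.
have -> : (fun p : line * T => fiberwise V (translate p.1 p.2)) =
    fun p => fiberwise V p.2 + p.1 * b p.2 (V (base p.2)).
  by apply/funext => -[t a]; rewrite /fiberwise cov_translate //=.
apply: smD => //; first exact: (@smooth_snd R line T _ (sm_fiberwise vV)).
apply: smM => //; first exact: (@smooth_fst R line T _ sm_line_id).
exact: (@smooth_snd R line T _ (sb vV)).
Qed.

(** The vertical lift of the fibrewise form [b]. The form may depend on the covector and not only on
    its base point, as the correction term of a cotangent lift does. *)
Definition vertical (a : T) : tv T :=
  push (X := line) (Y := T) (fun t => translate t a) line_tangent.

Lemma smooth_translatel (a : T) : smooth_map (X := line) (Y := T) (fun t => translate t a).
Proof.
have cL := @line_sm_closed R.
move=> f /smooth_translate.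
exact: (@smooth_pair R line T line id (fun=> a) cL (@smooth_map_id R line) (smooth_map_cst _ cL)).
Qed.

Lemma translate0 (a : T) : translate 0 a = a.
Proof.
apply: covec_eq => // v tv; rewrite cov_translate //=; by rewrite mul0r addr0.
Qed.

Lemma vertical_tangent a : tangent a (vertical a).
Proof.
rewrite -{1}[a]translate0.
apply: (push_tangent cotangent_sm_closed (smooth_translatel a)).
exact: line_tangentP.
Qed.

Lemma vertical_vfield : vfield vertical.
Proof.
split=> [a|f sf]; first exact: vertical_tangent.
have cP := @prod_sm_closed R line T.
have -> : (fun a => vertical a f) = (fun a => line_tangent (fun t => f (translate t a))).
  by apply/funext => a; rewrite /vertical pushE.
apply: (@sm_slice_tangent R line T (fun p => f (translate p.1 p.2)) 0) => //.
- exact: line_sm_closed.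
- exact: cotangent_sm_closed.
- exact: smooth_translate.
- exact: line_tangentP.
Qed.

Lemma vertical_base a (f : X -> R) : sm f -> vertical a (fun a' => f (base a')) = 0.
Proof.
move=> sf; rewrite /vertical pushE; last exact: smooth_base.
exact: (tangent_cst (@line_sm_closed R) line_tangentP (f (base a))).
Qed.

Lemma vertical_fiberwise a V : vfield V ->
  vertical a (fiberwise V) = b a (V (base a)).
Proof.
move=> vV; rewrite /vertical pushE; last exact: sm_fiberwise.
rewrite -[RHS](line_tangent_affine (cov a (V (base a)))); congr line_tangent.
apply/funext => t; rewrite -[LHS]/(cov (translate t a) (V (base a))) cov_translate //.
by have [tV _] := vV; exact: tV.
Qed.

End translation.

(** Pairings become finite sums of products in which the momenta [fiberwise (Z j)] are generating
    functions of the cotangent bundle. *)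
Lemma cov_expansion (x0 : X) : exists (f : 'I_n -> X -> R) (Z : 'I_n -> X -> tv X),
  [/\ forall j, sm (f j), forall j, vfield (Z j) &
    \forall x \near x0, (forall v, tangent x v -> v = \sum_j v (f j) *: Z j x) /\
      forall (a : covec X) v, base a = x -> tangent x v ->
        cov a v = \sum_j v (f j) * fiberwise (Z j) a].
Proof.
have [f [Z [sf vZ nZ]]] := tangent_expansion x0 cX dX.
exists f, Z; split=> //; apply: nearS nZ => x E; split=> // a v bx tv.
have tZ j : tangent x (Z j x) by have [tZ _] := vZ j.
rewrite {1}(E v tv) cov_sum; last by move=> j; apply: tangentZ; rewrite bx.
by apply: eq_bigr => j _; rewrite covZ ?bx // /fiberwise bx.
Qed.

End cotangent_bundle.

(** * The group action *)

Section action.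
Context {R : realType} {N : nonholonomic_system R} (S : symmetry N) {n : nat}.
Local Notation Q := (Q N).
Local Notation G := (G S).
Local Notation LG := (lspace (Defs.G S)).
Local Notation T := (cotangent (Defs.Q N)).
Local Notation tvG := ((pt LG -> R) -> R^o).
Local Notation tvT := ((pt T -> R) -> R^o).
Implicit Types (g : G) (q : Q).

Lemma Q_sm_closed : sm_closed Q.
Proof. exact: manifold_sm_closed (Q_manifold N). Qed.

Lemma G_sm_closed : sm_closed LG.
Proof. exact: manifold_sm_closed (lmanifold G). Qed.

Let cQ := Q_sm_closed.
Let cG := G_sm_closed.

Lemma smooth_act g : smooth_map (X := Q) (Y := Q) (@act R N S g).
Proof.
move=> f /(@act_smooth R N S).
exact: (@smooth_pair R LG Q Q (fun=> g) id cQ (smooth_map_cst _ cQ) (@smooth_map_id R Q)).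
Qed.

Lemma smooth_orbit q : smooth_map (X := LG) (Y := Q) (fun g => act g q).
Proof.
move=> f /(@act_smooth R N S).
exact: (@smooth_pair R LG Q LG id (fun=> q) cG (@smooth_map_id R LG) (smooth_map_cst _ cG)).
Qed.

Lemma actVK g q : act g^-1%g (act g q) = q.
Proof. by rewrite -actM mulVg act1. Qed.

Lemma actKV g q : act g (act g^-1%g q) = q.
Proof. by rewrite -actM mulgV act1. Qed.

Lemma push_act_tangent g q v : tangent q v -> tangent (act g q) (push (@act R N S g) v).
Proof. by move=> tv; apply: push_tangent => //; exact: smooth_act. Qed.

Lemma push_actVK g q v : tangent q v ->
  push (@act R N S g^-1%g) (push (@act R N S g) v) = v.
Proof.
move=> tv; rewrite push_comp; last exact: smooth_act.
have -> : @act R N S g^-1%g \o @act R N S g = id by apply/funext => q'; exact: actVK.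
exact: push_id tv.
Qed.

Lemma push_actKV g q v : tangent q v ->
  push (@act R N S g) (push (@act R N S g^-1%g) v) = v.
Proof.
move=> tv; rewrite push_comp; last exact: smooth_act.
have -> : @act R N S g \o @act R N S g^-1%g = id by apply/funext => q'; exact: actKV.
exact: push_id tv.
Qed.

Lemma push_actV_tangent g q v : tangent (act g q) v ->
  tangent q (push (@act R N S g^-1%g) v).
Proof. by move=> /(push_act_tangent g^-1%g); rewrite actVK. Qed.

Lemma Tact_lin g (a : T) :
  lin_form (act g (base a)) (fun v => cov a (push (@act R N S g^-1%g) v)).
Proof.
move=> c v w tv tw; rewrite push_lin cov_lin //; exact: push_actV_tangent.
Qed.

(** The lifted action by a formula on all of [T*Q]; [cotangent_act], which is defined by choice on
    [M], turns out to be its restriction. *)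
Definition Tact g (a : T) : T := mk_covec (@Tact_lin g a).

Lemma cov_Tact g (a : T) v : tangent (act g (base a)) v ->
  cov (Tact g a) v = cov a (push (@act R N S g^-1%g) v).
Proof. by move=> tv; rewrite cov_mk. Qed.

Lemma cov_Tact_push g (a : T) v : tangent (base a) v ->
  cov (Tact g a) (push (@act R N S g) v) = cov a v.
Proof.
move=> tv; rewrite cov_Tact; last exact: push_act_tangent.
by rewrite (push_actVK g tv).
Qed.

Lemma Tact1 (a : T) : Tact 1%g a = a.
Proof.
have b1 : base (Tact 1%g a) = base a by rewrite /= act1.
apply: covec_eq => // v; rewrite b1 => tv.
rewrite cov_Tact ?act1 // invg1.
have -> : @act R N S 1%g = id by apply/funext => q; exact: act1.
by rewrite (push_id tv).
Qed.

Hypothesis dQ : Defs.distribution n (@tangent R Q).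

(** The moved covector evaluated on [V] involves the derivative along [V] of [f j] translated by the
    inverse of [g], which is a slice of a smooth function on the product of [Q] and the group. *)
Lemma smooth_Tact :
  smooth_map (X := prod_space LG T) (Y := T) (fun p => Tact p.1 p.2).
Proof.
have cP := @prod_sm_closed R LG T.
have s1 := @smooth_fst R LG T; have s2 := @smooth_snd R LG T.
have sb : smooth_map (X := prod_space LG T) (Y := Q) (fun p => base p.2).
  exact: smooth_map_comp (@smooth_base R Q) s2.
have sab : smooth_map (X := prod_space LG T) (Y := Q) (fun p => act p.1 (base p.2)).
  move=> f /(@act_smooth R N S); exact: (smooth_pair cP s1 sb).
apply: smooth_map_cotangent => // V vV.
have [tV sV] := vV.
apply: sm_local => // -[g0 a0].
have [f [Z [sf vZ nZ]]] := cov_expansion cQ dQ (base a0).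
exists (fun p => \sum_j V (act p.1 (base p.2)) (fun q => f j (act p.1^-1%g q)) *
    fiberwise (Z j) p.2).
  apply: sm_sum => // j; apply: smM => //; last first.
    exact: s2 (sm_fiberwise (vZ j)).
  pose h (p : Q * LG) := f j (act p.2^-1%g p.1).
  have sh : @sm R (prod_space Q LG) h.
    have cQG := @prod_sm_closed R Q LG.
    have sv : smooth_map (X := prod_space Q LG) (Y := LG) (fun p => p.2^-1%g).
      exact: smooth_map_comp (@linv_smooth R G) (@smooth_snd R Q LG).
    have := @act_smooth R N S _ (sf j).
    exact: (smooth_pair cQG sv (@smooth_fst R Q LG)).
  have := sm_vfield_slice cQ cG sh vV.
  exact: (smooth_pair cP sab s1).
have nZ' : \forall p \near ((g0, a0) : prod_space LG T),
    (forall v, tangent (base p.2) v -> v = \sum_j v (f j) *: Z j (base p.2)) /\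
      forall (a : covec Q) v, base a = base p.2 -> tangent (base p.2) v ->
        cov a v = \sum_j v (f j) * fiberwise (Z j) a.
  exact: (smooth_map_continuous sb (x := (g0, a0)) nZ).
apply: nearS nZ' => -[g a] /= [_ /(_ a _ erefl)] E.
have tVg := tV (act g (base a)).
rewrite -[LHS]/(cov (Tact g a) (V (act g (base a)))) cov_Tact //.
rewrite E; last exact: push_actV_tangent.
by apply: eq_bigr => j _; rewrite pushE.
Qed.

Lemma smooth_Tactl (a : T) : smooth_map (X := LG) (Y := T) (fun g => Tact g a).
Proof.
move=> f /smooth_Tact.
exact: (@smooth_pair R LG T LG id (fun=> a) cG (@smooth_map_id R LG) (smooth_map_cst _ cG)).
Qed.

Definition genT (eta : tvG) (a : T) : tvT :=
  push (X := LG) (Y := T) (fun g => Tact g a) eta.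

Lemma genT_tangent eta a : lie_algebra eta -> tangent a (genT eta a).
Proof.
move=> le; rewrite -{1}[a]Tact1.
exact: (push_tangent (@gen_sm_closed R _ _) (smooth_Tactl a) le).
Qed.

Lemma genQ_tangent (eta : tvG) q : lie_algebra eta -> tangent q (genQ eta q).
Proof.
move=> le; rewrite -{1}[q](@act1 R N S).
exact: (push_tangent cQ (smooth_orbit q) le).
Qed.

Lemma genT_base eta a : push (X := T) (Y := Q) (@base R Q) (genT eta a) = genQ eta (base a).
Proof. by rewrite /genT push_comp //; exact: smooth_base. Qed.

Lemma genQ_lin c (eta zeta : tvG) q : genQ (c *: eta + zeta) q = c *: genQ eta q + genQ zeta q.
Proof. exact: push_lin. Qed.

Lemma sm_act_fun f : @sm R Q f -> @sm R (prod_space LG Q) (fun p => f (act p.1 p.2)).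
Proof. exact: (@act_smooth R N S). Qed.

Lemma sm_Tact_fun f : @sm R T f -> @sm R (prod_space LG T) (fun p => f (Tact p.1 p.2)).
Proof. exact: smooth_Tact. Qed.

Lemma gen_secQ_vfield (xi : Q -> tvG) : smooth_section xi -> vfield (gen_secQ xi).
Proof.
move=> [lx sx]; split=> [q|f sf]; first exact: genQ_tangent.
have -> : (fun q => gen_secQ xi q f : R) = fun q => xi q (fun g => f (act g q)).
  by apply/funext => q; rewrite /gen_secQ /genQ pushE.
exact: (@sm_section_slice R LG Q (fun p => f (act p.1 p.2)) 1%g xi cG cQ (sm_act_fun sf)).
Qed.

Definition gen_secT (xi : Q -> tvG) (a : T) : tvT := genT (xi (base a)) a.

Lemma gen_secT_vfield (xi : Q -> tvG) : smooth_section xi -> vfield (gen_secT xi).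
Proof.
move=> [lx sx]; split=> [a|f sf]; first exact: genT_tangent.
have -> : (fun a => gen_secT xi a f : R) = fun a => xi (base a) (fun g => f (Tact g a)).
  by apply/funext => a; rewrite /gen_secT /genT pushE.
apply: (@sm_section_slice R LG T (fun p => f (Tact p.1 p.2)) 1%g (fun a => xi (base a)) cG
  (@gen_sm_closed R _ _) (sm_Tact_fun sf)) => [a|h sh]; first exact: lx.
exact: smooth_base (sx h sh).
Qed.

Lemma genQ_vfield (eta : tvG) : lie_algebra eta -> vfield (genQ eta).
Proof.
move=> le; apply: (@gen_secQ_vfield (fun=> eta)); split=> // f sf; exact: sm_cst.
Qed.

Lemma left_invariant_vfield (eta : tvG) : lie_algebra eta -> vfield (left_invariant eta).
Proof.
move=> le.
have sl (g : LG) : smooth_map (X := LG) (Y := LG) (fun h => (g * h)%g).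
  move=> f /(@lmul_smooth R G).
  exact: (@smooth_pair R LG LG LG (fun=> g) id cG (smooth_map_cst _ cG) (@smooth_map_id R LG)).
split=> [g|f sf].
  rewrite -{1}[g]mulg1.
  exact: (push_tangent cG (sl g) le).
have -> : (fun g => left_invariant eta g f : R) = fun g => eta (fun h => f (g * h)%g).
  by apply/funext => g; rewrite /left_invariant pushE.
apply: (@sm_slice_tangent R LG LG (fun p => f (p.2 * p.1)%g) 1%g eta) => //.
have := @lmul_smooth R G _ sf.
exact: (smooth_pair (@prod_sm_closed R LG LG) (@smooth_snd R LG LG) (@smooth_fst R LG LG)).
Qed.

(* Freeness of the action is infinitesimal freeness: the orbit map is injective
   and equivariant, so it cannot kill a left-invariant vector field. *)
Lemma genQ_inj (eta : tvG) q : lie_algebra eta -> genQ eta q = 0 -> eta = 0.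
Proof.
move=> le eta0.
have vL := left_invariant_vfield le.
have inj : injective (fun g : LG => act g q).
  move=> g h /(congr1 (act h^-1%g)) /=; rewrite -!actM mulVg act1.
  by move=> /(@act_free R N S) /(congr1 (fun x => h * x)%g); rewrite mulgA mulgV mul1g mulg1.
have sl (g : LG) : smooth_map (X := LG) (Y := LG) (fun h => (g * h)%g).
  move=> f /(@lmul_smooth R G).
  exact: (@smooth_pair R LG LG LG (fun=> g) id cG (smooth_map_cst _ cG) (@smooth_map_id R LG)).
have := @injective_immersion R LG Q _ _ (fun g => act g q) (left_invariant eta)
  (lmanifold G) (Q_manifold N) (smooth_orbit q) inj vL.
have H (g : LG) : push (X := LG) (Y := Q) (fun g => act g q) (left_invariant eta g) = 0.
  rewrite /left_invariant push_comp; last exact: smooth_orbit.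
  have -> : (fun g => act g q) \o (fun h : LG => (g * h)%g) = @act R N S g \o (fun h => act h q).
    by apply/funext => h; rewrite /= actM.
  rewrite -push_comp; last exact: smooth_act.
  by rewrite -/(genQ eta q) eta0 push0.
move=> /(_ H 1%g) <-; rewrite /left_invariant.
have -> : (fun h : LG => (1 * h)%g) = id by apply/funext => h; rewrite mul1g.
by rewrite (push_id le).
Qed.

End action.

(** * The metric and the constraint submanifold *)

Section mechanics.
Context {R : realType} {N : nonholonomic_system R} {n : nat}.
Local Notation Q := (Q N).
Local Notation T := (cotangent (Defs.Q N)).
Local Notation M := (Defs.M N).
Local Notation tvQ := ((pt Q -> R) -> R^o).
Local Notation tvM := ((pt M -> R) -> R^o).
Local Notation kappa := (@metric R N).
Implicit Types (q : Q) (u v w : tvQ).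

Let rm := metric_riemannian N.

Lemma metric_linl q c u v w : tangent q u -> tangent q v -> tangent q w ->
  kappa q (c *: u + v) w = c * kappa q u w + kappa q v w.
Proof. exact: riem_linear rm q c u v w. Qed.

Lemma kinetic_sym q v w : tangent q v -> tangent q w -> kappa q v w = kappa q w v.
Proof. exact: riem_sym rm q v w. Qed.

Lemma metric_form q v : tangent q v -> lin_form q (kappa q v).
Proof.
move=> tv c u w tu tw; rewrite kinetic_sym ?metric_linl //; last exact: tangent_lin.
by rewrite (kinetic_sym tu tv) (kinetic_sym tw tv).
Qed.

Lemma metric_definite q v : tangent q v -> kappa q v v = 0 -> v = 0.
Proof.
move=> tv v0; apply: contrapT => vn0; have := riem_pos rm tv vn0.
by rewrite v0 ltxx.
Qed.

Lemma metricZl q c v w : tangent q v -> tangent q w -> kappa q (c *: v) w = c * kappa q v w.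
Proof.
move=> tv tw; have t0 := tangent0 q.
have k0 : kappa q 0 w = 0.
  have := metric_linl (-1) t0 t0 tw; rewrite scaler0 addr0 mulN1r => /eqP.
  by rewrite addNr => /eqP.
by rewrite -[c *: v]addr0 metric_linl // k0 addr0.
Qed.

Lemma metricDl q u v w : tangent q u -> tangent q v -> tangent q w ->
  kappa q (u + v) w = kappa q u w + kappa q v w.
Proof. by move=> tu tv tw; rewrite -[u in LHS]scale1r metric_linl // mul1r. Qed.

Lemma metric_suml q (I : Type) (r : seq I) (a : I -> R) (V : I -> tvQ) w :
  (forall i, tangent q (V i)) -> tangent q w ->
  kappa q (\sum_(i <- r) a i *: V i) w = \sum_(i <- r) a i * kappa q (V i) w.
Proof.
move=> tV tw; elim: r => [|i r IH].
  rewrite !big_nil -[0 in LHS](scale0r (0 : tvQ)) metricZl ?mul0r //; exact: tangent0.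
rewrite !big_cons metric_linl ?IH //.
by apply: tangent_sum => j; exact: tangentZ.
Qed.

Lemma metric_sumr q (I : Type) (r : seq I) (a : I -> R) (V : I -> tvQ) w :
  (forall i, tangent q (V i)) -> tangent q w ->
  kappa q w (\sum_(i <- r) a i *: V i) = \sum_(i <- r) a i * kappa q w (V i).
Proof.
move=> tV tw; rewrite kinetic_sym //; last by apply: tangent_sum => i; exact: tangentZ.
by rewrite metric_suml //; apply: eq_bigr => i _; rewrite kinetic_sym.
Qed.

Lemma is_flat_unique (a : T) v w : is_flat a v -> is_flat a w -> v = w.
Proof.
move=> [tv av] [tw aw]; apply/eqP; rewrite -subr_eq0; apply/eqP.
have tvw : tangent (base a) (v - w) by exact: tangentB.
apply: (metric_definite tvw).
have tNw : tangent (base a) (- w) by exact: tangentN.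
move: tvw; move: {1 3}(v - w) => d td.
have -> : v - w = (-1) *: w + v by rewrite scaleN1r addrC.
by rewrite metric_linl // -av // -aw // mulN1r addNr.
Qed.

Definition sharp (a : T) : tvQ := xget 0 [set v | is_flat a v].

Lemma sharpE (a : T) v : is_flat a v -> sharp a = v.
Proof.
move=> av; apply: (is_flat_unique _ av).
by apply: (@xgetPex _ 0 [set v | is_flat a v]); exists v.
Qed.

Lemma hamiltonianE (a : T) v : is_flat a v ->
  hamiltonian a = kappa (base a) v v / 2 + potential (base a).
Proof.
move=> av; rewrite /hamiltonian -/(sharp a) (sharpE av) /lagrangian.
by have [tv ->] := av => //; lra.
Qed.

Hypothesis dQ : Defs.distribution n (@tangent R Q).

(** The Gram matrix of a local frame is invertible: a combination given by its kernel is orthogonal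
    to the frame, hence to itself. *)
Lemma riesz (a : T) : exists v, is_flat a v.
Proof.
have [V [vV nV]] := dQ (base a); have [iV tE] := nbhs_singleton nV.
set q := base a in iV tE *.
have tV i : tangent q (V i q) by have [tV _] := vV i.
pose A : 'M[R]_n := \matrix_(i, j) kappa q (V i q) (V j q).
have uA : A \in unitmx.
  rewrite -row_free_unit -kermx_eq0; apply/eqP/row_matrixP => i; rewrite row0.
  set c := row i _.
  have cA : c *m A = 0 by rewrite /c -row_mul mulmx_ker row0.
  pose v := \sum_j c ord0 j *: V j q.
  have tv : tangent q v by apply: tangent_sum => j; exact: tangentZ.
  have vV0 j : kappa q v (V j q) = 0.
    have cAj : (c *m A) ord0 j = 0 by rewrite cA mxE.
    rewrite metric_suml // -[RHS]cAj [RHS]mxE.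
    by apply: eq_bigr => l _; rewrite [A _ _]mxE.
  have v0 : v = 0.
    apply: (metric_definite tv); rewrite {2}/v metric_sumr //.
    by apply: big1 => j _; rewrite vV0 mulr0.
  by apply/rowP => j; rewrite [RHS]mxE; apply: (iV (fun j => c ord0 j)).
pose b : 'rV[R]_n := \row_j cov a (V j q).
pose c := b *m invmx A.
pose v := \sum_j c ord0 j *: V j q.
have tv : tangent q v by apply: tangent_sum => j; exact: tangentZ.
have vE j : kappa q v (V j q) = cov a (V j q).
  rewrite metric_suml //.
  have -> : cov a (V j q) = (c *m A) ord0 j by rewrite mulmxKV // mxE.
  by rewrite [RHS]mxE; apply: eq_bigr => l _; rewrite [A _ _]mxE.
exists v; split=> // w; rewrite tE => -[d ->].
rewrite cov_sum; last by move=> i; apply: tangentZ; exact: tV.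
rewrite metric_sumr //; apply: eq_bigr => j _.
by rewrite covZ ?vE //; exact: tV.
Qed.

Lemma sharp_flat (a : T) : is_flat a (sharp a).
Proof. by have [v av] := riesz a; rewrite (sharpE av). Qed.

Lemma D_tangent q v : D q v -> tangent q v.
Proof.
have [V [vV nV]] := D_distribution (n := N) q; have [_ ->] := nbhs_singleton nV.
move=> [c ->]; apply: tangent_sum => i; apply: tangentZ.
by have [tV _] := vV i; exact: tV.
Qed.

Lemma D_lin q c v w : D q v -> D q w -> D q (c *: v + w).
Proof.
have [V [vV nV]] := D_distribution (n := N) q; have [_ ->] := nbhs_singleton nV.
move=> [a ->] [b ->]; exists (fun i => c * a i + b i).
rewrite scaler_sumr -big_split; apply: eq_bigr => i _ /=.
by rewrite scalerDl scalerA.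
Qed.

Lemma D_sum q (I : Type) (r : seq I) (V : I -> tvQ) : D q 0 ->
  (forall i, D q (V i)) -> D q (\sum_(i <- r) V i).
Proof.
move=> D0 DV; elim/big_ind: _ => // v w Dv Dw.
by rewrite -[v]scale1r; exact: D_lin.
Qed.

Lemma D0 q : D q 0.
Proof.
have [V [vV nV]] := D_distribution (n := N) q; have [_ ->] := nbhs_singleton nV.
by exists (fun=> 0); rewrite big1 // => i _; rewrite scale0r.
Qed.

Lemma M_sm_closed : sm_closed M.
Proof. exact: gen_sm_closed. Qed.

Lemma smooth_incl : smooth_map (X := M) (Y := T) (@Defs.incl R N).
Proof. by move=> f sf; apply: gen_sm; exists f. Qed.

Lemma smooth_tauM : smooth_map (X := M) (Y := Q) (@tauM R N).
Proof. exact: smooth_map_comp (@smooth_base R Q) smooth_incl. Qed.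

Lemma smooth_map_M (Y : fspace R) (phi : Y -> M) : sm_closed Y ->
  smooth_map (X := Y) (Y := T) (fun y => Defs.incl (phi y)) -> smooth_map phi.
Proof. by move=> cY sphi; apply: smooth_map_gen => // f [g sg <-]; exact: sphi. Qed.

Lemma M_eq (m m' : M) : Defs.incl m = Defs.incl m' -> m = m'.
Proof. by case: m m' => [a Pa] [b Pb] /= ab; exact: eq_exist. Qed.

Lemma sharp_D (m : M) : D (tauM m) (sharp (Defs.incl m)).
Proof. by case: m => a /= [v Dv av]; rewrite (sharpE av). Qed.

Lemma flat_in_M q v : D q v -> exists m : M, tauM m = q /\ is_flat (Defs.incl m) v.
Proof.
move=> Dv; have tv := D_tangent Dv.
pose a : T := mk_covec (metric_form tv).
have av : is_flat a v by split=> // w tw; rewrite cov_mk.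
have Ma : exists2 v, D (base a) v & is_flat a v by exists v.
by exists (exist _ a Ma).
Qed.

Lemma thetaM_E (m : M) (v : tvM) : thetaM m v = cov (Defs.incl m) (push (Y := Q) (@tauM R N) v).
Proof.
rewrite /thetaM /pullback /thetaQ push_comp //; exact: smooth_base.
Qed.

End mechanics.

(** * Invariance of the mechanical data and the lifted action on M *)

Section symmetric_mechanics.
Context {R : realType} {N : nonholonomic_system R} (S : symmetry N) {n : nat}.
Local Notation Q := (Defs.Q N).
Local Notation G := (Defs.G S).
Local Notation LG := (lspace (Defs.G S)).
Local Notation T := (cotangent (Defs.Q N)).
Local Notation M := (Defs.M N).
Local Notation tvQ := ((pt Q -> R) -> R^o).
Local Notation tvG := ((pt LG -> R) -> R^o).
Local Notation kappa := (@metric R N).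
Implicit Types (g : G) (q : Q).

Let cG := @G_sm_closed R N S.
Let cM := @M_sm_closed R N.

Lemma potential_act g q : potential (act g q) = potential q.
Proof.
have k0 q' : kappa q' 0 0 = 0.
  by rewrite -{1}(scale0r (0 : tvQ)) metricZl ?mul0r //; exact: tangent0.
have := act_lagrangian g (tangent0 q); rewrite /lagrangian push0 !k0 !mul0r !sub0r.
by move=> /oppr_inj.
Qed.

(** Invariance of the Lagrangian at the zero vector is that of the potential; what remains is
    invariance of the quadratic form, and polarisation gives the bilinear one. *)
Lemma metric_act g q v w : tangent q v -> tangent q w ->
  kappa (act g q) (push (@act R N S g) v) (push (@act R N S g) w) = kappa q v w.
Proof.
have norm u : tangent q u ->
    kappa (act g q) (push (@act R N S g) u) (push (@act R N S g) u) = kappa q u u.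
  move=> tu; have := act_lagrangian g tu; rewrite /lagrangian potential_act.
  by move=> e; lra.
move=> tv tw; have tvw := tangentD tv tw.
have := norm _ tvw; rewrite pushD.
have pv := push_act_tangent g tv; have pw := push_act_tangent g tw.
rewrite metricDl //; last exact: tangentD.
rewrite [in RHS]metricDl // ![kappa _ _ (_ + _)]kinetic_sym //; try exact: tangentD.
rewrite !metricDl // !norm // [kappa _ w v]kinetic_sym //.
rewrite [kappa _ (push (@act R N S g) w) (push (@act R N S g) v)]kinetic_sym //.
by move=> e; lra.
Qed.

Lemma is_flat_Tact g (a : T) v : is_flat a v ->
  is_flat (Tact g a) (push (@act R N S g) v).
Proof.
move=> [tv av]; split; first exact: push_act_tangent.
move=> w tw; rewrite cov_Tact // av; last exact: push_actV_tangent.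
by rewrite -(metric_act g) ?(push_actKV _ tw) //; exact: push_actV_tangent.
Qed.

Hypothesis dQ : Defs.distribution n (@tangent R Q).

Lemma hamiltonian_Tact g (a : T) : hamiltonian (Tact g a) = hamiltonian a.
Proof.
have [v av] := riesz dQ a; have [tv _] := av.
by rewrite (hamiltonianE av) (hamiltonianE (is_flat_Tact g av)) metric_act // potential_act.
Qed.

(** Every tangent vector at the moved point is a push-forward by [g], so the condition in
    [cotangent_act] determines the covector; invariance of the metric and of [D] shows that it
    exists in [M]. *)
Lemma incl_cotangent_act g (m : M) : Defs.incl (@cotangent_act R N S g m) = Tact g (Defs.incl m).
Proof.
have Ma : exists2 v, D (base (Tact g (Defs.incl m))) v & is_flat (Tact g (Defs.incl m)) v.
  exists (push (@act R N S g) (sharp (Defs.incl m))); first exact: act_D (sharp_D m).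
  exact: is_flat_Tact (sharp_flat dQ _).
pose P := [set m' : M | tauM m' = act g (tauM m) /\
    forall v, tangent (tauM m) v ->
      cov (Defs.incl m') (push (@act R N S g) v) = cov (Defs.incl m) v].
have [|t c] := @xgetPex _ m P.
  pose m1 : M := exist _ (Tact g (Defs.incl m)) Ma.
  by exists m1; split=> // v tv; exact: cov_Tact_push.
apply: covec_eq => // v; rewrite -/(tauM _) t => tv.
have tv' : tangent (tauM m) (push (@act R N S g^-1%g) v) by exact: push_actV_tangent.
have := c _ tv'; rewrite (push_actKV _ tv) => ->.
by rewrite cov_Tact.
Qed.

Lemma tauM_cotangent_act g (m : M) : tauM (@cotangent_act R N S g m) = act g (tauM m).
Proof. by rewrite /tauM incl_cotangent_act. Qed.

Lemma smooth_cotangent_act :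
  smooth_map (X := prod_space LG M) (Y := M) (fun p => @cotangent_act R N S p.1 p.2).
Proof.
have cP := @prod_sm_closed R LG M.
apply: smooth_map_M => // f sf.
have -> : f \o (fun p => Defs.incl (@cotangent_act R N S p.1 p.2)) = fun p => f (Tact p.1 (Defs.incl p.2)).
  by apply/funext => p /=; rewrite incl_cotangent_act.
have sp := @smooth_pair R LG T (prod_space LG M) fst (fun p => Defs.incl p.2) cP
  (@smooth_fst R LG M) (smooth_map_comp (@smooth_incl R N) (@smooth_snd R LG M)).
exact: (sp _ (smooth_Tact dQ sf)).
Qed.

Lemma smooth_cotangent_actl (m : M) :
  smooth_map (X := LG) (Y := M) (fun g => @cotangent_act R N S g m).
Proof.
move=> f /smooth_cotangent_act.
exact: (@smooth_pair R LG M LG id (fun=> m) cG (@smooth_map_id R LG) (smooth_map_cst _ cG)).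
Qed.

Lemma genM_tangent (eta : tvG) (m : M) : lie_algebra eta -> tangent m (genM S eta m).
Proof.
move=> le; have e : @cotangent_act R N S 1%g m = m.
  by apply: M_eq; rewrite incl_cotangent_act Tact1.
rewrite -{1}e; exact: (push_tangent cM (smooth_cotangent_actl m) le).
Qed.

Lemma genM_tauM (eta : tvG) (m : M) :
  push (Y := Q) (@tauM R N) (genM S eta m) = genQ eta (tauM m).
Proof.
rewrite /genM push_comp; last exact: smooth_tauM.
apply: (congr1 (fun phi => push (X := LG) (Y := Q) phi eta)).
by apply/funext => g /=; exact: tauM_cotangent_act.
Qed.

Lemma gen_secM_vfield (xi : Q -> tvG) : smooth_section xi -> vfield (gen_secM xi).
Proof.
move=> [lx sx]; split=> [m|f sf]; first exact: genM_tangent.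
have -> : (fun m => gen_secM xi m f : R) =
    fun m => xi (tauM m) (fun g => f (@cotangent_act R N S g m)).
  by apply/funext => m; rewrite /gen_secM /genM pushE.
apply: (@sm_section_slice R LG M (fun p => f (@cotangent_act R N S p.1 p.2)) 1%g
  (fun m => xi (tauM m)) cG cM (smooth_cotangent_act sf)) => [m|h sh]; first exact: lx.
exact: smooth_tauM (sx h sh).
Qed.

Lemma J_E (m : M) (eta : tvG) : J m eta = cov (Defs.incl m) (genQ eta (tauM m)).
Proof. by rewrite /J thetaM_E genM_tauM. Qed.

Lemma Jnh_E (xi : Q -> tvG) (m : M) :
  Jnh S xi m = cov (Defs.incl m) (genQ (xi (tauM m)) (tauM m)).
Proof. by rewrite /Jnh thetaM_E /gen_secM genM_tauM. Qed.

End symmetric_mechanics.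

(** * Vertical complements *)

Section vertical_complements.
Context {R : realType} {N : nonholonomic_system R} {S : symmetry N}.
Local Notation Q := (Defs.Q N).
Local Notation LG := (lspace (Defs.G S)).
Local Notation tvQ := ((pt Q -> R) -> R^o).
Local Notation tvG := ((pt LG -> R) -> R^o).
Variables (W : Q -> set tvQ) (h : set tvG).
Hypotheses (hW : vertical_complement S W) (lh : lie_subalgebra h)
  (hh : forall q, @gW R N S W q = h).
Implicit Types (q : Q) (eta zeta : tvG).

Let cQ := @Q_sm_closed R N.

Lemma tangent_distribution : exists n, Defs.distribution n (@tangent R Q).
Proof.
have [r dW] := W_distribution hW; exists (rankD N + r)%N.
exact: distribution_direct_sum (D_distribution (n := N)) dW (W_complement hW).
Qed.

Lemma genQ_sum (I : Type) (r : seq I) (c : I -> R) (eta : I -> tvG) q :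
  genQ (\sum_(i <- r) c i *: eta i) q = \sum_(i <- r) c i *: genQ (eta i) q.
Proof.
rewrite /genQ push_sum; apply: eq_bigr => i _; exact: pushZ.
Qed.

Lemma genQB eta zeta q : genQ (eta - zeta) q = genQ eta q - genQ zeta q.
Proof. exact: pushB. Qed.

Lemma h_lie eta : h eta -> lie_algebra eta.
Proof. by have [+ _ _] := lh; apply. Qed.

Lemma h_lin c eta zeta : h eta -> h zeta -> h (c *: eta + zeta).
Proof. by have [_ [_ +] _] := lh; apply. Qed.

Lemma h0 : h 0.
Proof. by have [_ [+ _] _] := lh. Qed.

Lemma h_sum (I : Type) (r : seq I) (c : I -> R) (eta : I -> tvG) :
  (forall i, h (eta i)) -> h (\sum_(i <- r) c i *: eta i).
Proof.
move=> heta; elim: r => [|i r IH]; first by rewrite big_nil; exact: h0.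
by rewrite big_cons; exact: h_lin.
Qed.

Lemma h_W eta q : h eta -> W q (genQ eta q).
Proof. by rewrite -(hh q) => -[]. Qed.

Lemma W_h q w : W q w -> exists2 zeta, h zeta & genQ zeta q = w.
Proof.
move=> Ww; have [zeta lz zw] := W_vertical hW Ww.
by exists zeta => //; rewrite -(hh q); split=> //; rewrite zw.
Qed.

Lemma h_genQ_D q zeta : h zeta -> D q (genQ zeta q) -> zeta = 0.
Proof.
move=> hz Dz; apply: (@genQ_inj R N S zeta q (h_lie hz)).
have [_ DW] := W_complement hW q.
have : (D q `&` W q) (genQ zeta q) by split=> //; exact: h_W.
by rewrite DW.
Qed.

(** A frame of [W] at [q0] is lifted to [h], and injectivity of the generators at [q0] makes the
    lifts span [h]. *)
Lemma h_basis (q0 : Q) : exists r (zeta : 'I_r -> tvG), [/\ forall a, h (zeta a),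
  h = lin_span zeta & lin_indep zeta].
Proof.
have [r dW] := W_distribution hW; have [V [vV nV]] := dW q0.
have [iV WE] := nbhs_singleton nV.
have /choice[zeta zP] : forall a, exists zeta, h zeta /\ genQ zeta q0 = V a q0.
  move=> a; have [|z hz zV] := @W_h q0 (V a q0); last by exists z.
  rewrite WE; exists (fun i => (i == a)%:R).
  rewrite (bigD1 a) //= eqxx scale1r big1 ?addr0 // => i /negPf ->.
  by rewrite scale0r.
have hz a : h (zeta a) by have [] := zP a.
exists r, zeta; split=> //.
  apply/seteqP; split=> [eta he|_ [c ->]]; last exact: h_sum.
  have := h_W q0 he; rewrite WE => -[c eE]; exists c.
  apply/eqP; rewrite -subr_eq0; apply/eqP.
  have hd : h (eta - \sum_i c i *: zeta i).
    rewrite addrC -scaleN1r; apply: h_lin => //; exact: h_sum.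
  apply: (@genQ_inj R N S _ q0 (h_lie hd)).
  rewrite genQB genQ_sum eE; apply/eqP; rewrite subr_eq0; apply/eqP.
  by apply: eq_bigr => i _; have [_ ->] := zP i.
move=> c c0; apply: iV; rewrite -[RHS](push0 (X := LG) (Y := Q) (fun g => act g q0)) -c0.
by rewrite -/(genQ _ q0) genQ_sum; apply: eq_bigr => i _; have [_ ->] := zP i.
Qed.

Lemma genQ_frame r (zeta : 'I_r -> tvG) q : (forall a, h (zeta a)) -> h = lin_span zeta ->
  lin_indep zeta -> lin_indep (fun a => genQ (zeta a) q) /\ W q = lin_span (fun a => genQ (zeta a) q).
Proof.
move=> hz hE iz; split.
  move=> c c0; apply: iz; apply: (@genQ_inj R N S _ q (h_lie (h_sum _ c hz))).
  by rewrite genQ_sum.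
apply/seteqP; split=> [w /W_h[eta]|_ [c ->]].
  by rewrite hE => -[c ->] <-; exists c; rewrite genQ_sum.
by rewrite -genQ_sum; apply: h_W; exact: h_sum.
Qed.

Lemma PgS_expansion r (zeta : 'I_r -> tvG) eta :
  (forall a, h (zeta a)) -> h = lin_span zeta -> lin_indep zeta -> lie_algebra eta ->
  exists z : 'I_r -> Q -> R, (forall a, sm (z a)) /\
    forall q, [/\ PgS S W eta q = eta - \sum_a z a q *: zeta a,
      @gS R N S q (PgS S W eta q) & @gW R N S W q (\sum_a z a q *: zeta a)].
Proof.
move=> hz hE iz le.
(* These coefficients come from a pointwise choice. Smoothness is recovered locally by [frame_coef],
   in the frame of [D] completed by the generators of the [zeta a]. *)
have /choice[z0 z0P] : forall q, exists c : 'I_r -> R,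
    D q (genQ eta q - \sum_a c a *: genQ (zeta a) q).
  move=> q; have [_ WE] := genQ_frame q hz hE iz.
  have [+ _] := W_complement hW q.
  move=> /(congr1 (fun E : set tvQ => E (genQ eta q))).
  have tq : tangent q (genQ eta q) by exact: genQ_tangent.
  move=> e; have [d Dd [w Ww dw]] : [set a + b | a in D q & b in W q] (genQ eta q) by rewrite -e.
  by move: Ww; rewrite WE => -[c wE]; exists c; rewrite -dw wE addrK.
exists (fun a q => z0 q a); split.
  move=> a; apply: sm_local => // q0.
  have [V [vV nV]] := D_distribution (n := N) q0; have [iV DE] := nbhs_singleton nV.
  have [iz0 WE0] := genQ_frame q0 hz hE iz.
  pose F := split_family V (fun a => genQ (zeta a)).
  have vF i : vfield (F i).
    rewrite /F /split_family; case: (fintype.split i) => // j.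
    exact: genQ_vfield (h_lie (hz j)).
  have FE q : (fun i => F i q) = split_family (V^~ q) (fun a => genQ (zeta a) q).
    by apply/funext => i; rewrite /F /split_family; case: (fintype.split i).
  have iF : lin_indep (F^~ q0).
    by rewrite FE; have [] := direct_sum_frame iV iz0 DE WE0 (W_complement hW q0).
  have [f [B [sf sB E]]] := frame_coef cQ vF iF.
  exists (fun q => \sum_j genQ eta q (f j) * B j (rshift (rankD N) a) q).
    apply: sm_sum => // j; apply: smM => //.
    by have [_ sG] := genQ_vfield le; exact: sG (sf j).
  apply: (nearS _ (nearI E nV)) => q [Eq [_ Dq]].
  have := z0P q; rewrite Dq => -[d dE].
  pose c := split_family d (z0 q).
  have cE : \sum_i c i *: F i q = genQ eta q.
    have -> : genQ eta q = \sum_i d i *: V i q + \sum_a z0 q a *: genQ (zeta a) q.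
      by rewrite -dE subrK.
    rewrite big_split_ord /=; congr (_ + _); apply: eq_bigr => i _;
      by rewrite /c /F /split_family ?(unsplitK (inl i)) ?(unsplitK (inr i)).
  have := Eq c (rshift (rankD N) a); rewrite cE => <-.
  by rewrite /c /split_family (unsplitK (inr a)).
move=> q; pose xi := eta - \sum_a z0 q a *: zeta a.
have hsum : h (\sum_a z0 q a *: zeta a) by exact: h_sum.
have lxi : lie_algebra xi by apply: tangentB => //; exact: h_lie.
have Sxi : @gS R N S q xi.
  split=> //; split; last by exists xi.
  by rewrite genQB genQ_sum; exact: z0P.
have Wxi : @gW R N S W q (eta - xi) by rewrite hh /xi opprB addrCA subrr addr0.
have PE : PgS S W eta q = xi.
  apply: (@xget_unique _ 0 [set a | @gS R N S q a /\ @gW R N S W q (eta - a)]) => //.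
  move=> a [[la [Da _]] Wa]; apply/eqP; rewrite -subr_eq0; apply/eqP.
  have hax : h (a - xi).
    rewrite hh in Wa Wxi.
    have E (x y t : tvG) : x - y = (-1) *: (t - x) + (t - y).
      by rewrite scaleN1r opprB addrA subrK.
    rewrite (E a xi eta).
    exact: h_lin.
  apply: (h_genQ_D hax (q := q)); rewrite genQB.
  have [_ [Dxi _]] := Sxi.
  by rewrite addrC -scaleN1r; exact: D_lin.
by rewrite PE hh.
Qed.

Lemma PgS_smooth_section eta : lie_algebra eta -> smooth_section (PgS S W eta).
Proof.
(* A basis of [h] is read off at a point of [Q]; on an empty [Q] both requirements hold
   trivially. *)
move=> le; have [q0|nQ] := pselect (inhabited Q); last first.
  split=> [q|f sf]; first by case: nQ.
  by apply: cQ => q; case: nQ.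
case: q0 => q0; have [r [zeta [hz hE iz]]] := h_basis q0.
have [z [sz zE]] := PgS_expansion hz hE iz le.
split=> [q|f sf]; first by have [_ [+ _] _] := zE q.
have -> : (fun q => PgS S W eta q f : R) = fun q => (eta f : R) - \sum_a z a q * zeta a f.
  by apply/funext => q; have [-> _ _] := zE q; rewrite fctE; congr (_ - _); rewrite fct_sumE.
apply: smB => //; first exact: sm_cst.
by apply: sm_sum => // a; apply: smM => //; exact: sm_cst.
Qed.

Lemma PgS_gS eta q : lie_algebra eta -> @gS R N S q (PgS S W eta q).
Proof.
move=> le; have [r [zeta [hz hE iz]]] := h_basis q.
by have [z [sz zE]] := PgS_expansion hz hE iz le; have [] := zE q.
Qed.

Lemma PgS_h eta q : lie_algebra eta -> h (eta - PgS S W eta q).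
Proof.
move=> le; have [r [zeta [hz hE iz]]] := h_basis q.
have [z [sz zE]] := PgS_expansion hz hE iz le; have [-> _] := zE q.
by rewrite hh opprB addrCA subrr addr0.
Qed.

(* As [eta - PgS eta] takes its values in the fixed subspace [h], so do the
   derivatives of [PgS eta]. *)
Lemma PgS_derive_h eta q u : lie_algebra eta -> tangent q u ->
  h (fun f => u (fun q' => PgS S W eta q' f)).
Proof.
move=> le tu; have [r [zeta [hz hE iz]]] := h_basis q.
have [z [sz zE]] := PgS_expansion hz hE iz le.
have -> : (fun f => u (fun q' => PgS S W eta q' f)) = \sum_a (- u (z a)) *: zeta a.
  apply/funext => f; rewrite fct_sumE.
  have -> : (fun q' => PgS S W eta q' f : R) = fun q' => (eta f : R) - \sum_a z a q' * zeta a f.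
    by apply/funext => q'; have [-> _ _] := zE q'; rewrite fctE; congr (_ - _); rewrite fct_sumE.
  have szf a : sm (fun q' => z a q' * zeta a f) by apply: smM => //; exact: sm_cst.
  rewrite (tangent_funB cQ tu); [|exact: sm_cst|exact: sm_sum].
  rewrite (tangent_cst cQ tu) sub0r (tangent_funsum cQ tu) // -sumrN.
  by apply: eq_bigr => a _; rewrite (tangent_funZr cQ tu) // -mulNr.
exact: h_sum.
Qed.

End vertical_complements.

(** * The nonholonomic field *)

Section second_order.
Context {R : realType} {N : nonholonomic_system R} {n : nat}.
Local Notation Q := (Defs.Q N).
Local Notation T := (cotangent (Defs.Q N)).
Local Notation M := (Defs.M N).
Local Notation tvQ := ((pt Q -> R) -> R^o).
Local Notation tvT := ((pt T -> R) -> R^o).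
Local Notation tvM := ((pt M -> R) -> R^o).
Local Notation kappa := (@metric R N).
Implicit Types (q : Q).

Let cQ := @Q_sm_closed R N.
Let cM := @M_sm_closed R N.
Let cL := @line_sm_closed R.

Hypothesis dQ : Defs.distribution n (@tangent R Q).

(** Adding [t] times the form dual to [w] moves the dual vector to [v + t w], whose kinetic energy
    is quadratic in [t]. *)
Lemma hamiltonian_translate (b : T -> tvQ -> R) (lb : forall a : T, lin_form (base a) (b a))
    (a : T) (v w : tvQ) :
  is_flat a v -> tangent (base a) w ->
  (forall u, tangent (base a) u -> b a u = kappa (base a) w u) ->
  line_tangent (fun t => hamiltonian (translate lb t a)) = kappa (base a) v w.
Proof.
move=> [tv av] tw bE; set q := base a in tv tw bE *.
rewrite -[RHS](line_tangent_quadratic (kappa q v v / 2 + potential q) _ (kappa q w w / 2)).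
congr line_tangent; apply/funext => t.
have tvw : tangent q (t *: w + v) by exact: tangent_lin.
have fl : is_flat (translate lb t a) (t *: w + v).
  split=> // u tu; rewrite cov_translate // metric_linl // bE // av //.
  exact: addrC.
rewrite (hamiltonianE fl) /= -/q metric_linl // (metric_form tw _ tw tv).
rewrite (metric_form tv _ tw tv) (kinetic_sym tv tw).
by field.
Qed.

Lemma D_section q w : D q w -> exists Z, [/\ vfield Z, forall x, D x (Z x) & Z q = w].
Proof.
have [V [vV nV]] := D_distribution (n := N) q.
have [_ DE] := nbhs_singleton nV; rewrite DE => -[c ->].
have [b [sb b1 b0]] := sm_bump cQ nV.
exists (fun x => b x *: \sum_i c i *: V i x); split.
- apply: vfield_scale => //; apply: vfield_sum => // i.
  by apply: vfield_scale => //; exact: sm_cst.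
- move=> x; have [[_ DxE]|nx] := pselect (lin_indep (V^~ x) /\ D x = lin_span (V^~ x)).
    rewrite -[_ *: _]addr0; apply: D_lin; last exact: D0.
    by rewrite DxE; exists c.
  by rewrite (b0 x nx) scale0r; exact: D0.
by rewrite b1 scale1r.
Qed.

Section fibre_translation.
Variable Z : Q -> tvQ.
Hypotheses (vZ : vfield Z) (DZ : forall q, D q (Z q)).

Let b (a : T) : tvQ -> R := kappa (base a) (Z (base a)).

Lemma flat_section_form (a : T) : lin_form (base a) (b a).
Proof. by apply: metric_form; have [tZ _] := vZ. Qed.

Let lb := flat_section_form.

Lemma sm_flat_section (V : Q -> tvQ) : vfield V -> @sm R T (fun a => b a (V (base a))).
Proof.
by move=> vV; have := riem_smooth (metric_riemannian N) vZ vV; exact: smooth_base.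
Qed.

(** The vector dual to the translated covector is a sum of two vectors of [D]. Forms dual to
    sections of [D] thus have vertical lifts tangent to [M], which are the test fields for the
    equation of motion. *)
Lemma translate_in_M (t : line) (m : M) :
  exists2 v, D (base (translate lb t (Defs.incl m))) v & is_flat (translate lb t (Defs.incl m)) v.
Proof.
have [tZ _] := vZ.
have [ts sE] := sharp_flat dQ (Defs.incl m).
exists (t *: Z (tauM m) + sharp (Defs.incl m)).
  by apply: D_lin; [exact: DZ|exact: sharp_D].
split=> [|u tu]; first by apply: tangent_lin => //; exact: tZ.
rewrite cov_translate // sE //= addrC -metric_linl //; exact: tZ.
Qed.

Definition translateM (t : line) (m : M) : M := exist _ _ (translate_in_M t m).

Lemma smooth_translateM :
  smooth_map (X := prod_space line M) (Y := M) (fun p => translateM p.1 p.2).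
Proof.
have cP := @prod_sm_closed R line M.
apply: smooth_map_M => // f sf.
have sp := @smooth_pair R line T (prod_space line M) fst (fun p => Defs.incl p.2) cP
  (@smooth_fst R line M) (smooth_map_comp (@smooth_incl R N) (@smooth_snd R line M)).
exact: (sp _ (smooth_translate lb sm_flat_section sf)).
Qed.

Definition verticalM (m : M) : tvM :=
  push (X := line) (Y := M) (fun t => translateM t m) line_tangent.

Lemma verticalM_fun (m : M) f : @sm R M f ->
  verticalM m f = line_tangent (fun t => f (translateM t m)).
Proof. by move=> sf; rewrite /verticalM pushE. Qed.

Lemma translateM0 (m : M) : translateM 0 m = m.
Proof. by apply: M_eq; exact: translate0. Qed.

Lemma verticalM_vfield : vfield verticalM.
Proof.
have sl (m : M) : smooth_map (X := line) (Y := M) (fun t => translateM t m).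
  move=> f /smooth_translateM.
  exact: (@smooth_pair R line M line id (fun=> m) cL (@smooth_map_id R line) (smooth_map_cst _ cL)).
split=> [m|f sf].
  rewrite -{1}[m]translateM0; apply: (push_tangent cM (sl m)); exact: line_tangentP.
have -> : (fun m => verticalM m f : R) = fun m => line_tangent (fun t => f (translateM t m)).
  by apply/funext => m; rewrite verticalM_fun.
apply: (@sm_slice_tangent R line M (fun p => f (translateM p.1 p.2)) 0) => //.
- exact: smooth_translateM.
- exact: line_tangentP.
Qed.

Lemma verticalM_tauM (m : M) (f : Q -> R) : sm f -> verticalM m (f \o @tauM R N) = 0.
Proof.
move=> sf; rewrite verticalM_fun; last exact: smooth_tauM.
exact: (tangent_cst cL line_tangentP (f (tauM m))).
Qed.

Lemma push_verticalM (m : M) : push (Y := Q) (@tauM R N) (verticalM m) = 0.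
Proof.
apply/funext => f; have [sf|nf] := pselect (sm f); last exact: push_nonsm.
by rewrite pushE // verticalM_tauM.
Qed.

Lemma verticalM_fiberwise (m : M) V : vfield V ->
  verticalM m (fiberwise V \o @Defs.incl R N) = kappa (tauM m) (Z (tauM m)) (V (tauM m)).
Proof.
move=> vV; rewrite verticalM_fun; last exact/smooth_incl/sm_fiberwise.
rewrite -[RHS](line_tangent_affine (cov (Defs.incl m) (V (tauM m)))); congr line_tangent.
apply/funext => t.
rewrite -[LHS]/(cov (translate lb t (Defs.incl m)) (V (tauM m))) cov_translate //.
by have [tV _] := vV; exact: tV.
Qed.

Lemma verticalM_hamiltonian (m : M) : @sm R T (@hamiltonian R N) ->
  verticalM m (@hamiltonianM R N) = kappa (tauM m) (sharp (Defs.incl m)) (Z (tauM m)).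
Proof.
move=> sH; rewrite verticalM_fun; last exact: smooth_incl.
rewrite -[LHS]/(line_tangent (fun t => hamiltonian (translate lb t (Defs.incl m)))).
apply: (@hamiltonian_translate b lb _ _ (Z (tauM m))) => //; first exact: sharp_flat.
by have [tZ _] := vZ; exact: tZ.
Qed.

Lemma verticalM_C : dsection (@C R N) verticalM.
Proof.
split; first exact: verticalM_vfield.
by move=> m; split; [have [tY _] := verticalM_vfield|rewrite push_verticalM; exact: D0].
Qed.

(** As [thetaM] kills vertical vectors, Cartan's formula leaves [Y (theta X) + theta [X, Y]] with
    [Y] vertical. In [cov_expansion] the second derivatives [Y (X f_j)] cancel, and only the fibre
    derivatives of the momenta remain. *)
Lemma omegaM_vertical (X : M -> tvM) (m : M) : vfield X ->
  omegaM X verticalM m = kappa (tauM m) (Z (tauM m)) (push (Y := Q) (@tauM R N) (X m)).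
Proof.
move=> vX; have [tX sX] := vX; have vY := verticalM_vfield; have [tY sY] := vY.
have [f [E [sf vE nE]]] := cov_expansion cQ dQ (tauM m).
have sXf j : sm (fun m => X m (f j \o @tauM R N) : R) by apply: sX; exact: smooth_tauM.
have sfw V : vfield V -> sm (fiberwise V \o @Defs.incl R N).
  by move=> vV; exact/smooth_incl/sm_fiberwise.
have thX (m' : M) : thetaM m' (X m') = cov (Defs.incl m') (push (Y := Q) (@tauM R N) (X m')).
  exact: thetaM_E.
have tpX (m' : M) : tangent (tauM m') (push (Y := Q) (@tauM R N) (X m')).
  by apply: push_tangent => //; exact: smooth_tauM.
have near_theta m0 f0 E0 : (forall j, sm (f0 j)) ->
    (\forall q \near tauM m0, (forall v, tangent q v -> v = \sum_j v (f0 j) *: E0 j q) /\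
      forall (a : covec Q) v, base a = q -> tangent q v ->
        cov a v = \sum_(j < n) v (f0 j) * fiberwise (E0 j) a) ->
    \forall m' \near m0, thetaM m' (X m') =
      \sum_j X m' (f0 j \o @tauM R N) * fiberwise (E0 j) (Defs.incl m').
  move=> sf0 nE0.
  have := smooth_map_continuous (@smooth_tauM R N) (x := m0) nE0.
  apply: nearS => m' [_ Em']; rewrite thX (Em' _ _ erefl) //.
  by apply: eq_bigr => j _; rewrite pushE.
have sth : sm (fun m' => thetaM m' (X m') : R).
  apply: sm_local => // m0.
  have [f0 [E0 [sf0 vE0 nE0]]] := cov_expansion cQ dQ (tauM m0).
  exists (fun m' => \sum_j X m' (f0 j \o @tauM R N) * fiberwise (E0 j) (Defs.incl m')).
    apply: sm_sum => // j; apply: smM => //; last exact: sfw.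
    by apply: sX; exact: smooth_tauM.
  exact: near_theta.
have [Em covE] := nbhs_singleton nE.
rewrite /omegaM /extd.
have -> : (fun m' => thetaM m' (verticalM m')) = fun=> 0.
  by apply/funext => m'; rewrite thetaM_E push_verticalM cov0.
rewrite (tangent_fun0 cM (tX m)) sub0r opprB opprK.
have -> : verticalM m (fun m' => thetaM m' (X m')) =
    verticalM m (fun m' => \sum_j X m' (f j \o @tauM R N) * fiberwise (E j) (Defs.incl m')).
  apply: (tangent_local cM (tY m) sth); last exact: near_theta.
  by apply: sm_sum => // j; apply: smM => //; exact: sfw.
rewrite (tangent_funsum cM (tY m)); last by move=> j; apply: smM => //; exact: sfw.
have tB := bracket_tangent m cM vX vY.
have tpB := push_tangent cQ (@smooth_tauM R N) tB.
rewrite thetaM_E (covE _ _ erefl tpB).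
rewrite [in RHS](Em _ (tpX m)) metric_sumr; first last.
- by have [tZ _] := vZ; exact: tZ.
- by move=> j; have [tE _] := vE j; exact: tE.
rewrite -big_split; apply: eq_bigr => j _ /=.
rewrite [push _ _ _]pushE // /bracket.
have -> : (fun y => verticalM y (f j \o @tauM R N)) = fun=> 0.
  by apply/funext => m'; exact: verticalM_tauM.
rewrite (tangent_fun0 cM (tX m)) sub0r.
rewrite (tangentM (tY m)) //; last exact: sfw.
have -> : verticalM m (fun m' => fiberwise (E j) (Defs.incl m')) =
  kappa (tauM m) (Z (tauM m)) (E j (tauM m)) by exact: verticalM_fiberwise.
by rewrite [push _ _ _]pushE //=; ring.
Qed.

End fibre_translation.

(** Let [u] be the projection and [s] the dual vector, both in [D]. Tested on the vertical lift
    given by a section of [D] equal to [u - s] at the base point, the equation of motion reads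
    [kappa (u - s) u = kappa s (u - s)], so [u - s] has norm zero. *)
Lemma nonholonomic_second_order (X : M -> tvM) (m : M) : @sm R T (@hamiltonian R N) ->
  nonholonomic_field X -> push (Y := Q) (@tauM R N) (X m) = sharp (Defs.incl m).
Proof.
move=> sH [[vX CX] XE].
have [tu Du] := CX m; have [ts sE] := sharp_flat dQ (Defs.incl m).
have tpu := D_tangent Du.
set u := push _ _ in Du tpu *; set s := sharp _ in ts sE *.
have Dus : D (tauM m) (u - s).
  by rewrite addrC -scaleN1r; apply: D_lin => //; exact: sharp_D.
have [Z [vZ DZ ZE]] := D_section Dus.
have := XE _ (verticalM_C vZ DZ) m.
rewrite omegaM_vertical // verticalM_hamiltonian // -/u -/s ZE => e.
apply/eqP; rewrite -subr_eq0; apply/eqP.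
have tus := D_tangent Dus.
apply: (metric_definite tus).
have E : u - s = (-1) *: s + u by rewrite scaleN1r addrC.
rewrite {2}E (metric_form tus _ ts tpu) e mulN1r.
by rewrite (kinetic_sym ts tus) addNr.
Qed.

End second_order.

(** * Derivatives of Lie algebra valued sections and the form K_W *)

Section derivative_sections.
Context {R : realType} {N : nonholonomic_system R} {S : symmetry N}.
Local Notation Q := (Defs.Q N).
Local Notation LG := (lspace (Defs.G S)).
Local Notation tvQ := ((pt Q -> R) -> R^o).
Local Notation tvG := ((pt LG -> R) -> R^o).
Let cQ := @Q_sm_closed R N.
Let cG := @G_sm_closed R N S.

(** The derivative along [u] of [xi] seen as a function with values in one fixed vector space, taken
    pointwise in the argument [f]. *)
Definition section_derive (u : tvQ) (xi : Q -> tvG) : tvG := fun f => u (fun q => xi q f).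

Lemma section_derive_lie u q (xi : Q -> tvG) : tangent q u -> smooth_section xi ->
  lie_algebra (section_derive u xi).
Proof.
move=> tu [lx sx]; rewrite /section_derive; split=> [f nf|a f g sf sg|f g sf sg].
- have -> : (fun q => xi q f : R) = fun=> 0.
    by apply/funext => q'; exact: tangent_nonsm (lx q') nf.
  by rewrite (tangent_fun0 cQ tu).
- have -> : (fun q => xi q (fun y => a * f y + g y)) = fun q => a * xi q f + xi q g.
    by apply/funext => q'; exact: tangentL (lx q') _ _.
  by rewrite (tangentL a tu) //; exact: sx.
- have -> : (fun q => xi q (fun y => f y * g y)) = fun q => xi q f * g 1%g + f 1%g * xi q g.
    by apply/funext => q'; exact: tangentM (lx q') _ _.
  have sxf := sx _ sf; have sxg := sx _ sg.
  rewrite (tangent_funD tu); last first.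
  - by apply: smM => //; exact: sm_cst.
  - by apply: smM => //; exact: sm_cst.
  by rewrite (tangent_funZr cQ tu) // (tangent_funZ cQ tu).
Qed.

Lemma section_derive_smooth (V : Q -> tvQ) (xi : Q -> tvG) : vfield V -> smooth_section xi ->
  smooth_section (fun q => section_derive (V q) xi).
Proof.
move=> [tV sV] sxi; split=> [q|f sf]; first exact: section_derive_lie (tV q) sxi.
by have [_ sx] := sxi; exact: sV (sx f sf).
Qed.

Lemma gen_secQ_derive (u : tvQ) q (xi : Q -> tvG) f : tangent q u -> smooth_section xi ->
  sm f -> u (fun q' => gen_secQ xi q' f) =
    genQ (section_derive u xi) q f + u (fun q' => genQ (xi q) q' f).
Proof.
move=> tu [lx sx] sf.
have -> : (fun q' => gen_secQ xi q' f) = (fun q' => xi q' (fun g => f (act g q'))).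
  by apply/funext => q'; rewrite /gen_secQ /genQ pushE.
rewrite (@section_slice_derive R LG Q (fun p => f (act p.1 p.2)) 1%g q xi u) //; last first.
  exact: sm_act_fun sf.
congr (_ + _); first by rewrite /genQ pushE.
by congr u; apply/funext => q'; rewrite /genQ pushE.
Qed.

End derivative_sections.

Section gauge_condition.
Context {R : realType} {N : nonholonomic_system R} {S : symmetry N} {n : nat}.
Local Notation Q := (Defs.Q N).
Local Notation LG := (lspace (Defs.G S)).
Local Notation M := (Defs.M N).
Local Notation tvQ := ((pt Q -> R) -> R^o).
Local Notation tvG := ((pt LG -> R) -> R^o).
Local Notation tvM := ((pt M -> R) -> R^o).
Variables (W : Q -> set tvQ) (h : set tvG).
Hypotheses (dQ : Defs.distribution n (@tangent R Q)).
Hypotheses (hW : vertical_complement S W) (lh : lie_subalgebra h)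
  (hh : forall q, @gW R N S W q = h).
Let cQ := @Q_sm_closed R N.
Let cG := @G_sm_closed R N S.
Let cM := @M_sm_closed R N.

Lemma calW_h (m : M) v : @calW R N S W m v -> exists2 zeta, h zeta & v = genM S zeta m.
Proof.
move=> [[zeta lz <-]]; rewrite (genM_tauM dQ) => Wz.
by exists zeta => //; rewrite -(hh (tauM m)).
Qed.

Lemma h_calW (m : M) zeta : h zeta -> @calW R N S W m (genM S zeta m).
Proof.
move=> hz; split; first by exists zeta => //; exact: h_lie hz.
rewrite (genM_tauM dQ); exact: (h_W hh).
Qed.

Lemma C_lin (m : M) c v w : @C R N m v -> C m w -> C m (c *: v + w).
Proof.
move=> [tv Dv] [tw Dw]; split; first exact: tangent_lin.
by rewrite push_lin; exact: D_lin.
Qed.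

Lemma genM_C (m : M) zeta : h zeta -> C m (genM S zeta m) -> zeta = 0.
Proof.
by move=> hz [_]; rewrite (genM_tauM dQ) => Dz; exact: (h_genQ_D hW lh hh hz Dz).
Qed.

Lemma genMB (eta zeta : tvG) (m : M) : genM S (eta - zeta) m = genM S eta m - genM S zeta m.
Proof. exact: pushB. Qed.

Lemma C_calW_unique (m : M) (v a a' : tvM) zeta zeta' :
  C m a -> C m a' -> h zeta -> h zeta' -> v = a + genM S zeta m ->
  v = a' + genM S zeta' m -> zeta = zeta' /\ a = a'.
Proof.
move=> Ca Ca' hz hz' va va'.
have e : genM S (zeta - zeta') m = a' - a.
  rewrite genMB; apply/eqP; rewrite subr_eq addrAC -va' va; apply/eqP.
  by rewrite addrC addKr.
have zz : zeta - zeta' = 0.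
  apply: (@genM_C m).
    by rewrite addrC -scaleN1r; exact: (h_lin lh).
  by rewrite e addrC -scaleN1r; exact: C_lin.
split; first by apply/eqP; rewrite -subr_eq0 zz.
move: e; rewrite zz /genM push0 => /esym/eqP; rewrite subr_eq0 => /eqP.
by [].
Qed.

Lemma projC_E (m : M) (a : tvM) zeta : C m a -> h zeta ->
  @projC R N S W m (a + genM S zeta m) = a.
Proof.
move=> Ca hz.
apply: (@xget_unique _ 0 [set a' | C m a' /\ @calW R N S W m (a + genM S zeta m - a')]).
  by split=> //; rewrite addrC addKr; exact: h_calW.
move=> a' [Ca' /calW_h[zeta' hz' e]].
have [|_ ->] // := @C_calW_unique m (a + genM S zeta m) a' a zeta' zeta Ca' Ca hz' hz _ erefl.
by rewrite -e addrCA subrr addr0.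
Qed.

Lemma projW_E (m : M) (a : tvM) zeta : C m a -> h zeta ->
  @projW R N S W m (a + genM S zeta m) = genM S zeta m.
Proof.
move=> Ca hz.
apply: (@xget_unique _ 0 [set w | @calW R N S W m w /\ C m (a + genM S zeta m - w)]).
  by split; [exact: h_calW|rewrite addrK].
move=> w [/calW_h[zeta' hz' ->]] Ca'.
have [|->] // := @C_calW_unique m (a + genM S zeta m) _ a zeta' zeta Ca' Ca hz' hz _ erefl.
by rewrite subrK.
Qed.

Lemma calA_E (m : M) (a : tvM) zeta : C m a -> h zeta ->
  @calA R N S W m (a + genM S zeta m) = zeta.
Proof.
move=> Ca hz; rewrite /calA projW_E //.
apply: (@xget_unique _ 0 [set xi | lie_algebra xi /\ genM S xi m = genM S zeta m]).
  by split=> //; exact: h_lie hz.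
move=> xi [lx e]; apply/eqP; rewrite -subr_eq0; apply/eqP.
apply: (@genQ_inj R N S _ (tauM m)).
  by apply: tangentB => //; exact: h_lie hz.
by rewrite -(genM_tauM dQ) genMB e subrr push0.
Qed.

Lemma calA_C (m : M) (a : tvM) : C m a -> @calA R N S W m a = 0.
Proof.
move=> Ca; have := calA_E Ca (h0 lh).
by rewrite /genM push0 addr0.
Qed.

Lemma projC_C (m : M) (a : tvM) : C m a -> @projC R N S W m a = a.
Proof.
move=> Ca; have := projC_E Ca (h0 lh).
by rewrite /genM push0 addr0.
Qed.

Variables (Xnh : M -> tvM).
Hypotheses (hX : nonholonomic_field Xnh) (sH : @sm R (cotangent Q) (@hamiltonian R N)).

(* The bracket of [Xnh] with the field generated by the section [xi] only sees the
   derivative of [xi], because [Xnh] projects to the equivariant map [sharp]. *)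
Lemma push_bracket (xi : Q -> tvG) (m : M) : smooth_section xi ->
  push (Y := Q) (@tauM R N) (bracket Xnh (gen_secM xi) m) =
  genQ (section_derive (sharp (Defs.incl m)) xi) (tauM m).
Proof.
move=> sxi; have [[[tX sX] CX] _] := hX; have [lx sx] := sxi.
set q := tauM m; set u := sharp _.
have uE : push (Y := Q) (@tauM R N) (Xnh m) = u by exact: nonholonomic_second_order dQ _ _ sH hX.
have tu : tangent q u by have [] := sharp_flat dQ (Defs.incl m).
apply/funext => f; have [sf|nf] := pselect (sm f); last by rewrite /genQ !push_nonsm.
rewrite pushE // /bracket.
have -> : (fun m' => gen_secM xi m' (f \o @tauM R N)) = (fun q => gen_secQ xi q f) \o @tauM R N.
  apply/funext => m' /=; rewrite -pushE // /gen_secM (genM_tauM dQ).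
  by [].
have -> : Xnh m ((fun q => gen_secQ xi q f) \o @tauM R N) = u (fun q => gen_secQ xi q f).
  by rewrite -uE pushE //; have [_ sG] := gen_secQ_vfield sxi; exact: sG.
rewrite (gen_secQ_derive tu sxi sf).
have -> : (fun m' => Xnh m' (f \o @tauM R N)) = fun m' => sharp (Defs.incl m') f.
  apply/funext => m'; rewrite -pushE //.
  by rewrite (nonholonomic_second_order dQ m' sH hX).
(* Along the orbit [sharp] moves by the differential of the action, so its derivative is a mixed
   derivative of [f (act g q')]; it cancels the term in which [xi] is frozen at [q]. *)
suff -> : gen_secM xi m (fun m' => sharp (Defs.incl m') f) = u (fun q' => genQ (xi q) q' f).
  by rewrite addrK.
have ss : sm (fun m' : M => sharp (Defs.incl m') f : R).
  have -> : (fun m' : M => sharp (Defs.incl m') f : R) = fun m' => Xnh m' (f \o @tauM R N).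
    apply/funext => m'; rewrite -(nonholonomic_second_order dQ m' sH hX).
    by rewrite pushE.
  by apply: sX; exact: smooth_tauM.
rewrite /gen_secM /genM pushE // -/q.
have -> : (fun m' : M => sharp (Defs.incl m') f) \o (fun g => @cotangent_act R N S g m) =
    fun g => u (fun q' => f (act g q')).
  apply/funext => g /=; rewrite (incl_cotangent_act dQ).
  by rewrite (sharpE (is_flat_Tact g (sharp_flat dQ (Defs.incl m)))) pushE.
rewrite -(@slice_comm R LG Q (fun p => f (act p.1 p.2)) 1%g q (xi q) u cG cQ (sm_act_fun sf) (lx q) tu).
by congr u; apply/funext => q'; rewrite /genQ pushE.
Qed.

Lemma gauge_condition eta (m : M) : lie_algebra eta ->
  @JK R N S W Xnh (genM S eta) m = 0 ->
  cov (Defs.incl m) (genQ (section_derive (sharp (Defs.incl m)) (PgS S W eta)) (tauM m)) = 0.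
Proof.
move=> le; have [[vX CX] _] := hX; have [tX sX] := vX.
pose xi := PgS S W eta.
have sxi : smooth_section xi by exact: PgS_smooth_section hW lh hh _ le.
have vxi := gen_secM_vfield dQ sxi; have [txi _] := vxi.
set u := sharp _; set z := section_derive u xi.
have tu : tangent (tauM m) u by have [] := sharp_flat dQ (Defs.incl m).
have hz : h z by exact: (PgS_derive_h hW lh hh le tu).
have Cxi (m' : M) : C m' (gen_secM xi m').
  split=> //; rewrite /gen_secM (genM_tauM dQ).
  by have [_ []] := PgS_gS hW lh hh (tauM m') le.
(* The difference of [eta] and [xi] has values in [h], so [xi_M] is the part of [eta_M] in [C]. *)
have projxi : (fun m' => @projC R N S W m' (genM S eta m')) = gen_secM xi.
  apply/funext => m'.
  have -> : genM S eta m' = gen_secM xi m' + genM S (eta - xi (tauM m')) m'.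
    by rewrite genMB /gen_secM addrCA subrr addr0.
  by apply: projC_E => //; exact: (PgS_h hW lh hh).
have projX : (fun m' => @projC R N S W m' (Xnh m')) = Xnh.
  by apply/funext => m'; exact: projC_C.
(* Subtracting [genM S z m] from the bracket leaves a vector that projects to 0, hence one in [C];
   since [z] is in [h], this is the decomposition along [C] and [calW]. *)
have AB : @calA R N S W m (bracket Xnh (gen_secM xi) m) = z.
  rewrite -[bracket _ _ _](subrK (genM S z m)); apply: calA_E => //.
  have tB := bracket_tangent m cM vX vxi.
  split; first by apply: tangentB => //; apply: (genM_tangent dQ); exact: h_lie lh _ hz.
  rewrite pushB push_bracket // (genM_tauM dQ) subrr; exact: D0.
have KE : @calK R N S W Xnh (genM S eta) m = - z.
  apply/funext => f; rewrite /calK projX projxi /extd.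
  have -> : (fun y => @calA R N S W y (gen_secM xi y) f : R) = fun=> 0.
    by apply/funext => y; rewrite calA_C.
  have -> : (fun y => @calA R N S W y (Xnh y) f : R) = fun=> 0.
    by apply/funext => y; rewrite calA_C.
  by rewrite (tangent_fun0 cM (tX m)) (tangent_fun0 cM (txi m)) AB subrr sub0r.
rewrite /JK KE (J_E dQ).
have -> : genQ (- z) (tauM m) = - genQ z (tauM m) by exact: pushN.
rewrite covN; last by apply: genQ_tangent; exact: h_lie lh _ hz.
by move=> /eqP; rewrite oppr_eq0 => /eqP.
Qed.

End gauge_condition.

(** * Cotangent lifts *)

Section lifts.
Context {R : realType} {N : nonholonomic_system R} {S : symmetry N} {n : nat}.
Local Notation Q := (Defs.Q N).
Local Notation LG := (lspace (Defs.G S)).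
Local Notation T := (cotangent (Defs.Q N)).
Local Notation M := (Defs.M N).
Local Notation tvQ := ((pt Q -> R) -> R^o).
Local Notation tvT := ((pt T -> R) -> R^o).
Local Notation tvG := ((pt LG -> R) -> R^o).
Local Notation kappa := (@metric R N).
Hypotheses (dQ : Defs.distribution n (@tangent R Q)).
Let cQ := @Q_sm_closed R N.
Let cG := @G_sm_closed R N S.
Let cT := @cotangent_sm_closed R Q.

(** The function [g |-> (g.a) (V (g.q))] is compared at the unit with [g |-> (g.a) (g_* V q)], which
    is constant. The derivatives of the momenta drop out of the difference, and [slice_comm]
    identifies what is left with the bracket. *)
Lemma genT_fiberwise (zeta : tvG) (a : T) V : lie_algebra zeta -> vfield V ->
  genT zeta a (fiberwise V) = cov a (bracket (genQ zeta) V (base a)).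
Proof.
move=> lz vV; have [tV sV] := vV; set q := base a.
have vz := genQ_vfield lz.
have [f [E [sf vE nE]]] := cov_expansion cQ dQ q.
have [_ covE] := nbhs_singleton nE.
have nG : \forall g \near (1%g : LG),
    (forall v, tangent (act g q) v -> v = \sum_j v (f j) *: E j (act g q)) /\
      forall (a : covec Q) v, base a = act g q -> tangent (act g q) v ->
        cov a v = \sum_j v (f j) * fiberwise (E j) a.
  have c := smooth_map_continuous (@smooth_orbit R N S q) (x := 1%g).
  move: (nE); rewrite -{1}(@act1 R N S q) => nE1.
  exact: (c _ nE1).
have sfwT V' : vfield V' -> @sm R LG (fun g => fiberwise V' (Tact g a)).
  by move=> vV'; exact: (@smooth_Tactl R N S n dQ a _ (sm_fiberwise vV')).
have sVg j : @sm R LG (fun g => V q (fun q' => f j (act g q'))).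
  pose k (p : Q * LG) := f j (act p.2 p.1).
  have sk : @sm R (prod_space Q LG) k.
    have := @act_smooth R N S _ (sf j).
    exact: (smooth_pair (@prod_sm_closed R Q LG) (@smooth_snd R Q LG) (@smooth_fst R Q LG)).
  exact: (sm_slice_tangent cQ cG sk (tV q)).
have sVo j : @sm R LG (fun g => V (act g q) (f j)).
  exact: (@smooth_orbit R N S q _ (sV _ (sf j))).
rewrite /genT pushE; last exact: sm_fiberwise.
have -> : zeta (fiberwise V \o (fun g => Tact g a)) =
    zeta (fun g => \sum_j V (act g q) (f j) * fiberwise (E j) (Tact g a)).
  apply: (tangent_local cG lz) => //; first exact: sfwT.
    by apply: sm_sum => // j; apply: smM => //; exact: sfwT.
  by apply: nearS nG => g [_ /(_ (Tact g a) _ erefl)]; apply; exact: tV.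
have const : zeta (fun g => \sum_j V q (fun q' => f j (act g q')) * fiberwise (E j) (Tact g a)) = 0.
  rewrite -[RHS](tangent_cst cG lz (cov a (V q))); apply: (tangent_local cG lz).
  - by apply: sm_sum => // j; apply: smM => //; exact: sfwT.
  - exact: sm_cst.
  apply: nearS nG => g [_ Eg].
  rewrite -(cov_Tact_push g (tV q)) (Eg (Tact g a) _ erefl); last first.
    exact: push_act_tangent.
  by apply: eq_bigr => j _; rewrite pushE.
move: const; rewrite !(tangent_funsum cG lz); last first.
- by move=> j; apply: smM => //; exact: sfwT.
- by move=> j; apply: smM => //; exact: sfwT.
move=> const; rewrite -[LHS]subr0 -[X in _ - X]const -sumrB.
have tB := bracket_tangent q cQ vz vV.
rewrite (covE a _ erefl tB); apply: eq_bigr => j _.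
rewrite !(tangentM lz) //; try exact: sfwT.
rewrite Tact1 act1 opprD addrACA.
have -> : (fun q' : Q => f j (act (1%g : LG) q')) = f j :> (Q -> R).
  by apply/funext => q'; rewrite act1.
rewrite subrr addr0 -mulrBl; congr (_ * _); rewrite /bracket; congr (_ - _).
  rewrite /genQ pushE //; exact: sV.
rewrite -(@slice_comm R LG Q (fun p => f j (act p.1 p.2)) 1%g q zeta (V q) cG cQ
  (sm_act_fun (sf j)) lz (tV q)).
by congr (V q); apply/funext => q'; rewrite /genQ pushE.
Qed.

Section lift_section.
Variable xi : Q -> tvG.
Hypothesis sxi : smooth_section xi.

(* The vertical part of the cotangent lift of the field generated by [xi]: the
   lift moves the covector by the action, corrected by the derivative of [xi]. *)
Definition lift_form (a : T) (v : tvQ) : R :=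
  - cov a (genQ (section_derive v xi) (base a)).

Lemma lift_form_lin (a : T) : lin_form (base a) (lift_form a).
Proof.
move=> c v w tv tw; rewrite /lift_form.
have -> : section_derive (c *: v + w) xi = c *: section_derive v xi + section_derive w xi by [].
rewrite genQ_lin cov_lin; first by ring.
- by apply: genQ_tangent; exact: section_derive_lie tv sxi.
- by apply: genQ_tangent; exact: section_derive_lie tw sxi.
Qed.

Lemma sm_lift_form V : vfield V -> @sm R T (fun a => lift_form a (V (base a))).
Proof.
move=> vV; apply: smN => //.
exact: (sm_fiberwise (gen_secQ_vfield (section_derive_smooth vV sxi))).
Qed.

Definition lift (a : T) : tvT := gen_secT xi a + vertical lift_form_lin a.

Lemma lift_vfield : vfield lift.
Proof.
have [tG sG] := gen_secT_vfield dQ sxi.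
have [tV sV] := vertical_vfield lift_form_lin sm_lift_form.
split=> [a|f sf]; first exact: tangentD.
by apply: (smD cT); [exact: sG|exact: sV].
Qed.

Lemma lift_base (a : T) f : sm f -> lift a (f \o @base R Q) = gen_secQ xi (base a) f.
Proof.
move=> sf; rewrite /lift fctE (vertical_base _ _ sf) addr0.
by rewrite -pushE // /gen_secT genT_base.
Qed.

Lemma push_lift (a : T) : push (X := T) (Y := Q) (@base R Q) (lift a) = gen_secQ xi (base a).
Proof.
apply/funext => f; have [sf|nf] := pselect (sm f); first by rewrite pushE // lift_base.
by rewrite /gen_secQ /genQ !push_nonsm.
Qed.

(** The rule by which cotangent lifts act on fibrewise linear functions. The generator gives the
    bracket with [xi] frozen at the base point; the vertical correction supplies the derivative of
    [xi] along [V]. *)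
Lemma lift_fiberwise (a : T) V : vfield V ->
  lift a (fiberwise V) = cov a (bracket (gen_secQ xi) V (base a)).
Proof.
move=> vV; have [tV sV] := vV; have [lx sx] := sxi.
rewrite /lift fctE (vertical_fiberwise _ _ vV) /gen_secT genT_fiberwise //.
set q := base a; have vG := gen_secQ_vfield sxi.
have vz := genQ_vfield (lx q).
have lD := section_derive_lie (tV q) sxi.
rewrite /lift_form -covN; last exact: genQ_tangent.
have tB := bracket_tangent q cQ vz vV.
have tN : tangent q (- genQ (section_derive (V q) xi) q) by apply: tangentN; exact: genQ_tangent.
rewrite -covD //; congr cov.
apply: (tangent_eq (tangentD tB tN) (bracket_tangent q cQ vG vV)) => f sf.
rewrite !fctE /bracket (gen_secQ_derive (tV q) sxi sf) /gen_secQ -/q.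
by rewrite opprD addrA addrAC.
Qed.

(** The lift [Y] preserves the canonical form, that is [Y (theta Z) = theta [Y, Z]] for every [Z],
    so Cartan's formula leaves [Z (theta Y)], where [theta Y] is the function attached to [xi_Q]. As
    [Z] need not be projectable, its projection is expanded in a frame whose coefficients [Z (f j)]
    are functions on the cotangent bundle. *)
Lemma lift_cotangent_lift : cotangent_lift (gen_secQ xi) lift.
Proof.
have vY := lift_vfield; have vX := gen_secQ_vfield sxi.
split=> // Z vZ a; have [tY sY] := vY; have [tZ sZ] := vZ; have [tX sX] := vX.
set q := base a.
have sb f : sm f -> @sm R T (f \o @base R Q) by exact: smooth_base.
have tpZ (a' : T) : tangent (base a') (push (X := T) (Y := Q) (@base R Q) (Z a')).
  by apply: push_tangent => //; exact: smooth_base.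
have near_theta (a0 : T) f0 E0 : (forall j, sm (f0 j)) ->
    (\forall q \near base a0, (forall v, tangent q v -> v = \sum_j v (f0 j) *: E0 j q) /\
      forall (a : covec Q) v, base a = q -> tangent q v ->
        cov a v = \sum_(j < n) v (f0 j) * fiberwise (E0 j) a) ->
    \forall a' \near a0, (forall f, sm f -> Z a' (f \o @base R Q) =
        \sum_j Z a' (f0 j \o @base R Q) * E0 j (base a') f) /\
      thetaQ a' (Z a') = \sum_j Z a' (f0 j \o @base R Q) * fiberwise (E0 j) a'.
  move=> sf0 nE0.
  have := smooth_map_continuous (@smooth_base R Q) (x := a0) nE0.
  apply: nearS => a' [Ev Ecov]; split=> [f sf|].
    rewrite -pushE // {1}(Ev _ (tpZ a')) fct_sumE.
    by apply: eq_bigr => j _; rewrite pushE.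
  rewrite /thetaQ (Ecov _ _ erefl) //.
  by apply: eq_bigr => j _; rewrite pushE.
have sth : @sm R T (fun a' => thetaQ a' (Z a') : R).
  apply: sm_local => // a0.
  have [f0 [E0 [sf0 vE0 nE0]]] := cov_expansion cQ dQ (base a0).
  exists (fun a' => \sum_j Z a' (f0 j \o @base R Q) * fiberwise (E0 j) a').
    apply: sm_sum => // j; apply: smM => //; last exact: sm_fiberwise.
    by apply: sZ; exact: sb.
  by apply: nearS (near_theta a0 f0 E0 sf0 nE0) => a' [].
have [f [E [sf vE nE]]] := cov_expansion cQ dQ q.
have nT := near_theta a f E sf nE.
have sZf j : @sm R T (fun a' => Z a' (f j \o @base R Q) : R) by apply: sZ; exact: sb.
have tE j : tangent q (E j q) by have [tE _] := vE j.
have tB j := bracket_tangent q cQ vX (vE j).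
rewrite /omegaQ /extd.
have -> : (fun a' => thetaQ a' (lift a')) = fiberwise (gen_secQ xi).
  by apply/funext => a'; rewrite /thetaQ push_lift.
have tBr := bracket_tangent a cT vY vZ.
have wE : push (X := T) (Y := Q) (@base R Q) (bracket lift Z a) =
    \sum_j (lift a (fun a' => Z a' (f j \o @base R Q)) *: E j q +
            Z a (f j \o @base R Q) *: bracket (gen_secQ xi) (E j) q).
  have tR : tangent q (\sum_j (lift a (fun a' => Z a' (f j \o @base R Q)) *: E j q +
            Z a (f j \o @base R Q) *: bracket (gen_secQ xi) (E j) q)).
    by apply: tangent_sum => j; apply: tangentD; exact: tangentZ.
  apply: (tangent_eq (push_tangent cQ (@smooth_base R Q) tBr) tR) => k sk.
  rewrite pushE // fct_sumE /bracket.
  have sEk j : @sm R T (fun a' => E j (base a') k).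
    by have [_ sEj] := vE j; exact: (sb _ (sEj _ sk)).
  have -> : lift a (fun a' => Z a' (k \o @base R Q)) =
      lift a (fun a' => \sum_j Z a' (f j \o @base R Q) * E j (base a') k).
    apply: (tangent_local cT (tY a)); first by apply: sZ; exact: sb.
      by apply: sm_sum => // j; exact: smM.
    by apply: nearS nT => a' [-> //].
  have -> : (fun a' => lift a' (k \o @base R Q)) = (fun q => gen_secQ xi q k) \o @base R Q.
    by apply/funext => a'; rewrite lift_base.
  have [Zk _] := nbhs_singleton nT; rewrite Zk; last exact: sX.
  rewrite (tangent_funsum cT (tY a)); last by move=> j; exact: smM.
  rewrite -sumrB; apply: eq_bigr => j _.
  rewrite (tangentM (tY a)) //.
  have -> : lift a (fun a' => E j (base a') k) = gen_secQ xi q (fun q => E j q k).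
    by have [_ sEj] := vE j; exact: (@lift_base a (fun q => E j q k) (sEj _ sk)).
  rewrite !fctE /GRing.scale /= -/q; ring.
rewrite [thetaQ a _]/thetaQ wE cov_sum; last first.
  by move=> j; apply: tangentD; exact: tangentZ.
have -> : lift a (fun a' => thetaQ a' (Z a')) =
    lift a (fun a' => \sum_j Z a' (f j \o @base R Q) * fiberwise (E j) a').
  apply: (tangent_local cT (tY a) sth).
    by apply: sm_sum => // j; apply: smM => //; exact: sm_fiberwise.
  by apply: nearS nT => a' [].
rewrite (tangent_funsum cT (tY a)); last first.
  by move=> j; apply: smM => //; exact: sm_fiberwise.
have -> : \sum_j lift a (fun a' => Z a' (f j \o @base R Q) * fiberwise (E j) a') =
    \sum_j cov a (lift a (fun a' => Z a' (f j \o @base R Q)) *: E j q +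
            Z a (f j \o @base R Q) *: bracket (gen_secQ xi) (E j) q).
  apply: eq_bigr => j _; rewrite (tangentM (tY a)) //; last exact: sm_fiberwise.
  rewrite lift_fiberwise // (covD (a := a) (tangentZ _ (tE j)) (tangentZ _ (tB j))).
  by rewrite !covZ.
by rewrite addrAC subrr sub0r opprK.
Qed.

Lemma lift_hamiltonian (a : T) : @sm R T (@hamiltonian R N) ->
  lift a (@hamiltonian R N) = lift_form a (sharp a).
Proof.
move=> sH; rewrite /lift fctE /gen_secT /genT pushE //.
have -> : (@hamiltonian R N) \o (fun g : LG => Tact g a) = fun=> hamiltonian a.
  by apply/funext => g /=; exact: hamiltonian_Tact dQ g a.
have [lx _] := sxi.
rewrite (tangent_cst cG (lx (base a))) add0r /vertical pushE //.
(* The correcting form is replaced by its dual vector [w], which is the shape in which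
   [hamiltonian_translate] applies. *)
have [w wE] := riesz dQ (mk_covec (@lift_form_lin a)).
have [tw wE'] := wE.
have sa := sharp_flat dQ a; have [ts _] := sa.
have bE u : tangent (base a) u -> lift_form a u = kappa (base a) w u.
  by move=> tu; rewrite -[RHS]wE' // cov_mk.
rewrite -[LHS]/(line_tangent (fun t => hamiltonian (translate lift_form_lin t a))).
rewrite (hamiltonian_translate lift_form_lin sa tw bE) bE //.
exact: kinetic_sym.
Qed.

End lift_section.
End lifts.

(** * Existence and independence of the momenta *)

Theorem proposition3p10
  (R : realType) (N : nonholonomic_system R) (S : symmetry N)
  (hdim : dimension_assumption S)
  (W : Q N -> set ((Q N -> R) -> R^o))
  (hW : vertical_complement S W)
  (hvert : vertical_symmetry_condition S W)
  (Xnh : M N -> (M N -> R) -> R^o)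
  (hX : nonholonomic_field Xnh)
  (hJK : forall eta, lie_algebra eta ->
     forall m, JK S W Xnh (genM S eta) m = 0)
  (k : nat) (hk : forall q, has_dim (distS S q) k) :
  exists eta : 'I_k -> (lspace (G S) -> R) -> R^o,
    [/\ forall i, lie_algebra (eta i),
        forall i, horizontal_gauge_symmetry S (PgS S W (eta i)) &
        forall (q : Q N) (c : 'I_k -> R),
          (forall m, tauM m = q ->
             \sum_i c i * Jnh S (PgS S W (eta i)) m = 0) ->
          forall i, c i = 0].
Proof.
have cQ := @Q_sm_closed R N.
(* On an empty [Q] every distribution is integrable, against [D_nonintegrable]; so there is a point
   at which to take a basis of [S]. *)
have [q0|nQ] := pselect (inhabited (Q N)); last first.
  case: (D_nonintegrable (n := N)) => V V' _ _; split; last by move=> q; case: nQ.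
  by split=> [q|f sf]; [case: nQ|apply: cQ => q; case: nQ].
case: q0 => q0; have [h lh hh] := hvert.
have [n dQ] := tangent_distribution hW.
have [b ib bE] := hk q0.
have bS i : distS S q0 (b i).
  rewrite bE; exists (fun j => (j == i)%:R).
  rewrite (bigD1 i) //= eqxx scale1r big1 ?addr0 // => j /negPf ->.
  by rewrite scale0r.
have /choice[eta etaP] : forall i, exists eta, lie_algebra eta /\ genQ (S := S) eta q0 = b i.
  by move=> i; have [_ [z lz zb]] := bS i; exists z.
have le i : lie_algebra (eta i) by have [] := etaP i.
exists eta; split=> // [i|q c c0].
  have sxi := PgS_smooth_section hW lh hh (le i).
  split=> //; first by move=> q; exact: (PgS_gS hW lh hh q (le i)).
  exists (lift sxi); first exact: lift_cotangent_lift dQ _ sxi.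
  (* Should the Hamiltonian not belong to the algebra, derivations give it the value 0 by
     convention. *)
  move=> m; have [sH|nH] := pselect (@sm R (cotangent (Q N)) (@hamiltonian R N)); last first.
    by have [tY _] := lift_vfield dQ sxi; exact: tangent_nonsm (tY _) nH.
  rewrite (lift_hamiltonian dQ sxi) // /lift_form.
  by rewrite (gauge_condition dQ hW lh hh hX sH (le i)) ?oppr0 //; exact: hJK.
pose xi i := PgS S W (eta i) q.
have Dxi i : D q (genQ (xi i) q) by have [_ []] := PgS_gS hW lh hh q (le i).
have lxi i : lie_algebra (xi i) by have [] := PgS_gS hW lh hh q (le i).
pose z := \sum_i c i *: xi i.
have lz : lie_algebra z by apply: tangent_sum => i; apply: tangentZ; exact: lxi.
have zE : genQ z q = \sum_i c i *: genQ (xi i) q by exact: genQ_sum.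
have Dz : D q (genQ z q).
  rewrite zE; apply: D_sum; first exact: D0.
  by move=> i; rewrite -[_ *: _]addr0; apply: D_lin => //; exact: D0.
(* The covector dual to the generator of [z] is a point of [M] over [q]; there the assumed relation
   says that this generator has norm zero. *)
have [m [mq [tz mz]]] := flat_in_M Dz.
have tzq : tangent q (genQ z q) by exact: genQ_tangent.
have z0 : z = 0.
  apply: (@genQ_inj R N S z q) => //; apply: (metric_definite tzq).
  have bq : base (Defs.incl m) = q by exact: mq.
  have e := mz (genQ z q); rewrite bq in e; rewrite -e // zE cov_sum; last first.
    by move=> i; rewrite bq; apply: tangentZ; exact: genQ_tangent.
  rewrite -[RHS](c0 m mq); apply: eq_bigr => i _.
  rewrite covZ ?bq; last exact: genQ_tangent.
  by rewrite (Jnh_E dQ) mq.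
pose y := \sum_i c i *: eta i.
have hy : h y.
  have -> : y = \sum_i c i *: (eta i - xi i).
    transitivity (y - z); first by rewrite z0 subr0.
    by rewrite /y /z -sumrB; apply: eq_bigr => i _; rewrite scalerBr.
  by apply: h_sum => // i; exact: (PgS_h hW lh hh q (le i)).
have yE : genQ y q0 = \sum_i c i *: b i.
  by rewrite genQ_sum; apply: eq_bigr => i _; have [_ ->] := etaP i.
(* By the choice of the [eta i], the generator of [y] at [q0] lies in [S], hence in [D], while an
   element of [h] generates a vector of [W]. *)
have y0 : y = 0.
  apply: (h_genQ_D hW lh hh (q := q0) hy).
  have : distS S q0 (genQ y q0) by rewrite bE yE; exists c.
  by case.
by apply: ib; rewrite -yE y0 /genQ push0.
Qed.
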